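(* Let $A$ be a ring, $R$ an $A$-algebra of finite type, $M$ a finitely presented $R$-module and $f:\operatorname{Spec}R\to\operatorname{Spec}A$ the induced map of schemes. 1. The following are equivalent: (a) $M$ is quasi-finite over $A$; (b) for all $\mathfrak p\in\operatorname{Spec}A$, $$d_{\mathfrak p}(M)=\dim_{k(\mathfrak p)}M(\mathfrak p)=\sum_{\mathfrak n\in f^{-1}(\mathfrak p)}\dim_{k(\mathfrak p)}M_{\mathfrak n}/\mathfrak pM_{\mathfrak n}<\infty;$$ (c) the induced map $A\to S:=R/\operatorname{Ann}_R(M)$ is quasi-finite. 2. (Zariski's main theorem for modules) The quasi-finite locus of $M$, $$\{\mathfrak n\in\operatorname{Spec}R\mid M\text{ is quasi-finite at }\mathfrak n\},$$ is open in $\operatorname{Spec}R$.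
   Context: Rings are commutative with unit. For $\mathfrak p\in\operatorname{Spec}A$, $k(\mathfrak p)=A_{\mathfrak p}/\mathfrak pA_{\mathfrak p}$, $M(\mathfrak p)=M\otimes_Ak(\mathfrak p)$ and $d_{\mathfrak p}(M)=\dim_{k(\mathfrak p)}M(\mathfrak p)$. $M$ is called quasi-finite at $\mathfrak n\in\operatorname{Spec}R$ (over $A$) if $\dim_{k(\mathfrak p)}M_{\mathfrak n}/\mathfrak pM_{\mathfrak n}<\infty$, where $\mathfrak p\in\operatorname{Spec}A$ is the prime lying under $\mathfrak n$; $M$ is quasi-finite over $A$ if it is quasi-finite at all $\mathfrak n\in\operatorname{Spec}R$. A finite type ring map $A\to S$ is quasi-finite if it is quasi-finite at every prime $\mathfrak n$ of $S$, i.e. $\dim_{k(\mathfrak p)}S_{\mathfrak n}/\mathfrak pS_{\mathfrak n}<\infty$ with $\mathfrak p$ the prime of $A$ under $\mathfrak n$. *)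

(* Defs.v *)
From HB Require Import structures.
From mathcomp Require Import all_boot all_order all_algebra.
From mathcomp Require Import all_classical all_reals ereal topology esum Rstruct ring.

Set Implicit Arguments.
Unset Strict Implicit.
Unset Printing Implicit Defensive.

Import Order.TTheory GRing.Theory Num.Theory.
Local Open Scope classical_set_scope.
Local Open Scope quotient_scope.
Local Open Scope ring_scope.

(* Rings are [comPzRingType]s: the zero ring is allowed, which is needed for
   R / Ann(M) when M = 0.  An A-algebra R is a ring morphism
   [phi : {rmorphism A -> R}]. *)

Record submod (A : comPzRingType) (M : lmodType A) := Submod {
  submod_fun : M -> bool;
  submod_closedP : submod_closed submod_fun }.

Definition submod_pred (A : comPzRingType) (M : lmodType A) (N : submod M) :
  {pred M} := submod_fun N.
Coercion submod_pred : submod >-> pred_sort.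

HB.instance Definition _ (A : comPzRingType) (M : lmodType A) (N : submod M) :=
  GRing.isSubmodClosed.Build A M (submod_pred N) (@submod_closedP A M N).

Notation ideal A := (submod A^o).

Section Generated.
Variables (A : comPzRingType) (M : lmodType A).

Definition span_pred (X : set M) : {pred M} :=
  fun m => `[< forall N : submod M, (forall x, X x -> x \in N) -> m \in N >].

Lemma span_closed X : submod_closed (span_pred X).
Proof.
split; first by apply/asboolP => N _; exact: rpred0.
move=> a x y /asboolP xX /asboolP yX; apply/asboolP => N XN.
by rewrite rpredD ?rpredZ ?xX ?yX.
Qed.

Definition span (X : set M) : submod M := Submod (span_closed X).

Definition ideal_mul (J : ideal A) : submod M :=
  span [set x | exists a m, a \in J /\ x = a *: m].

Definition ann_pred : {pred A^o} := fun a => `[< forall m : M, (a : A) *: m = 0 >].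

Lemma ann_closed : submod_closed ann_pred.
Proof.
split; first by apply/asboolP => m; rewrite scale0r.
move=> a x y /asboolP x0 /asboolP y0; apply/asboolP => m.
by rewrite scalerDl -scalerA x0 y0 scaler0 addr0.
Qed.

Definition ann : ideal A := Submod ann_closed.

End Generated.

Definition ideal_ext (A B : comPzRingType) (g : {rmorphism A -> B})
  (I : ideal A) : ideal B := span (M := B^o) [set g a | a in [set a : A | a \in I]].

Definition quotring (A : comPzRingType) (I : ideal A) : Type :=
  Quotient.quot (submod_pred I).
HB.instance Definition _ (A : comPzRingType) (I : ideal A) :=
  GRing.Zmodule.on (quotring I).

Section QuotRing.
Variables (A : comPzRingType) (I : ideal A).
Implicit Types x y : quotring I.

Definition quotring_pi (a : A) : quotring I := \pi_(Quotient.quot (submod_pred I)) (a : A^o).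

Lemma quotring_eqP (a b : A) :
  quotring_pi a = quotring_pi b <-> (a - b : A^o) \in I.
Proof.
rewrite /quotring_pi; split=> [/eqP|h].
  by rewrite -Quotient.idealrBE.
by apply/eqP; rewrite -Quotient.idealrBE.
Qed.

Definition quotring_repr x : A := repr (x : Quotient.quot (submod_pred I)).

Lemma quotring_reprK x : quotring_pi (quotring_repr x) = x.
Proof. exact: reprK. Qed.

Lemma quotring_piD : {morph quotring_pi : a b / a + b}.
Proof. by move=> a b; rewrite /quotring_pi !piE. Qed.

Lemma quotring_piB : {morph quotring_pi : a b / a - b}.
Proof. by move=> a b; rewrite /quotring_pi !piE. Qed.

Definition quotring_one : quotring I := quotring_pi 1.
Definition quotring_mul x y := quotring_pi (quotring_repr x * quotring_repr y).

Lemma quotring_piM (a b : A) :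
  quotring_mul (quotring_pi a) (quotring_pi b) = quotring_pi (a * b).
Proof.
apply/quotring_eqP.
set a' := quotring_repr _; set b' := quotring_repr _.
have ha : (a' - a : A^o) \in I by apply/quotring_eqP; rewrite quotring_reprK.
have hb : (b' - b : A^o) \in I by apply/quotring_eqP; rewrite quotring_reprK.
have -> : (a' * b' - a * b : A^o) = (b' : A) *: (a' - a : A^o) + a *: (b' - b : A^o).
  rewrite /GRing.scale/= mulrBr mulrBr [b' * a']mulrC [b' * a]mulrC.
  by rewrite addrA subrK.
by rewrite rpredD ?rpredZ.
Qed.

Lemma quotring_ind (P : quotring I -> Prop) :
  (forall a, P (quotring_pi a)) -> forall x, P x.
Proof. by move=> h x; rewrite -(quotring_reprK x). Qed.

Lemma quotring_mulA : associative quotring_mul.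
Proof.
elim/quotring_ind=> a; elim/quotring_ind=> b; elim/quotring_ind=> c.
by rewrite !quotring_piM mulrA.
Qed.

Lemma quotring_mulC : commutative quotring_mul.
Proof.
by elim/quotring_ind=> a; elim/quotring_ind=> b; rewrite !quotring_piM mulrC.
Qed.

Lemma quotring_mul1 : left_id quotring_one quotring_mul.
Proof. by elim/quotring_ind=> a; rewrite quotring_piM mul1r. Qed.

Lemma quotring_mulDl : left_distributive quotring_mul +%R.
Proof.
elim/quotring_ind=> a; elim/quotring_ind=> b; elim/quotring_ind=> c.
by rewrite -quotring_piD !quotring_piM -quotring_piD mulrDl.
Qed.

HB.instance Definition _ := GRing.Zmodule_isComPzRing.Build (quotring I)
  quotring_mulA quotring_mulC quotring_mul1 quotring_mulDl.

HB.instance Definition _ := GRing.isZmodMorphism.Build A (quotring I)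
  quotring_pi quotring_piB.

Lemma quotring_pi_monoid : monoid_morphism quotring_pi.
Proof. by split=> // a b; rewrite -quotring_piM. Qed.

HB.instance Definition _ := GRing.isMonoidMorphism.Build A (quotring I)
  quotring_pi quotring_pi_monoid.

End QuotRing.

(* M / JM with its (A / J)-module structure *)
Definition redmod (A : comPzRingType) (J : ideal A) (M : lmodType A) : Type :=
  Quotient.quot (submod_pred (ideal_mul M J)).
HB.instance Definition _ A J M := GRing.Zmodule.on (@redmod A J M).

Section RedMod.
Variables (A : comPzRingType) (J : ideal A) (M : lmodType A).

Definition redmod_pi (m : M) : redmod J M :=
  \pi_(Quotient.quot (submod_pred (ideal_mul M J))) m.

Lemma redmod_eqP (m n : M) :
  redmod_pi m = redmod_pi n <-> m - n \in ideal_mul M J.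
Proof.
rewrite /redmod_pi; split=> [/eqP|h].
  by rewrite -Quotient.idealrBE.
by apply/eqP; rewrite -Quotient.idealrBE.
Qed.

Definition redmod_repr (x : redmod J M) : M :=
  repr (x : Quotient.quot (submod_pred (ideal_mul M J))).

Lemma redmod_reprK x : redmod_pi (redmod_repr x) = x.
Proof. exact: reprK. Qed.

Lemma redmod_piD : {morph redmod_pi : a b / a + b}.
Proof. by move=> a b; rewrite /redmod_pi !piE. Qed.

Definition redmod_scale (k : quotring J) (x : redmod J M) : redmod J M :=
  redmod_pi (quotring_repr k *: redmod_repr x).

Lemma ideal_mulP (a : A) (m : M) : (a : A^o) \in J -> a *: m \in ideal_mul M J.
Proof. by move=> aJ; apply/asboolP => N; apply; exists a, m. Qed.

Lemma redmod_piZ (a : A) (m : M) :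
  redmod_scale (quotring_pi J a) (redmod_pi m) = redmod_pi (a *: m).
Proof.
apply/redmod_eqP; set a' := quotring_repr _; set m' := redmod_repr _.
have ha : (a' - a : A^o) \in J by apply/quotring_eqP; rewrite quotring_reprK.
have hm : m' - m \in ideal_mul M J by apply/redmod_eqP; rewrite redmod_reprK.
have -> : a' *: m' - a *: m = (a' - a) *: m' + a *: (m' - m).
  by rewrite scalerBl scalerBr addrA subrK.
by apply: rpredD; [exact: ideal_mulP|exact: rpredZ].
Qed.

Lemma redmod_ind (P : redmod J M -> Prop) :
  (forall m, P (redmod_pi m)) -> forall x, P x.
Proof. by move=> h x; rewrite -(redmod_reprK x). Qed.

Lemma redmod_scaleA a b v :
  redmod_scale a (redmod_scale b v) = redmod_scale (a * b) v.
Proof.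
elim/quotring_ind: a => a; elim/quotring_ind: b => b; elim/redmod_ind: v => m.
by rewrite -rmorphM !redmod_piZ scalerA.
Qed.

Lemma redmod_scale1 : left_id 1 redmod_scale.
Proof.
elim/redmod_ind=> m.
by rewrite -(rmorph1 (quotring_pi J)) redmod_piZ scale1r.
Qed.

Lemma redmod_scaleDr : right_distributive redmod_scale +%R.
Proof.
elim/quotring_ind=> a; elim/redmod_ind=> m; elim/redmod_ind=> n.
by rewrite -redmod_piD !redmod_piZ -redmod_piD scalerDr.
Qed.

Lemma redmod_scaleDl v : {morph redmod_scale^~ v : a b / a + b}.
Proof.
elim/quotring_ind=> a; elim/quotring_ind=> b; elim/redmod_ind: v => m.
by rewrite -rmorphD !redmod_piZ -redmod_piD scalerDl.
Qed.

HB.instance Definition _ := GRing.Zmodule_isLmodule.Build (quotring J)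
  (redmod J M) redmod_scaleA redmod_scale1 redmod_scaleDr redmod_scaleDl.

End RedMod.

Definition restr (A B : comPzRingType) (g : {rmorphism A -> B}) (M : lmodType B)
  : Type := M.
HB.instance Definition _ A B g M := GRing.Zmodule.on (@restr A B g M).

Section Restr.
Variables (A B : comPzRingType) (g : {rmorphism A -> B}) (M : lmodType B).

Definition restr_scale (a : A) (m : restr g M) : restr g M := g a *: (m : M).

Lemma restr_scaleA a b v : restr_scale a (restr_scale b v) = restr_scale (a * b) v.
Proof. by rewrite /restr_scale scalerA rmorphM. Qed.
Lemma restr_scale1 : left_id 1 restr_scale.
Proof. by move=> m; rewrite /restr_scale rmorph1 scale1r. Qed.
Lemma restr_scaleDr : right_distributive restr_scale +%R.
Proof. by move=> a m n; rewrite /restr_scale -scalerDr. Qed.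
Lemma restr_scaleDl v : {morph restr_scale^~ v : a b / a + b}.
Proof. by move=> a b; rewrite /restr_scale rmorphD scalerDl. Qed.

HB.instance Definition _ := GRing.Zmodule_isLmodule.Build A (restr g M)
  restr_scaleA restr_scale1 restr_scaleDr restr_scaleDl.

End Restr.

Record Spec (A : comPzRingType) := MkSpec {
  prime_ideal :> ideal A;
  prime_proper : (1 : A^o) \notin prime_ideal;
  prime_mul : forall a b : A, (a * b : A^o) \in prime_ideal ->
    (a : A^o) \in prime_ideal \/ (b : A^o) \in prime_ideal }.

HB.instance Definition _ A := gen_eqMixin (Spec A).
HB.instance Definition _ A := gen_choiceMixin (Spec A).

Section Zariski.
Variable A : comPzRingType.

(* Complements of the closed sets V(E) = {p | E is contained in p} *)
Definition zariski_open : set_system (Spec A) :=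
  [set U | exists E : set A, U = [set p : Spec A | ~ forall a, E a -> (a : A^o) \in p]].

Lemma zariski_openT : zariski_open setT.
Proof.
exists setT; apply/seteqP; split=> p //= _ h.
by have /negP := prime_proper p; apply; apply: h.
Qed.

Lemma zariski_openI : setI_closed zariski_open.
Proof.
move=> _ _ [E ->] [F ->].
exists [set x | exists a b, [/\ E a, F b & x = a * b]].
apply/seteqP; split=> p /=.
  move=> [/existsNP[a /not_implyP[Ea ap]] /existsNP[b /not_implyP[Fb bp]]] h.
  have /prime_mul[] // : (a * b : A^o) \in (p : ideal A) by apply: h; exists a, b.
move=> h; split=> k; apply: h => _ [a [b [Ea Fb ->]]].
  by rewrite mulrC; apply: (@rpredZ A A^o p b a); exact: k.
by apply: (@rpredZ A A^o p a b); exact: k.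
Qed.

Lemma zariski_open_bigU (I : Type) (f : I -> set (Spec A)) :
  (forall i, zariski_open (f i)) -> zariski_open (\bigcup_i f i).
Proof.
move=> /choice[E fE]; exists (\bigcup_i E i); apply/seteqP; split=> p /=.
  by move=> [i _]; rewrite fE /= => h k; apply: h => a Ea; apply: k; exists i.
move=> /existsNP[a /not_implyP[[i _ Ea] ap]]; exists i => //.
by rewrite fE /= => h; apply: ap; exact: h.
Qed.

HB.instance Definition _ := isOpenTopological.Build (Spec A)
  zariski_openT zariski_openI zariski_open_bigU.

End Zariski.

Section SpecMap.
Variables (A R : comPzRingType) (phi : {rmorphism A -> R}) (n : Spec R).

Definition contr_pred : {pred A^o} := fun a => (phi a : R^o) \in n.

Lemma contr_closed : submod_closed contr_pred.
Proof.
split; first by rewrite /in_mem /= /contr_pred rmorph0; exact: (@rpred0 R^o n).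
move=> a x y; rewrite /in_mem /= /contr_pred rmorphD rmorphM => xn yn.
by apply: (@rpredD R^o n) => //; apply: (@rpredZ R R^o n (phi a) (phi x)).
Qed.

Definition contr : ideal A := Submod contr_closed.

Lemma contr_proper : (1 : A^o) \notin contr.
Proof.
by rewrite /in_mem /= /contr_pred rmorph1; exact: prime_proper.
Qed.

Lemma contr_mul (a b : A) : (a * b : A^o) \in contr ->
  (a : A^o) \in contr \/ (b : A^o) \in contr.
Proof.
by rewrite /in_mem /= /contr_pred rmorphM; exact: prime_mul.
Qed.

Definition spec_map : Spec A := MkSpec contr_proper contr_mul.

End SpecMap.

Section LocMod.
Variables (A : comPzRingType) (p : Spec A).

Definition den := {s : A | (s : A^o) \notin p}.

Lemma den_mulP (s t : den) : (sval s * sval t : A^o) \notin p.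
Proof.
by apply/negP => /prime_mul[]; apply/negP; [exact: (valP s)|exact: (valP t)].
Qed.
Definition den1 : den := exist _ (1 : A) (prime_proper p).
Definition denM (s t : den) : den := exist _ (sval s * sval t) (den_mulP s t).

Variable M : lmodType A.

(* (m, s) represents m / s *)
Definition loc_rel (x y : M * den) : bool :=
  `[< exists u : den, sval u *: (sval y.2 *: x.1 - sval x.2 *: y.1) = 0 >].

Lemma loc_relP x y : reflect
  (exists u : den, (sval u * sval y.2) *: x.1 = (sval u * sval x.2) *: y.1)
  (loc_rel x y).
Proof.
apply: (iffP (asboolP _)) => -[u hu]; exists u.
  by apply/eqP; rewrite -subr_eq0 -!scalerA -scalerBr hu.
by rewrite scalerBr !scalerA hu subrr.
Qed.

Lemma loc_rel_equiv : equiv_class_of loc_rel.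
Proof.
split=> [x|x y|y x z].
- by apply/loc_relP; exists den1.
- by apply/idP/idP => /loc_relP[u hu]; apply/loc_relP; exists u; rewrite hu.
- move=> /loc_relP[u hu] /loc_relP[v hv]; apply/loc_relP.
  exists (denM (denM u v) y.2) => /=.
  have -> : sval u * sval v * sval y.2 * sval z.2
          = (sval v * sval z.2) * (sval u * sval y.2) by ring.
  have -> : sval u * sval v * sval y.2 * sval x.2
          = (sval u * sval x.2) * (sval v * sval y.2) by ring.
  rewrite -scalerA hu -[RHS]scalerA -hv !scalerA.
  by congr (_ *: _); ring.
Qed.

Canonical loc_equiv := EquivRelPack loc_rel_equiv.
Canonical loc_encModRel := defaultEncModRel loc_rel.

Definition locmod : Type := {eq_quot loc_rel}.
HB.instance Definition _ := Choice.on locmod.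

Definition loc_frac (m : M) (s : den) : locmod := \pi_{eq_quot loc_rel} (m, s).

Lemma loc_eqP m s n t : loc_frac m s = loc_frac n t <->
  exists u : den, (sval u * sval t) *: m = (sval u * sval s) *: n.
Proof.
rewrite /loc_frac; split=> [/eqP|h].
  by rewrite piE => /loc_relP.
by apply/eqP; rewrite piE; apply/loc_relP.
Qed.

Definition loc_num (x : locmod) : M := (repr (x : {eq_quot loc_rel})).1.
Definition loc_den (x : locmod) : den := (repr (x : {eq_quot loc_rel})).2.

Lemma loc_fracK x : loc_frac (loc_num x) (loc_den x) = x.
Proof. by rewrite /loc_frac /loc_num /loc_den -surjective_pairing; exact: reprK. Qed.

Lemma loc_ind (P : locmod -> Prop) :
  (forall m s, P (loc_frac m s)) -> forall x, P x.
Proof. by move=> h x; rewrite -(loc_fracK x). Qed.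

Lemma loc_repr_eq m s : exists u : den,
  (sval u * sval s) *: loc_num (loc_frac m s) =
  (sval u * sval (loc_den (loc_frac m s))) *: m.
Proof. by apply/loc_eqP; rewrite loc_fracK. Qed.

Definition loc_zero : locmod := loc_frac 0 den1.
Definition loc_opp (x : locmod) := loc_frac (- loc_num x) (loc_den x).
Definition loc_add (x y : locmod) :=
  loc_frac (sval (loc_den y) *: loc_num x + sval (loc_den x) *: loc_num y)
           (denM (loc_den x) (loc_den y)).

Lemma loc_addE m s n t : loc_add (loc_frac m s) (loc_frac n t) =
  loc_frac (sval t *: m + sval s *: n) (denM s t).
Proof.
apply/loc_eqP; have [u hu] := loc_repr_eq m s; have [v hv] := loc_repr_eq n t.
move: hu hv; set m' := loc_num _; set s' := loc_den _.
set n' := loc_num _; set t' := loc_den _ => hu hv.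
exists (denM u v) => /=; rewrite !scalerDr !scalerA; congr (_ + _).
- have -> : sval u * sval v * (sval s * sval t) * sval t'
          = (sval v * sval t * sval t') * (sval u * sval s) by ring.
  by rewrite -scalerA hu scalerA; congr (_ *: _); ring.
- have -> : sval u * sval v * (sval s * sval t) * sval s'
          = (sval u * sval s * sval s') * (sval v * sval t) by ring.
  by rewrite -scalerA hv scalerA; congr (_ *: _); ring.
Qed.

Lemma loc_oppE m s : loc_opp (loc_frac m s) = loc_frac (- m) s.
Proof.
apply/loc_eqP; have [u hu] := loc_repr_eq m s.
by exists u; rewrite !scalerN hu.
Qed.

Lemma loc_addA : associative loc_add.
Proof.
elim/loc_ind=> m s; elim/loc_ind=> n t; elim/loc_ind=> k r.
rewrite !loc_addE; apply/loc_eqP; exists den1 => /=.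
rewrite !scalerDr !scalerA !addrA; congr (_ + _ + _); congr (_ *: _); ring.
Qed.

Lemma loc_addC : commutative loc_add.
Proof.
elim/loc_ind=> m s; elim/loc_ind=> n t.
rewrite !loc_addE; apply/loc_eqP; exists den1 => /=.
by rewrite addrC [sval s * sval t]mulrC.
Qed.

Lemma loc_add0 : left_id loc_zero loc_add.
Proof.
elim/loc_ind=> m s; rewrite loc_addE; apply/loc_eqP; exists den1 => /=.
by rewrite scaler0 add0r scale1r !mul1r.
Qed.

Lemma loc_addN : left_inverse loc_zero loc_opp loc_add.
Proof.
elim/loc_ind=> m s; rewrite loc_oppE loc_addE; apply/loc_eqP; exists den1 => /=.
by rewrite scalerN addNr !scaler0.
Qed.

HB.instance Definition _ := GRing.isZmodule.Build locmod
  loc_addA loc_addC loc_add0 loc_addN.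

Lemma loc_fracD m s n t : loc_frac m s + loc_frac n t =
  loc_frac (sval t *: m + sval s *: n) (denM s t).
Proof. exact: loc_addE. Qed.

Lemma loc_frac_same m n s : loc_frac m s + loc_frac n s = loc_frac (m + n) s.
Proof.
rewrite loc_fracD; apply/loc_eqP; exists den1 => /=.
by rewrite scalerDr scalerDr !scalerA; congr (_ *: _ + _ *: _); ring.
Qed.

End LocMod.

Section LocScale.
Variables (A : comPzRingType) (p : Spec A).

Section Scale.
Variable M : lmodType A.

Definition loc_scale (a : locmod p A^o) (x : locmod p M) : locmod p M :=
  loc_frac ((loc_num a : A) *: loc_num x) (denM (loc_den a) (loc_den x)).

Lemma loc_scaleE (a : A) s (m : M) t :
  loc_scale (loc_frac (a : A^o) s) (loc_frac m t) = loc_frac (a *: m) (denM s t).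
Proof.
apply/loc_eqP.
have [u] := loc_repr_eq (a : A^o) s; have [v] := loc_repr_eq m t.
set m' := loc_num _; set t' := loc_den _.
set a' := loc_num _; set s' := loc_den _ => hv hu.
have {}hu : sval u * sval s * a' = sval u * sval s' * a := hu.
exists (denM u v) => /=; rewrite !scalerA.
have -> : sval u * sval v * (sval s * sval t) * a'
        = (sval u * sval s * a') * (sval v * sval t) by ring.
by rewrite hu -scalerA hv scalerA; congr (_ *: _); ring.
Qed.

Lemma loc_scaleDr : right_distributive loc_scale +%R.
Proof.
elim/loc_ind=> a s; elim/loc_ind=> m t; elim/loc_ind=> n r.
rewrite loc_fracD !loc_scaleE loc_fracD; apply/loc_eqP; exists (den1 p) => /=.
by rewrite !scalerDr !scalerA; congr (_ *: _ + _ *: _); ring.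
Qed.

Lemma loc_scaleDl v : {morph loc_scale^~ v : a b / a + b}.
Proof.
move: v; elim/loc_ind=> m t; elim/loc_ind=> a s; elim/loc_ind=> b r.
rewrite loc_fracD !loc_scaleE loc_fracD; apply/loc_eqP; exists (den1 p) => /=.
have E (x : A) (y : A^o) : x *: y = x * y :> A by [].
by rewrite !E !scalerDr !scalerA -!scalerDl; congr (_ *: _); ring.
Qed.

Lemma loc_scale1 : left_id (loc_frac (1 : A^o) (den1 p)) loc_scale.
Proof.
elim/loc_ind=> m s; rewrite loc_scaleE; apply/loc_eqP; exists (den1 p) => /=.
by rewrite scale1r !mul1r.
Qed.

End Scale.

Lemma loc_scaleA (M : lmodType A) a b (v : locmod p M) :
  loc_scale a (loc_scale b v) = loc_scale (loc_scale a b) v.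
Proof.
move: a b v; elim/loc_ind=> a s; elim/loc_ind=> b r; elim/loc_ind=> m t.
rewrite (@loc_scaleE A^o a s b r) (loc_scaleE b r) !loc_scaleE; apply/loc_eqP; exists (den1 p) => /=.
have E (x : A) (y : A^o) : x *: y = x * y :> A by [].
by rewrite !E !scalerA; congr (_ *: _); ring.
Qed.

Lemma loc_mulC : commutative (@loc_scale A^o).
Proof.
elim/loc_ind=> a s; elim/loc_ind=> b r.
rewrite (@loc_scaleE A^o a s b r) (@loc_scaleE A^o b r a s); apply/loc_eqP; exists (den1 p) => /=.
have E (x : A) (y : A^o) : x *: y = x * y :> A by [].
by rewrite !E; ring.
Qed.

Definition locring : Type := locmod p A^o.
HB.instance Definition _ := GRing.Zmodule.on locring.
HB.instance Definition _ := GRing.Zmodule_isComPzRing.Build locring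
  (@loc_scaleA A^o) loc_mulC (@loc_scale1 A^o)
  (fun x y z => @loc_scaleDl A^o z x y).

HB.instance Definition _ (M : lmodType A) := GRing.Zmodule_isLmodule.Build
  locring (locmod p M) (@loc_scaleA M) (@loc_scale1 M) (@loc_scaleDr M)
  (@loc_scaleDl M).

Definition loc_inj (a : A) : locring := loc_frac (a : A^o) (den1 p).

Lemma loc_injB : zmod_morphism loc_inj.
Proof.
move=> a b; apply: (canRL (addrK _)).
by rewrite /loc_inj [LHS]loc_frac_same subrK.
Qed.

HB.instance Definition _ := GRing.isZmodMorphism.Build A locring loc_inj loc_injB.

Lemma loc_inj_monoid : monoid_morphism loc_inj.
Proof.
split=> // a b; rewrite /loc_inj; symmetry.
apply: etrans (loc_scaleE _ _ _ _) _; apply/loc_eqP; exists (den1 p) => /=.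
have E (x : A) (y : A^o) : x *: y = x * y :> A by [].
by rewrite !E; ring.
Qed.

HB.instance Definition _ := GRing.isMonoidMorphism.Build A locring loc_inj
  loc_inj_monoid.

End LocScale.

(* k(p) = A_p / pA_p, with pA_p the ideal generated by the image of p.  Only its
   ring structure is declared; [residue_nontrivial] and [residue_inverse] below
   show that it is a field. *)
Definition max_ideal (A : comPzRingType) (p : Spec A) : ideal (locring p) :=
  ideal_ext (loc_inj p) p.
Definition residue (A : comPzRingType) (p : Spec A) : comPzRingType :=
  quotring (max_ideal p).
Definition to_residue (A : comPzRingType) (p : Spec A) :
  {rmorphism A -> residue p} := quotring_pi (max_ideal p) \o loc_inj p.

Section ResidueField.
Variables (A : comPzRingType) (p : Spec A).

Lemma loc_num_prime (a : A) (s : den p) :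
  ((loc_num (loc_frac (a : A^o) s) : A^o) \in p) = ((a : A^o) \in p).
Proof.
have [u] := loc_repr_eq (a : A^o) s; set a' := loc_num _; set s' := loc_den _.
move=> h; have {}h : sval u * sval s * a' = sval u * sval s' * a := h.
apply/idP/idP => hp.
- have : (sval (denM u s') * a : A^o) \in p.
    by rewrite /= -h; apply: (@rpredZ A A^o p (_ : A) a').
  by move=> /prime_mul[] //; move/negP: (valP (denM u s')).
- have : (sval (denM u s) * a' : A^o) \in p.
    by rewrite /= h; apply: (@rpredZ A A^o p (_ : A) a).
  by move=> /prime_mul[] //; move/negP: (valP (denM u s)).
Qed.

Definition loc_prime_pred (x : (locring p)^o) : bool := (loc_num x : A^o) \in p.

Lemma loc_prime_closed : submod_closed loc_prime_pred.
Proof.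
split; first by rewrite /in_mem /= /loc_prime_pred loc_num_prime; exact: (@rpred0 A^o p).
move=> x y z; rewrite /in_mem /=; move: x y z.
elim/loc_ind=> a s; elim/loc_ind=> b t; elim/loc_ind=> c r.
have -> : (loc_frac a s : locring p) *: (loc_frac b t : (locring p)^o)
            + (loc_frac c r : (locring p)^o)
        = loc_frac (sval r *: ((a : A) *: b) + (sval s * sval t) *: c)
            (denM (denM s t) r).
  apply: etrans (congr1 (fun x => x + _) (loc_scaleE _ _ _ _)) _.
  exact: loc_fracD.
rewrite /loc_prime_pred !loc_num_prime => hb hc.
by apply: (@rpredD A^o p); do ?apply: (@rpredZ A A^o p).
Qed.

Lemma max_idealP (a : A) (s : den p) :
  (loc_frac (a : A^o) s : (locring p)^o) \in max_ideal p <-> (a : A^o) \in p.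
Proof.
split=> [/asboolP/(_ (Submod loc_prime_closed)) h|ap].
  have : (loc_frac (a : A^o) s : (locring p)^o) \in Submod loc_prime_closed.
    by apply: h => _ [b bp <-]; rewrite /in_mem /= /loc_prime_pred loc_num_prime.
  by rewrite /in_mem /= /loc_prime_pred loc_num_prime.
apply/asboolP => N hN.
have -> : (loc_frac (a : A^o) s : (locring p)^o)
        = (loc_frac (1 : A^o) s : locring p) *: (loc_inj p a : (locring p)^o).
  apply: etrans (esym (loc_scaleE _ _ _ _)).
  apply/loc_eqP; exists (den1 p) => /=.
  have E (x : A) (y : A^o) : x *: y = x * y :> A by [].
  by rewrite !E; ring.
by apply: rpredZ; apply: hN; exists a.
Qed.

Lemma residue_nontrivial : (1 : residue p) <> 0.
Proof.
rewrite -(rmorph1 (quotring_pi (max_ideal p))) -(rmorph0 (quotring_pi (max_ideal p))).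
move=> /quotring_eqP; rewrite subr0 => /max_idealP.
exact/negP/prime_proper.
Qed.

Lemma residue_inverse (x : residue p) : x <> 0 -> exists y, y * x = 1.
Proof.
elim/quotring_ind: x; elim/loc_ind=> a s x0.
have ap : (a : A^o) \notin p.
  apply/negP => /(max_idealP _ s) h; apply: x0.
  rewrite -(rmorph0 (quotring_pi (max_ideal p))); apply/quotring_eqP.
  by rewrite subr0.
exists (quotring_pi _ (loc_frac (sval s : A^o) (exist _ a ap : den p) : locring p)).
rewrite -rmorphM -(rmorph1 (quotring_pi _)); congr quotring_pi.
apply: etrans (loc_scaleE _ _ _ _) _; apply/loc_eqP; exists (den1 p) => /=.
have E (x : A) (y : A^o) : x *: y = x * y :> A by [].
by rewrite !E; ring.
Qed.

End ResidueField.

Section LocMap.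
Variables (A R : comPzRingType) (phi : {rmorphism A -> R}) (n : Spec R).
Local Notation p := (spec_map phi n).

Lemma den_mapP (s : den p) : (phi (sval s) : R^o) \notin n.
Proof. exact: (valP s). Qed.
Definition den_map (s : den p) : den n := exist _ (phi (sval s)) (den_mapP s).

Definition loc_map (x : locring p) : locring n :=
  loc_frac (phi (loc_num x) : R^o) (den_map (loc_den x)).

Lemma loc_mapE (a : A) s :
  loc_map (loc_frac (a : A^o) s) = loc_frac (phi a : R^o) (den_map s).
Proof.
apply/loc_eqP; have [u hu] := loc_repr_eq (a : A^o) s.
exists (den_map u) => /=; move/(congr1 phi): hu.
by rewrite /GRing.scale/= !rmorphM.
Qed.

Lemma loc_map_zmod : zmod_morphism loc_map.
Proof.
move=> x y; apply: (canRL (addrK _)).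
rewrite -{2}(subrK y x); move: (x - y) => {x} x; move: x y.
elim/loc_ind=> a s; elim/loc_ind=> b t.
rewrite [X in _ = loc_map X]loc_fracD !loc_mapE [LHS]loc_fracD; apply/loc_eqP.
by exists (den1 n); rewrite /GRing.scale/= rmorphD !rmorphM; ring.
Qed.

HB.instance Definition _ := GRing.isZmodMorphism.Build (locring p) (locring n)
  loc_map loc_map_zmod.

Lemma loc_map_monoid : monoid_morphism loc_map.
Proof.
split.
  apply: etrans (loc_mapE _ _) _; apply/loc_eqP.
  by exists (den1 n); rewrite /GRing.scale/= !rmorph1.
elim/loc_ind=> a s; elim/loc_ind=> b t.
apply: etrans (congr1 loc_map (loc_scaleE _ _ _ _)) _.
rewrite !loc_mapE [RHS]loc_scaleE.
by apply/loc_eqP; exists (den1 n); rewrite /GRing.scale/= !rmorphM.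
Qed.

HB.instance Definition _ := GRing.isMonoidMorphism.Build (locring p) (locring n)
  loc_map loc_map_monoid.

End LocMap.

Arguments loc_map {A R} phi n x.

(* M (x)_A B as a B-module *)
Section Tensor.
Variables (A B : comPzRingType) (g : {rmorphism A -> B}) (M : lmodType A).

(* A finite sequence of pairs (m_i, b_i) represents the formal sum of the
   m_i (x) b_i.  As (0, b) is identified with the empty sum, the monoid of
   classes is a group. *)
Inductive tens_eq : seq (M * B) -> seq (M * B) -> Prop :=
| tens_refl s : tens_eq s s
| tens_sym s t : tens_eq s t -> tens_eq t s
| tens_trans s t r : tens_eq s t -> tens_eq t r -> tens_eq s r
| tens_cat s s' t t' : tens_eq s s' -> tens_eq t t' ->
    tens_eq (s ++ t) (s' ++ t')
| tens_catC s t : tens_eq (s ++ t) (t ++ s)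
| tens_0l b : tens_eq [:: (0, b)] [::]
| tens_Dl m m' b : tens_eq [:: (m + m', b)] [:: (m, b); (m', b)]
| tens_Dr m b b' : tens_eq [:: (m, b + b')] [:: (m, b); (m, b')]
| tens_Zl a m b : tens_eq [:: (a *: m, b)] [:: (m, g a * b)].

Definition tens_rel (s t : seq (M * B)) : bool := `[< tens_eq s t >].

Lemma tens_rel_equiv : equiv_class_of tens_rel.
Proof.
split=> [s|s t|t s r].
- by apply/asboolP; exact: tens_refl.
- by apply/asboolP/asboolP; exact: tens_sym.
- by move=> /asboolP h /asboolP k; apply/asboolP; exact: tens_trans h k.
Qed.

Canonical tens_equiv := EquivRelPack tens_rel_equiv.
Canonical tens_encModRel := defaultEncModRel tens_rel.

Definition tensor : Type := {eq_quot tens_rel}.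
HB.instance Definition _ := Choice.on tensor.

Definition tens_pi (s : seq (M * B)) : tensor := \pi_{eq_quot tens_rel} s.
Definition tens_repr (x : tensor) : seq (M * B) :=
  repr (x : {eq_quot tens_rel}).

Lemma tens_reprK x : tens_pi (tens_repr x) = x.
Proof. exact: reprK. Qed.

Lemma tens_eqP s t : tens_pi s = tens_pi t <-> tens_eq s t.
Proof.
rewrite /tens_pi; split=> [/eqP|h].
  by rewrite piE => /asboolP.
by apply/eqP; rewrite piE; apply/asboolP.
Qed.

Lemma tens_reprP s : tens_eq (tens_repr (tens_pi s)) s.
Proof. by apply/tens_eqP; rewrite tens_reprK. Qed.

Lemma tens_ind (P : tensor -> Prop) :
  (forall s, P (tens_pi s)) -> forall x, P x.
Proof. by move=> h x; rewrite -(tens_reprK x). Qed.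

Definition tens_map_opp (s : seq (M * B)) := [seq (- x.1, x.2) | x <- s].
Definition tens_map_mul (b : B) (s : seq (M * B)) := [seq (x.1, b * x.2) | x <- s].

Lemma tens_map_opp_eq s t :
  tens_eq s t -> tens_eq (tens_map_opp s) (tens_map_opp t).
Proof.
elim=> {s t} /=.
- by move=> s; exact: tens_refl.
- by move=> s t _; exact: tens_sym.
- by move=> s t r _ h _; exact: tens_trans h.
- by move=> s s' t t' _ h _ k; rewrite /tens_map_opp !map_cat; exact: tens_cat.
- by move=> s t; rewrite /tens_map_opp !map_cat; exact: tens_catC.
- by move=> b; rewrite oppr0; exact: tens_0l.
- by move=> m m' b; rewrite opprD; exact: tens_Dl.
- by move=> m b b'; exact: tens_Dr.
- by move=> a m b; rewrite -scalerN; exact: tens_Zl.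
Qed.

Lemma tens_map_mul_eq c s t :
  tens_eq s t -> tens_eq (tens_map_mul c s) (tens_map_mul c t).
Proof.
elim=> {s t} /=.
- by move=> s; exact: tens_refl.
- by move=> s t _; exact: tens_sym.
- by move=> s t r _ h _; exact: tens_trans h.
- by move=> s s' t t' _ h _ k; rewrite /tens_map_mul !map_cat; exact: tens_cat.
- by move=> s t; rewrite /tens_map_mul !map_cat; exact: tens_catC.
- by move=> b; exact: tens_0l.
- by move=> m m' b; exact: tens_Dl.
- by move=> m b b'; rewrite mulrDr; exact: tens_Dr.
- by move=> a m b; rewrite mulrCA; exact: tens_Zl.
Qed.

Definition tens_zero : tensor := tens_pi [::].
Definition tens_add (x y : tensor) := tens_pi (tens_repr x ++ tens_repr y).
Definition tens_opp (x : tensor) := tens_pi (tens_map_opp (tens_repr x)).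
Definition tens_scale (b : B) (x : tensor) :=
  tens_pi (tens_map_mul b (tens_repr x)).

Lemma tens_addE s t : tens_add (tens_pi s) (tens_pi t) = tens_pi (s ++ t).
Proof. by apply/tens_eqP; apply: tens_cat; exact: tens_reprP. Qed.

Lemma tens_oppE s : tens_opp (tens_pi s) = tens_pi (tens_map_opp s).
Proof. by apply/tens_eqP; apply: tens_map_opp_eq; exact: tens_reprP. Qed.

Lemma tens_scaleE b s : tens_scale b (tens_pi s) = tens_pi (tens_map_mul b s).
Proof. by apply/tens_eqP; apply: tens_map_mul_eq; exact: tens_reprP. Qed.

Lemma tens_addA : associative tens_add.
Proof.
elim/tens_ind=> s; elim/tens_ind=> t; elim/tens_ind=> r.
by rewrite !tens_addE catA.
Qed.

Lemma tens_addC : commutative tens_add.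
Proof.
elim/tens_ind=> s; elim/tens_ind=> t; rewrite !tens_addE.
by apply/tens_eqP; exact: tens_catC.
Qed.

Lemma tens_add0 : left_id tens_zero tens_add.
Proof. by elim/tens_ind=> s; rewrite tens_addE. Qed.

Lemma tens_addN : left_inverse tens_zero tens_opp tens_add.
Proof.
elim/tens_ind=> s; rewrite tens_oppE tens_addE; apply/tens_eqP.
elim: s => [|[m b] s ih] /=; first exact: tens_refl.
apply: (@tens_trans _ ([:: (- m, b); (m, b)] ++ (tens_map_opp s ++ s))).
  change (tens_eq
    ([:: (- m, b)] ++ (tens_map_opp s ++ ([:: (m, b)] ++ s)))
    ([:: (- m, b)] ++ ([:: (m, b)] ++ (tens_map_opp s ++ s)))).
  apply: tens_cat; first exact: tens_refl.
  rewrite !catA; apply: tens_cat; last exact: tens_refl.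
  exact: tens_catC.
apply: (@tens_trans _ ([::] ++ [::])); last exact: tens_refl.
apply: tens_cat => //; apply: tens_trans (tens_sym (tens_Dl _ _ _)) _.
by rewrite addNr; exact: tens_0l.
Qed.

HB.instance Definition _ := GRing.isZmodule.Build tensor
  tens_addA tens_addC tens_add0 tens_addN.

Lemma tens_scaleA a b v : tens_scale a (tens_scale b v) = tens_scale (a * b) v.
Proof.
elim/tens_ind: v => s; rewrite !tens_scaleE; congr tens_pi.
by rewrite /tens_map_mul -map_comp; apply: eq_map => x /=; rewrite mulrA.
Qed.

Lemma tens_scale1 : left_id 1 tens_scale.
Proof.
elim/tens_ind=> s; rewrite tens_scaleE; congr tens_pi.
by rewrite -[RHS]map_id; apply: eq_map => -[m b] /=; rewrite mul1r.
Qed.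

Lemma tens_scaleDr : right_distributive tens_scale +%R.
Proof.
move=> b; elim/tens_ind=> s; elim/tens_ind=> t.
have D u v : tens_pi u + tens_pi v = tens_pi (u ++ v) := tens_addE u v.
by rewrite D !tens_scaleE D /tens_map_mul map_cat.
Qed.

Lemma tens_scaleDl v : {morph tens_scale^~ v : a b / a + b}.
Proof.
elim/tens_ind: v => s a b.
have D u v : tens_pi u + tens_pi v = tens_pi (u ++ v) := tens_addE u v.
rewrite !tens_scaleE D; elim: s => [|[m c] s ih] //=.
have S x u : tens_pi (x :: u) = tens_pi [:: x] + tens_pi u by rewrite D.
rewrite S ih [RHS]S -!D [X in _ = _ + (_ + X)]S [X in _ = _ + X]addrCA [RHS]addrA.
congr (_ + _).
by rewrite mulrDl D; apply/tens_eqP; exact: tens_Dr.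
Qed.

HB.instance Definition _ := GRing.Zmodule_isLmodule.Build B tensor
  tens_scaleA tens_scale1 tens_scaleDr tens_scaleDl.

End Tensor.

Section Dimension.
Variables (k : comPzRingType) (V : lmodType k).

Definition is_basis (n : nat) (e : 'I_n -> V) : Prop :=
  (forall v, exists c : 'I_n -> k, v = \sum_i c i *: e i) /\
  (forall c : 'I_n -> k, \sum_i c i *: e i = 0 -> forall i, c i = 0).

(* The cardinality of a finite basis, and +oo if there is none.  In every
   use below k is a field, so the cardinality is unique. *)
Definition vdim : \bar Rdefinitions.R :=
  xget +oo%E [set (n%:R)%:E | n in [set n | exists e : 'I_n -> V, is_basis e]].

End Dimension.

(* R is the smallest A-subalgebra of R containing some finite subset. *)
Definition finite_type (A R : comPzRingType) (phi : {rmorphism A -> R}) : Prop :=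
  exists s : seq R, forall S : R -> bool, subring_closed S ->
    (forall a, S (phi a)) -> (forall x, x \in s -> S x) -> forall x, S x.

(* M is the cokernel of K : R^m -> R^n (acting on row vectors): it is generated
   by the e i and the rows of K generate the relations between them. *)
Definition finitely_presented (R : comPzRingType) (M : lmodType R) : Prop :=
  exists (m n : nat) (e : 'I_n -> M) (K : 'M[R]_(m, n)),
    (forall x, exists c : 'rV[R]_n, x = \sum_i c 0 i *: e i) /\
    (forall c : 'rV[R]_n, \sum_i c 0 i *: e i = 0 <->
       exists d : 'rV[R]_m, c = d *m K).

Section QuasiFinite.
Variables (A R : comPzRingType) (phi : {rmorphism A -> R}) (M : lmodType R).

(* d_p(M) = dim_{k(p)} M (x)_A k(p) *)
Definition fiber_dim (p : Spec A) : \bar Rdefinitions.R :=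
  vdim (tensor (to_residue p) (restr phi M)).

(* dim_{k(p)} M_n / pM_n, where p lies under n: pM_n = (pA_p)M_n, with M_n an
   A_p-module through A_p -> R_n. *)
Definition local_fiber_dim (n : Spec R) : \bar Rdefinitions.R :=
  vdim (redmod (max_ideal (spec_map phi n)) (restr (loc_map phi n) (locmod n M))).

Definition quasi_finite_at (n : Spec R) : Prop := (local_fiber_dim n < +oo)%E.
Definition quasi_finite : Prop := forall n, quasi_finite_at n.

End QuasiFinite.

Definition quasi_finite_map (A S : comPzRingType) (psi : {rmorphism A -> S}) :
  Prop := finite_type psi /\ quasi_finite psi S^o.

(* Main.v *)
Require Import Defs.
From HB Require Import structures.
From mathcomp Require Import all_boot all_order all_algebra.
From mathcomp Require Import all_classical all_reals ereal topology esum Rstruct.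
From mathcomp Require Import ring zify.
Import Order.TTheory GRing.Theory Num.Theory.
Local Open Scope classical_set_scope.
Local Open Scope ring_scope.
Set Implicit Arguments.
Unset Strict Implicit.
Unset Printing Implicit Defensive.

(** Write V = M (x) k(p) for the fibre over a prime p of A, and W = M_n/pM_n for
    the local fibre at a prime n of R over p.

    Everything rests on an elementwise form of quasi-finiteness, [algebraic_at]:
    modulo pM and after multiplication by some t outside n, the element x of R
    satisfies on M a polynomial equation whose coefficients come from A and are
    not all in p.  If W has finite dimension this holds for all x, since the
    powers of x, applied to finitely many generators of M, are linearly
    dependent in W ([quasi_finite_algebraic_at]).  Conversely it is enough to
    know it for elements that generate R up to denominators outside n: the
    monomials in them, applied to the generators of M, span a finite dimensional
    stable subspace U of W; an element outside n is injective on U, hence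
    bijective, so U is also stable under the inverses of such elements and is
    all of W ([algebraic_at_quasi_finite]).

    (a) => (b).  For fixed x, the t in R with f(x) t V = 0 for some nonzero
    polynomial f over k(p) form an ideal which lies in no prime over p, hence
    contains the image of an element of A outside p.  So x is algebraic on V and
    V has finite dimension ([fiber_basis]).  The kernel of V -> W consists of the
    vectors killed by an element outside n, and the map is onto ([localize_eq0],
    [localize_surj]).  Two different primes over p are separated by an operator
    on V: a polynomial equation for x factors as x^i u = 0, where u lies outside
    every prime over p that contains x ([fitting]).  As in the Chinese remainder
    theorem, V is then the direct sum of its localizations
    ([support_decomposition]).

    (a) <=> (c).  If z M is contained in pM, the determinant trick gives a power
    of z in pR + Ann M; so algebraicity on M and on R / Ann M are the same.

    Openness.  Let D be the image of A in S = R / Ann M.  Zariski's main theorem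
    ([zariski_main]) gives g outside n, integral over D, such that each s in S
    becomes integral over D after multiplication by a power of g.  Wherever g
    does not vanish, R is generated up to powers of g by g and elements g^k y
    that are integral, hence algebraic, and the criterion above applies.

    Zariski's main theorem is proved as by Peskine.  Induction on the number of
    generators reduces it to a ring S finite over D[x] with D integrally closed
    in S.  Let J be the conductor of S into D[x].  If J is not contained in q,
    then up to an element outside q one computes in D[x], where an equation for
    x with a coefficient outside q can be lowered until it gives a fraction
    ([root_descent], [zmt_conductor]).  If J is contained in q, take a prime n
    below q minimal over J.  The key lemma [conductor_lead] makes x
    transcendental over D modulo n, and it remains to see that x cannot then be
    algebraic modulo q ([transcendental_not_residually_algebraic]).  Instead of
    going-down for normal domains, this uses a valuation ring of the fraction
    field of S/n centred at q: its trace on the fraction field K of D is a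
    valuation ring over which Gauss's lemma controls the coefficients of minimal
    polynomials over K(x). *)

(** * Subrings, integral elements and generated subalgebras *)

(** Subrings are kept as boolean predicates on the ambient ring, so that nested
    subrings and polynomials over them live in one type. *)
Record subring (S : comNzRingType) := Subring {
  subring_fun : S -> bool;
  subring_closedP : subring_closed subring_fun }.

Definition subring_pred (S : comNzRingType) (D : subring S) : {pred S} :=
  subring_fun D.
Coercion subring_pred : subring >-> pred_sort.
Arguments subring_pred : simpl never.

HB.instance Definition _ (S : comNzRingType) (D : subring S) :=
  GRing.isSubringClosed.Build S (subring_pred D) (@subring_closedP S D).

Record subring_sort (S : comNzRingType) (D : subring S) := SubringSort {
  subring_val :> S;
  subring_valP : subring_val \in D }.

HB.instance Definition _ (S : comNzRingType) (D : subring S) :=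
  [isSub for @subring_val S D].
HB.instance Definition _ (S : comNzRingType) (D : subring S) :=
  [Choice of subring_sort D by <:].
HB.instance Definition _ (S : comNzRingType) (D : subring S) :=
  [SubChoice_isSubComNzRing of subring_sort D by <:].

Section Integral.
Variables (S : comNzRingType).
Implicit Types D E : subring S.

Lemma polyOver_lift D p : p \is a polyOver D ->
  exists p0 : {poly subring_sort D}, map_poly val p0 = p.
Proof.
move=> /polyOverP pD.
exists (\poly_(i < size p) (SubringSort (pD i) : subring_sort D)).
apply/polyP => i; rewrite coef_map coef_poly /=.
by case: ltnP => // h; rewrite nth_default.
Qed.

Lemma polyOver_val D (p0 : {poly subring_sort D}) : map_poly val p0 \is a polyOver D.
Proof. by apply/polyOverP => i; rewrite coef_map; exact: subring_valP. Qed.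

Lemma map_val_monic D (p0 : {poly subring_sort D}) :
  (map_poly val p0 \is monic) = (p0 \is monic).
Proof.
apply/idP/idP => [|/(monic_map val)//].
have E : lead_coef (map_poly val p0) = val (lead_coef p0).
  by apply: lead_coef_map_inj; [exact: val_inj|exact: raddf0].
by rewrite !monicE E => /eqP h; apply/eqP/val_inj; rewrite h.
Qed.

(** Lifting to polynomials over the subring as a ring in its own right keeps
    quotient and remainder over D. *)
Lemma polyOver_divmod D (F r : {poly S}) : F \is monic -> F \is a polyOver D ->
  r \is a polyOver D -> exists q r', [/\ q \is a polyOver D,
    r' \is a polyOver D, r = q * F + r' & (size r' < size F)%N].
Proof.
move=> Fm /polyOver_lift[F0 FE] /polyOver_lift[r0 rE].
have F0m : F0 \is monic by rewrite -map_val_monic FE.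
exists (map_poly val (Pdiv.Ring.rdivp r0 F0)), (map_poly val (Pdiv.Ring.rmodp r0 F0)).
split; try exact: polyOver_val.
  by rewrite -rE -FE {1}(Pdiv.RingMonic.rdivp_eq F0m r0) rmorphD rmorphM.
rewrite -FE !(size_map_inj_poly val_inj) // Pdiv.Ring.ltn_rmodpN0 //.
exact: monic_neq0.
Qed.

Definition integral D (z : S) :=
  exists p : {poly S}, [/\ p \is monic, p \is a polyOver D & root p z].

Lemma integralE D z :
  integral D z <-> integralOver (\val : subring_sort D -> S) z.
Proof.
split=> [[p [pm /polyOver_lift[p0 pE] pz]]|[p pm pz]].
  by exists p0; rewrite ?pE // -map_val_monic pE.
by exists (map_poly val p); split; rewrite ?map_val_monic ?polyOver_val.
Qed.

Lemma integral_mem D z : z \in D -> integral D z.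
Proof.
move=> zD; exists ('X - z%:P); rewrite monicXsubC root_XsubC eqxx; split=> //.
by rewrite polyOverXsubC.
Qed.

Lemma integralB D y z : integral D y -> integral D z -> integral D (y - z).
Proof. by rewrite !integralE; exact: integral_sub. Qed.

Lemma integralM D y z : integral D y -> integral D z -> integral D (y * z).
Proof. by rewrite !integralE; exact: integral_mul. Qed.

Lemma integral_closure_closed D : subring_closed (fun z => `[< integral D z >]).
Proof.
split=> [|y z /asboolP yD /asboolP zD|y z /asboolP yD /asboolP zD]; apply/asboolP.
- exact/integral_mem/rpred1.
- exact: integralB.
- exact: integralM.
Qed.

Definition integral_closure D := Subring (integral_closure_closed D).

Lemma integral_closureP D z : reflect (integral D z) (z \in integral_closure D).
Proof. exact: asboolP. Qed.

Lemma integral_trans D p z : p \is monic -> p \is a polyOver (integral_closure D) ->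
  root p z -> integral D z.
Proof.
move=> pm /polyOverP pD pz; apply/integralE; apply: integral_root_monic pm pz _.
by apply/integral_poly => i; apply/integralE/integral_closureP.
Qed.

Lemma integral_closedP D z :
  integral (integral_closure D) z -> integral D z.
Proof. by case=> p [pm pD pz]; exact: integral_trans pz. Qed.

Lemma integral_sub D E z : {subset D <= E} -> integral D z -> integral E z.
Proof.
move=> DE [p [pm pD pz]]; exists p; split=> //.
by apply/polyOverP => i; apply/DE/(polyOverP pD).
Qed.

Lemma integralX D z n : integral D z -> integral D (z ^+ n).
Proof.
by move=> /integral_closureP zD; apply/integral_closureP; exact: rpredX.
Qed.

(** The D-submodule generated by u; coefficients are indexed by nat so that spans of
    sequences of different sizes combine without casts. *)
Definition span_over D (u : seq S) (z : S) := exists c : nat -> S,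
  (forall i, c i \in D) /\ z = \sum_(i < size u) c i * u`_i.

Lemma span_over0 D u : span_over D u 0.
Proof.
exists (fun=> 0); split=> [_|]; first exact: rpred0.
by rewrite big1 // => i _; rewrite mul0r.
Qed.

Lemma span_overD D u y z : span_over D u y -> span_over D u z -> span_over D u (y + z).
Proof.
move=> [c [cD ->]] [d [dD ->]]; exists (fun i => c i + d i).
split=> [i|]; first by rewrite rpredD.
by rewrite -big_split; apply: eq_bigr => i _; rewrite mulrDl.
Qed.

Lemma span_overM D u a z : a \in D -> span_over D u z -> span_over D u (a * z).
Proof.
move=> aD [c [cD ->]]; exists (fun i => a * c i).
split=> [i|]; first by rewrite rpredM.
by rewrite big_distrr; apply: eq_bigr => i _; rewrite /= mulrA.
Qed.

Lemma span_overN D u z : span_over D u z -> span_over D u (- z).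
Proof. by rewrite -mulN1r; apply: span_overM; rewrite rpredN rpred1. Qed.

Lemma span_over_mem D u v : v \in u -> span_over D u v.
Proof.
move=> vu; exists (fun i => (i == index v u)%:R); split=> [i|].
  by rewrite rpred_nat.
rewrite (bigD1 (Ordinal (introT idP (etrans (index_mem v u) vu)))) //=.
rewrite eqxx mul1r nth_index // big1 ?addr0 // => i.
by rewrite -val_eqE /= => /negbTE->; rewrite mul0r.
Qed.

Lemma span_over_sum D u (I : Type) (r : seq I) (P : pred I) (F : I -> S) :
  (forall i, P i -> span_over D u (F i)) -> span_over D u (\sum_(i <- r | P i) F i).
Proof.
move=> h; apply: big_ind => //; first exact: span_over0; exact: span_overD.
Qed.

Lemma span_over_le D u v z : (forall w, w \in u -> span_over D v w) -> span_over D u z ->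
  span_over D v z.
Proof.
move=> uv [c [cD ->]]; apply: span_over_sum => i _; apply: span_overM => //.
exact/uv/mem_nth.
Qed.

(** Cayley-Hamilton: multiplication by z has a matrix C over D on the generators u,
    so the characteristic polynomial of C at z kills u, hence kills 1. *)
Lemma integral_span_over D u z : (forall v, v \in u -> span_over D u (z * v)) ->
  span_over D u 1 -> integral D z.
Proof.
move=> zu [e [_ e1]].
have /choice[c cP] : forall i : 'I_(size u), exists c : nat -> S,
  (forall i, c i \in D) /\ z * u`_i = \sum_(i < size u) c i * u`_i.
  by move=> i; apply/zu/mem_nth.
pose C : 'M[S]_(size u) := \matrix_(i, j) c i j.
pose U : 'cV[S]_(size u) := \col_i u`_i.
exists (char_poly C); split; first exact: char_poly_monic.
  rewrite /char_poly /determinant; apply: rpred_sum => s _.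
  apply: rpredM; first by rewrite rpredX // rpredN rpred1.
  apply: rpred_prod => i _; rewrite !mxE rpredB ?polyOverC //.
    by rewrite rpredMn // polyOverX.
  by have [] := cP i.
have E : (char_poly C).[z] = \det (z%:M - C).
  rewrite /char_poly -/(horner_eval z _) -det_map_mx; congr (\det _).
  apply/matrixP => i j; rewrite !mxE /= /horner_eval hornerD hornerN hornerMn.
  by rewrite hornerX hornerC.
have ZU : (z%:M - C) *m U = 0.
  apply/matrixP => i j; rewrite mulmxBl mul_scalar_mx !mxE.
  have [_ ->] := cP i; apply/eqP; rewrite subr_eq0; apply/eqP.
  by apply: eq_bigr => k _; rewrite !mxE.
have := congr1 (mulmx (\adj (z%:M - C))) ZU.
rewrite mulmxA mul_adj_mx mulmx0 mul_scalar_mx -E => h.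
have hu (i : 'I_(size u)) : (char_poly C).[z] * u`_i = 0.
  by have := congr1 (fun A : 'cV_ _ => A i 0) h; rewrite !mxE.
rewrite /root -[_.[z]]mulr1 e1 big_distrr /= big1 // => i _.
by rewrite mulrCA hu mulr0.
Qed.

Lemma adjoin_closed D x :
  subring_closed (fun z => `[< exists2 p, p \is a polyOver D & z = p.[x] >]).
Proof.
split=> [|y z /asboolP[p pD ->] /asboolP[q qD ->]
         |y z /asboolP[p pD ->] /asboolP[q qD ->]]; apply/asboolP.
- by exists 1; rewrite ?rpred1 // hornerC.
- by exists (p - q); rewrite ?rpredB // hornerD hornerN.
- by exists (p * q); rewrite ?rpredM // hornerM.
Qed.

Definition adjoin D x := Subring (adjoin_closed D x).

Lemma adjoinP D x z :
  reflect (exists2 p, p \is a polyOver D & z = p.[x]) (z \in adjoin D x).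
Proof. exact: asboolP. Qed.

Lemma adjoin_base D x z : z \in D -> z \in adjoin D x.
Proof. by move=> zD; apply/adjoinP; exists z%:P; rewrite ?polyOverC // hornerC. Qed.

Lemma adjoin_gen D x : x \in adjoin D x.
Proof. by apply/adjoinP; exists 'X; rewrite ?polyOverX // hornerX. Qed.

Lemma adjoin_min D x E : {subset D <= E} -> x \in E -> {subset adjoin D x <= E}.
Proof.
move=> DE xE _ /adjoinP[p /polyOverP pD ->]; rewrite horner_coef.
by apply: rpred_sum => i _; rewrite rpredM ?rpredX // DE.
Qed.

Definition adjoins D xs : subring S := foldr (fun x E => adjoin E x) D xs.

Lemma adjoins_base D xs z : z \in D -> z \in adjoins D xs.
Proof. by move=> zD; elim: xs => //= x xs ih; apply: adjoin_base. Qed.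

Lemma adjoins_gen D xs x : x \in xs -> x \in adjoins D xs.
Proof.
elim: xs => //= y xs ih; rewrite inE => /predU1P[->|/ih h]; first exact: adjoin_gen.
exact: adjoin_base.
Qed.

Lemma adjoins_min D xs E : {subset D <= E} -> {subset xs <= E} ->
  {subset adjoins D xs <= E}.
Proof.
move=> DE; elim: xs => [//|x xs ih] xE /=; apply: adjoin_min.
  by apply: ih => y yx; apply: xE; rewrite inE yx orbT.
by apply: xE; rewrite inE eqxx.
Qed.

Definition module_finite D E := exists u : seq S,
  {subset u <= E} /\ forall z, z \in E -> span_over D u z.

Lemma module_finite_adjoin D E w : {subset D <= E} -> module_finite D E -> integral E w -> module_finite D (adjoin E w).
Proof.
move=> DE [u [uE uP]] [F [Fm FE Fw]].
exists [seq v * w ^+ j | v <- u, j <- iota 0 (size F)]; split.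
  move=> _ /allpairsP[[v j] /= [vu _ ->]].
  by rewrite rpredM ?rpredX ?adjoin_gen // adjoin_base // uE.
move=> _ /adjoinP[p pE ->].
have [q [r [_ /polyOverP rE -> szr]]] := polyOver_divmod Fm FE pE.
rewrite hornerD hornerM (rootP Fw) mulr0 add0r horner_coef.
apply: span_over_sum => i _; have [c [cD ->]] := uP _ (rE i).
rewrite big_distrl; apply: span_over_sum => j _; rewrite /= -mulrA; apply: span_overM => //.
apply/span_over_mem/allpairs_f; first exact: mem_nth.
by rewrite mem_iota (leq_trans (ltn_ord i) (ltnW szr)).
Qed.

Lemma module_finite_adjoins D ws : (forall w, w \in ws -> integral D w) -> module_finite D (adjoins D ws).
Proof.
elim: ws => [_|w ws ih] /=.
  exists [:: 1]; split=> [z|z zD]; first by rewrite inE => /eqP->; exact: rpred1.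
  exists (fun=> z); split=> //.
  by rewrite big_ord1 mulr1.
move=> h; apply: module_finite_adjoin => [z||].
- exact: adjoins_base.
- by apply: ih => z zw; apply: h; rewrite inE zw orbT.
- apply: (@integral_sub D) => [z|]; first exact: adjoins_base.
  by apply: h; rewrite inE eqxx.
Qed.

End Integral.

(** * Products and leading coefficients of polynomials *)

Section PolynomialTools.

Lemma uniform_bound (P : nat -> nat -> Prop) :
  (forall i, exists k, forall k', (k <= k')%N -> P i k') ->
  forall n, exists k, forall i, (i < n)%N -> P i k.
Proof.
move=> h n; suff [k kP] : exists k, forall k', (k <= k')%N ->
    forall i, (i < n)%N -> P i k' by exists k => i; exact: kP.
elim: n => [|n [k kP]]; first by exists 0%N.
have [l lP] := h n; exists (maxn k l) => k'; rewrite geq_max => /andP[kk lk] i.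
by rewrite ltnS leq_eqVlt => /predU1P[->|]; [exact: lP|exact: kP].
Qed.

Variable S : comNzRingType.
Implicit Types (D E : subring S) (q : S -> Prop).

(** Gauss's lemma for an ideal q that is prime on the coefficient set D: the first
    coefficients of f and g outside q produce a coefficient of f g outside q.
    Keeping D apart from the ring S covers both a prime of S and the maximal ideal
    of a valuation ring inside a field. *)
Lemma gauss_prime (D : S -> Prop) q (f g : {poly S}) :
    q 0 -> (forall a b, q a -> q b -> q (a - b)) ->
    (forall a b, D a -> q b -> q (a * b)) ->
    (forall a b, D a -> D b -> q (a * b) -> q a \/ q b) ->
    (forall i, D f`_i) -> (forall i, D g`_i) -> (forall k, q (f * g)`_k) ->
  (forall i, q f`_i) \/ (forall i, q g`_i).
Proof.
move=> q0 qB qM qP fD gD fgq.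
have qD a b : q a -> q b -> q (a + b).
  by move=> qa qb; have := qB _ _ qa (qB _ _ q0 qb); rewrite sub0r opprK.
case: (pselect (forall i, q f`_i)) => [|/existsNP fn]; first by left.
case: (pselect (forall i, q g`_i)) => [|/existsNP gn]; first by right.
exfalso.
have minim (h : {poly S}) : (exists i, ~ q h`_i) ->
    exists i, ~ q h`_i /\ forall j, (j < i)%N -> q h`_j.
  move=> hn; have [j0 hj0] := hn.
  have ex : exists j, `[< ~ q h`_j >] by exists j0; apply/asboolP.
  case: (ex_minnP ex) => i /asboolP hi imin; exists i; split=> // j ji.
  by apply: contrapT => hj; move: ji; rewrite ltnNge imin //; apply/asboolP.
have [i [fi imin]] := minim _ fn; have [j [gj jmin]] := minim _ gn.
suff : q (f`_i * g`_j) by move=> /qP[].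
have := fgq (i + j)%N; rewrite coefM.
rewrite (bigD1 (inord i)) //= inordK ?ltnS ?leq_addr // addKn => h.
rewrite -[X in q X](addrK (\sum_(k < (i + j).+1 | k != inord i) f`_k * g`_(i + j - k))).
apply: (qB) h _; apply: (big_ind q) => // k ki.
have {ki} : (k : nat) != i.
  by apply: contraNneq ki => E; apply/eqP/val_inj; rewrite /= inordK ?ltnS ?leq_addr.
rewrite neq_ltn => /orP[ki|ik]; first by rewrite mulrC; apply/qM/imin.
by apply/qM/jmin => //; have := ltn_ord k; lia.
Qed.

Lemma coefM_top (f g : {poly S}) m n : (size f <= m.+1)%N -> (size g <= n.+1)%N ->
  (f * g)`_(m + n) = f`_m * g`_n.
Proof.
move=> szf szg; rewrite coefM (bigD1 (inord m)) //= inordK ?ltnS ?leq_addr //.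
rewrite addKn big1 ?addr0 // => k km.
have {km} : (k : nat) != m.
  by apply: contraNneq km => E; apply/eqP/val_inj; rewrite /= inordK ?ltnS ?leq_addr.
rewrite neq_ltn => /orP[km|mk]; last by rewrite nth_default ?mul0r // (leq_trans szf).
by rewrite [g`__]nth_default ?mulr0 // (leq_trans szg) // ltn_subRL ltn_add2r.
Qed.

Lemma coefX_top (f : {poly S}) d n : (size f <= d.+1)%N ->
  (size (f ^+ n) <= (n * d).+1)%N /\ (f ^+ n)`_(n * d) = f`_d ^+ n.
Proof.
move=> szf; elim: n => [|n [ihs ihc]].
  by rewrite !expr0 mul0n size_poly1 coefC.
rewrite !exprS mulSn coefM_top // ihc; split=> //.
by apply: leq_trans (size_polyMleq _ _) _; lia.
Qed.

(** If a is the coefficient of degree d of h, this monic polynomial takes at a x the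
    value a^(d-1) h(x). *)
Definition lead_scale d (h : {poly S}) :=
  'X^d + \poly_(i < d) (h`_i * h`_d ^+ (d - i.+1)).

Lemma lead_scale_monic d h : lead_scale d h \is monic.
Proof.
rewrite monicE /lead_scale lead_coefDl ?lead_coefXn //.
by rewrite size_polyXn ltnS size_poly.
Qed.

Lemma lead_scale_over D d h : h \is a polyOver D -> lead_scale d h \is a polyOver D.
Proof.
move=> /polyOverP hD; rewrite rpredD ?polyOverXn //.
by apply: polyOver_poly => i _; rewrite rpredM ?rpredX.
Qed.

Lemma lead_scaleE d (h : {poly S}) x : (0 < d)%N -> (size h <= d.+1)%N ->
  (lead_scale d h).[h`_d * x] = h`_d ^+ d.-1 * h.[x].
Proof.
move=> d0 szh; rewrite hornerD hornerXn horner_poly (horner_coef_wide _ szh).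
rewrite big_ord_recr /= mulrDr addrC; congr (_ + _); last first.
  by rewrite mulrA -exprSr prednK // exprMn.
rewrite big_distrr; apply: eq_bigr => i _ /=.
rewrite exprMn.
have -> : d.-1 = (d - i.+1 + i)%N by have := ltn_ord i; lia.
by rewrite exprD; ring.
Qed.

Lemma integral_lead D d (h : {poly S}) x : h \is a polyOver D -> (0 < d)%N ->
  (size h <= d.+1)%N -> h.[x] = 0 -> integral D (h`_d * x).
Proof.
move=> hD d0 szh hx; exists (lead_scale d h); rewrite lead_scale_monic.
by rewrite lead_scale_over // /root lead_scaleE // hx mulr0 eqxx.
Qed.

(** Multiplying a root by e multiplies the coefficient of degree j of its monic
    equation by a positive power of e when j is below the degree. *)
Lemma integral_scale E (F : {poly S}) e s : F \is monic -> root F s ->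
  e \in E -> (forall j, (j < size F)%N -> e * F`_j \in E) -> integral E (e * s).
Proof.
move=> Fm /rootP Fs eE FE; pose m := (size F).-1.
have szF : size F = m.+1 by rewrite prednK // size_poly_gt0 monic_neq0.
have Fm1 : F`_m = 1 by exact/eqP/Fm.
pose G := 'X^m + \poly_(j < m) (F`_j * e ^+ (m - j)).
exists G; split.
- by rewrite monicE lead_coefDl ?lead_coefXn // size_polyXn ltnS size_poly.
- rewrite rpredD ?polyOverXn //; apply: polyOver_poly => i im.
  rewrite -[(m - i)%N]prednK ?subn_gt0 // exprS mulrCA mulrA rpredM ?rpredX //.
  by rewrite FE // szF ltnS ltnW.
- suff -> : root G (e * s) = (e ^+ m * F.[s] == 0) by rewrite Fs mulr0.
  rewrite /root; congr (_ == 0); rewrite hornerD hornerXn horner_poly.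
  rewrite horner_coef szF big_ord_recr /= Fm1 mul1r mulrDr addrC -exprMn.
  congr (_ + _); rewrite big_distrr; apply: eq_bigr => i _ /=.
  have -> : e ^+ m = e ^+ (m - i) * e ^+ i by rewrite -exprD subnK // ltnW.
  by rewrite exprMn; ring.
Qed.

Lemma integral_scale_ex E (F : {poly S}) e s : F \is monic -> root F s -> e \in E ->
  (forall j, exists k, e ^+ k * F`_j \in E) -> exists k, e ^+ k * s \in integral_closure E.
Proof.
move=> Fm Fs eE FE.
have [k kP] : exists k, forall i, (i < size F)%N -> e ^+ k * F`_i \in E.
  apply: (uniform_bound (P := fun i k => e ^+ k * F`_i \in E)) => i.
  have [k kE] := FE i; exists k => k' kk'.
  by rewrite -(subnK kk') exprD -mulrA rpredM // rpredX.
by exists k; apply/integral_closureP; apply: integral_scale Fm Fs _ _ => //; rewrite rpredX.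
Qed.

End PolynomialTools.

Section ProperFraction.
Variables (S : comNzRingType) (D : subring S) (x : S).

(** The element t is the fraction r(x)/p(x), of negative degree in x.  The relation
    t p(x) = r(x) rewrites t x^d as a combination of the x^i and t x^i with i < d, so
    every t^K x^e with e < K + d is a D-combination of the t^j x^i with j <= K and
    i < d.  Feeding this into the equation of t over D[x], multiplied by a high power
    of t, makes the D-span of finitely many t^j x^i stable under t. *)
Lemma proper_fraction_integral t (p r : {poly S}) : p \is monic -> p \is a polyOver D ->
  r \is a polyOver D -> (size r < size p)%N -> t * p.[x] = r.[x] ->
  integral (adjoin D x) t -> integral D t.
Proof.
move=> pm pD rD szr tp [F [Fm FD Ft]].
pose d := (size p).-1.
have szp : size p = d.+1 by rewrite prednK // size_poly_gt0 monic_neq0.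
have pd1 : p`_d = 1 by exact/eqP/pm.
have {}szr : (size r <= d)%N by rewrite -ltnS -szp.
pose u N := [seq t ^+ j * x ^+ i | j <- iota 0 N, i <- iota 0 d].
have uP N j i : (j < N)%N -> (i < d)%N -> span_over D (u N) (t ^+ j * x ^+ i).
  by move=> jN id; apply/span_over_mem/allpairs_f; rewrite mem_iota.
have uS N N' z : (N <= N')%N -> span_over D (u N) z -> span_over D (u N') z.
  move=> NN; apply: span_over_le => _ /allpairsP[[j i] /= [+ + ->]].
  by rewrite !mem_iota /= add0n => jN id; apply: uP => //; exact: leq_trans NN.
have red e K : (e < K + d)%N -> span_over D (u K.+1) (t ^+ K * x ^+ e).
  elim/ltn_ind: e K => e ih K eK.
  have [ed|de] := ltnP e d; first exact: uP.
  have K0 : (0 < K)%N by lia.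
  have tx : t * x ^+ d = \sum_(i < d) r`_i * x ^+ i - \sum_(i < d) p`_i * (t * x ^+ i).
    rewrite -(horner_coef_wide _ szr) -tp horner_coef szp big_ord_recr /= pd1 mul1r.
    rewrite mulrDr addrAC big_distrr /= -sumrB big1 ?add0r // => i _.
    by rewrite mulrCA subrr.
  have -> : t ^+ K * x ^+ e = t ^+ K.-1 * x ^+ (e - d) * (t * x ^+ d).
    by rewrite -{1}(prednK K0) -{1}(subnK de) exprSr exprD; ring.
  rewrite tx mulrBr; apply: span_overD; last apply: span_overN.
    rewrite big_distrr; apply: span_over_sum => i _ /=.
    have -> : t ^+ K.-1 * x ^+ (e - d) * (r`_i * x ^+ i) =
      r`_i * (t ^+ K.-1 * x ^+ (e - d + i)) by rewrite exprD; ring.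
    apply: span_overM; first exact/(polyOverP rD).
    by apply: (@uS K.-1.+1); [lia|apply: ih; have := ltn_ord i; lia].
  rewrite big_distrr; apply: span_over_sum => i _ /=.
  have -> : t ^+ K.-1 * x ^+ (e - d) * (p`_i * (t * x ^+ i)) =
      p`_i * (t ^+ K * x ^+ (e - d + i)).
    by rewrite -{2}(prednK K0) exprSr exprD; ring.
  apply: span_overM; first exact/(polyOverP pD).
  by apply: ih; have := ltn_ord i; lia.
have [d0|d0] := posnP d.
  move: szr tp; rewrite d0 leqn0 size_poly_eq0 => /eqP ->.
  rewrite [p]size1_polyC ?szp ?d0 // hornerC; move: pd1; rewrite d0 => ->; rewrite mulr1 horner0 => ->.
  exact/integral_mem/rpred0.
pose m := (size F).-1.
have szF : size F = m.+1 by rewrite prednK // size_poly_gt0 monic_neq0.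
have Fm1 : F`_m = 1 by exact/eqP/Fm.
have /choice[c cP] : forall j, exists c, c \is a polyOver D /\ F`_j = c.[x].
  by move=> j; have /adjoinP[c] := polyOverP FD j; exists c.
have [K K0 KP] : exists2 K, (0 < K)%N & forall j, (j < m)%N -> (size (c j) <= K)%N.
  have [K KP] := uniform_bound (P := fun j K => (size (c j) <= K)%N)
    (fun j => ex_intro _ (size (c j)) (fun _ => id)) m.
  by exists K.+1 => // j /KP/leqW.
apply: (@integral_span_over _ D (u (m + K)%N)); last first.
  by have := uP (m + K)%N 0%N 0%N (ltn_addl _ K0) d0; rewrite !expr0 mulr1.
have top i : (i < d)%N -> span_over D (u (m + K)%N) (t ^+ (m + K) * x ^+ i).
  move=> id.
  have tm : t ^+ m = - \sum_(j < m) F`_j * t ^+ j.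
    have := rootP Ft; rewrite horner_coef szF big_ord_recr /= Fm1 mul1r.
    by move=> /eqP; rewrite addrC addr_eq0 => /eqP.
  rewrite exprD tm mulNr mulNr; apply: span_overN.
  rewrite -mulrA big_distrl; apply: span_over_sum => j _ /=.
  have [cD ->] := cP j; rewrite horner_coef !big_distrl; apply: span_over_sum => l _ /=.
  have -> : (c j)`_l * x ^+ l * t ^+ j * (t ^+ K * x ^+ i) =
    (c j)`_l * (t ^+ (j + K) * x ^+ (l + i)) by rewrite !exprD; ring.
  apply: span_overM; first exact/(polyOverP cD).
  have jm := ltn_ord j; have lc := leq_trans (ltn_ord l) (KP _ jm).
  by apply: (@uS (j + K).+1); [lia|apply: red; lia].
move=> _ /allpairsP[[j i] /= [+ + ->]].
rewrite !mem_iota /= add0n => jN id; rewrite mulrA -exprS.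
have [->|jN'] := eqVneq j.+1 (m + K)%N; first exact: top.
by apply: uP => //; rewrite ltn_neqAle jN'.
Qed.

End ProperFraction.

(** * Prime sets and the conductor *)

(** Prime ideals as plain predicates; [spec_of] turns them into points of the
    spectrum. *)
Record prime_set (S : comPzRingType) (q : S -> Prop) : Prop := PrimeSet {
  prime_set0 : q 0;
  prime_setD : forall a b, q a -> q b -> q (a + b);
  prime_setM : forall a b, q b -> q (a * b);
  prime_set1 : ~ q 1;
  prime_setP : forall a b, q (a * b) -> q a \/ q b }.

Section PrimeSet.
Variables (S : comNzRingType) (q : S -> Prop).
Hypothesis qP : prime_set q.

Lemma prime_setB a b : q a -> q b -> q (a - b).
Proof. by move=> qa qb; rewrite -mulN1r; apply: prime_setD => //; exact: prime_setM. Qed.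

Lemma prime_setMr a b : q a -> q (a * b).
Proof. by rewrite mulrC; exact: prime_setM. Qed.

Lemma prime_setX a n : q (a ^+ n) -> q a.
Proof.
by elim: n => [/(prime_set1 qP)//|n ih]; rewrite exprS => /(prime_setP qP)[].
Qed.

Lemma prime_set_sum (I : Type) (r : seq I) (P : pred I) (F : I -> S) :
  (forall i, P i -> q (F i)) -> q (\sum_(i <- r | P i) F i).
Proof. by move=> h; apply: big_ind => //; [exact: prime_set0|exact: prime_setD]. Qed.

Lemma prime_set_polyM (f g : {poly S}) : (forall k, q (f * g)`_k) ->
  (forall i, q f`_i) \/ (forall i, q g`_i).
Proof.
apply: (@gauss_prime S (fun=> True)) => //; first exact: prime_set0.
- exact: prime_setB.
- by move=> a b _; exact: prime_setM.
- by move=> a b _ _; exact: prime_setP.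
Qed.

Lemma prime_set_horner (f : {poly S}) x : (forall i, q f`_i) -> q f.[x].
Proof. by move=> h; rewrite horner_coef; apply: prime_set_sum => i _; exact: prime_setMr. Qed.

End PrimeSet.

(** The extension to S of the ideal that q cuts out on D. *)
Definition ext_ideal (S : comNzRingType) (D : subring S) (q : S -> Prop) (y : S) :=
  exists n (a b : nat -> S),
    (forall i, a i \in D /\ q (a i)) /\ y = \sum_(i < n) a i * b i.

(** The element x is algebraic over D modulo q, locally at q. *)
Definition residually_algebraic (S : comNzRingType) (D : subring S) (q : S -> Prop) (x : S) :=
  exists (f : {poly S}) (t : S),
    [/\ f \is a polyOver D, ~ (forall i, q f`_i), ~ q t & ext_ideal D q (t * f.[x])].

Section Conductor.
Variables (S : comNzRingType) (D : subring S).
Hypothesis Dic : forall z, integral D z -> z \in D.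

(** Subtracting the polynomial part of t p(x) / p(x) leaves a proper fraction, which
    is integral over D, hence in D. *)
Lemma adjoin_of_monic_mul x t (p : {poly S}) : p \is monic -> p \is a polyOver D ->
  t * p.[x] \in adjoin D x -> integral (adjoin D x) t -> t \in adjoin D x.
Proof.
move=> pm pD /adjoinP[r rD tp] ti.
have [q [r' [qD r'D rE szr']]] := polyOver_divmod pm pD rD.
have qx : q.[x] \in adjoin D x by apply/adjoinP; exists q.
rewrite -(subrK q.[x] t) rpredD //; apply/adjoin_base/Dic.
apply: (proper_fraction_integral (x := x) pm pD r'D szr').
  by rewrite mulrBl tp rE hornerD hornerM addrC addKr.
exact/integralB/integral_mem.
Qed.

Lemma adjoin_scale a x c : a \in D -> c \in adjoin D x ->
  exists k, a ^+ k * c \in adjoin D (a * x).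
Proof.
move=> aD /adjoinP[p pD ->]; exists (size p); rewrite horner_coef big_distrr.
apply: rpred_sum => i _ /=.
have -> : a ^+ size p * (p`_i * x ^+ i) = p`_i * a ^+ (size p - i) * (a * x) ^+ i.
  have {1}-> : size p = (size p - i + i)%N by rewrite subnK // ltnW.
  by rewrite exprD exprMn; ring.
rewrite rpredM ?rpredX ?adjoin_gen // adjoin_base // rpredM ?rpredX //.
exact: (polyOverP pD).
Qed.

(** The monic case for the generator a x of a smaller ring D[a x], a the leading
    coefficient of p: a high power of a moves t and its integral equation into
    D[a x]. *)
Lemma adjoin_of_lead_mul x t d (p : {poly S}) : p \is a polyOver D ->
  (size p <= d.+1)%N -> t * p.[x] \in adjoin D x -> integral (adjoin D x) t ->
  exists l, p`_d ^+ l * t \in adjoin D x.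
Proof.
move=> pD szp tp ti; have [d0|d0] := posnP d.
  have p1 : (size p <= 1)%N by rewrite -[1%N]/(0.+1) -d0.
  by exists 1%N; move: tp; rewrite (size1_polyC p1) hornerC d0 coefC /= mulrC.
set a := p`_d; have aD : a \in D by exact: (polyOverP pD).
have [F [Fm FD Ft]] := ti.
have [k /integral_closureP kt] : exists k, a ^+ k * t \in integral_closure (adjoin D (a * x)).
  apply: integral_scale_ex Fm Ft _ _ => [|j]; first exact: adjoin_base.
  by apply: adjoin_scale => //; exact: (polyOverP FD).
have [m mP] := adjoin_scale aD tp; exists (k + m)%N.
have sub : {subset adjoin D (a * x) <= adjoin D x}.
  apply: adjoin_min => [z|]; first exact: adjoin_base.
  by apply: rpredM; [exact: adjoin_base|exact: adjoin_gen].
apply: sub.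
have adX n : a ^+ n \in adjoin D (a * x) by rewrite rpredX // adjoin_base.
apply: (@adjoin_of_monic_mul _ _ (lead_scale d p)).
- exact: lead_scale_monic.
- exact: lead_scale_over.
- rewrite lead_scaleE //.
  have -> : a ^+ (k + m) * t * (a ^+ d.-1 * p.[x]) =
    a ^+ k * a ^+ d.-1 * (a ^+ m * (t * p.[x])) by rewrite exprD; ring.
  by rewrite rpredM // rpredM.
- rewrite exprD mulrAC; apply: integralM => //; exact/integral_mem.
Qed.

Section Finite.
Variable x : S.
Hypothesis Sfg : exists u, forall s, span_over (adjoin D x) u s.

Lemma adjoin_integral s : integral (adjoin D x) s.
Proof. by have [u uP] := Sfg; apply: (@integral_span_over _ _ u). Qed.

Definition conductor g := forall s, g * s \in adjoin D x.

Lemma conductorM g s : conductor g -> conductor (s * g).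
Proof. by move=> gJ r; rewrite [s * g]mulrC -mulrA; exact: gJ. Qed.

Lemma conductorD g h : conductor g -> conductor h -> conductor (g + h).
Proof. by move=> gJ hJ r; rewrite mulrDl rpredD. Qed.

(** The heart of Peskine's argument: the radical of the conductor is homogeneous
    with respect to x.  Apply [adjoin_of_lead_mul] to u_i v^N and h^N for the
    finitely many generators u_i of S over D[x]. *)
Lemma conductor_lead v d (h : {poly S}) N : h \is a polyOver D ->
  (size h <= d.+1)%N -> conductor ((v * h.[x]) ^+ N) ->
  exists M, conductor ((v * h`_d) ^+ M).
Proof.
move=> hD szh hJ; have [u uP] := Sfg.
have [szhN hN] := coefX_top N szh.
have hNx : (h ^+ N).[x] = h.[x] ^+ N by rewrite horner_exp.
have hdD : h`_d \in D by exact: (polyOverP hD).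
have [l lP] : exists l, forall i, (i < size u)%N ->
    h`_d ^+ (N * l) * (u`_i * v ^+ N) \in adjoin D x.
  apply: (uniform_bound (P := fun i l => h`_d ^+ (N * l) * (u`_i * v ^+ N) \in adjoin D x)).
  move=> i; have := @adjoin_of_lead_mul x (u`_i * v ^+ N) (N * d) (h ^+ N).
  rewrite hN hNx => /(_ _ szhN _ (adjoin_integral _))[||l]; first exact: rpredX.
    by rewrite -mulrA -exprMn mulrC.
  rewrite -exprM => lP; exists l => k' lk'.
  rewrite -(subnK lk') mulnDr exprD -mulrA rpredM //.
  by rewrite adjoin_base // rpredX.
exists (N * l.+1)%N.
have -> : (v * h`_d) ^+ (N * l.+1) =
    v ^+ (N * l) * h`_d ^+ N * (h`_d ^+ (N * l) * v ^+ N).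
  by rewrite mulnS exprD !exprMn; ring.
apply: conductorM => s; have [c [cD ->]] := uP s.
rewrite big_distrr; apply: rpred_sum => i _ /=.
have := lP _ (ltn_ord i) => h1.
have -> : h`_d ^+ (N * l) * v ^+ N * (c i * u`_i) =
  c i * (h`_d ^+ (N * l) * (u`_i * v ^+ N)) by ring.
by rewrite rpredM.
Qed.

Section Birational.
Variable q : S -> Prop.
Hypothesis qP : prime_set q.

(** The product of the leading coefficient a of h with x is integral over D, so lies
    in D.  If a is in q then so is a x, and a x can be absorbed in the next
    coefficient without losing the coefficient outside q. *)
Lemma root_descent n (h : {poly S}) : (size h <= n.+1)%N -> h \is a polyOver D ->
  h.[x] = 0 -> ~ (forall i, q h`_i) ->
  exists g, [/\ g \in D, ~ q g & g * x \in D].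
Proof.
elim: n h => [|n ih] h szh hD hx hq.
  case: hq => i; move: hx; rewrite [h]size1_polyC // hornerC coefC => ->.
  by case: (_ == _); exact: (prime_set0 qP).
have aD : h`_n.+1 \in D by exact: (polyOverP hD).
have axD : h`_n.+1 * x \in D by apply/Dic/integral_lead.
case: (pselect (q h`_n.+1)) => qa; last by exists h`_n.+1.
pose h' := \poly_(i < n.+1) (h`_i + (i == n)%:R * (h`_n.+1 * x)).
apply: (ih h'); first exact: size_poly.
- apply: polyOver_poly => i _; rewrite rpredD ?(polyOverP hD) //.
  by rewrite rpredM // rpred_nat.
- rewrite -[RHS]hx horner_poly (horner_coef_wide _ szh) [LHS]big_ord_recr [RHS]big_ord_recr /=.
  rewrite big_ord_recr /= eqxx mul1r mulrDl -[h`_n.+1 * x * _]mulrA -exprS addrA.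
  congr (_ + _ + _); apply: eq_bigr => i _.
  by rewrite (ltn_eqF (ltn_ord i)) mul0r addr0.
- move=> h'q; apply: hq => i.
  have [ni|] := ltnP n i.
    move: ni; rewrite leq_eqVlt => /predU1P[<- //|ni].
    by rewrite nth_default ?(leq_trans szh) //; exact: (prime_set0 qP).
  move=> iN; have := h'q i; rewrite coef_poly ltnS iN => hi.
  rewrite -[h`_i](addrK ((i == n)%:R * (h`_n.+1 * x))).
  apply: (prime_setB qP) => //; apply: (prime_setM qP).
  exact: (prime_setMr qP).
Qed.

(** After multiplication by g, the equation of x modulo q becomes an equation T f = P
    over D satisfied by x, where f and T have coefficients outside q and P has none. *)
Lemma zmt_conductor g : conductor g -> ~ q g -> residually_algebraic D q x ->
  exists g, [/\ ~ q g, g \in D & forall s, exists k, g ^+ k * s \in D].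
Proof.
move=> gJ gq [f [t [fD fq tq [n [a [b [aP tf]]]]]]].
have /adjoinP[T TD gt] : g * t \in adjoin D x by exact: gJ.
have /choice[B BP] : forall i, exists B, B \is a polyOver D /\ g * b i = B.[x].
  by move=> i; have /adjoinP[B] := gJ (b i); exists B.
pose P := \sum_(i < n) (a i)%:P * B i.
have Tq : ~ (forall i, q T`_i).
  by move=> /(prime_set_horner qP x); rewrite -gt => /(prime_setP qP)[].
have Pq i : q P`_i.
  rewrite coef_sum; apply: (prime_set_sum qP) => j _; rewrite coefCM.
  by apply: (prime_setMr qP); have [] := aP j.
have [||||c [cD cq cx]] := @root_descent (size (T * f - P)) (T * f - P).
- exact: leqnSn.
- rewrite rpredB ?rpredM //; apply: rpred_sum => i _.
  by rewrite rpredM ?polyOverC; [|have [] := aP i|have [] := BP i].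
- rewrite hornerD hornerN hornerM -gt -mulrA tf horner_sum big_distrr.
  rewrite -sumrB big1 // => i _ /=.
  by rewrite hornerM hornerC; have [_ <-] := BP i; rewrite mulrCA subrr.
- move=> h; have [//|//] : (forall i, q T`_i) \/ (forall i, q f`_i).
  apply: (prime_set_polyM qP) => i; rewrite -[_`_i](subrK P`_i) -coefB.
  exact: (prime_setD qP).
exists c; split=> // s.
have [F [Fm FD Fs]] := adjoin_integral s.
have [j|k /integral_closureP ks] := integral_scale_ex (E := D) Fm Fs cD; last first.
- by exists k; exact: Dic.
have /adjoinP[p pD ->] := polyOverP FD j; exists (size p).
rewrite horner_coef big_distrr; apply: rpred_sum => i _ /=.
have -> : c ^+ size p * (p`_i * x ^+ i) = p`_i * c ^+ (size p - i) * (c * x) ^+ i.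
  have {1}-> : size p = (size p - i + i)%N by rewrite subnK // ltnW.
  by rewrite exprD exprMn; ring.
by rewrite rpredM ?rpredX // rpredM ?rpredX // (polyOverP pD).
Qed.

End Birational.
End Finite.
End Conductor.

(** * Minimal primes *)

Section MinimalPrime.

(** The complement of a maximal multiplicative set containing T0 and disjoint from
    J.  The last clause, a form of minimality over J, says that each element of n is
    nilpotent modulo J after inverting the complement of n. *)
Lemma prime_set_over (S : comPzRingType) (J T0 : set S) :
    J 0 -> (forall a b, J a -> J b -> J (a + b)) -> (forall a b, J b -> J (a * b)) ->
    T0 1 -> (forall a b, T0 a -> T0 b -> T0 (a * b)) -> (forall a, T0 a -> ~ J a) ->
  exists n : set S, [/\ prime_set n, J `<=` n, forall t, T0 t -> ~ n t &
    forall h, n h -> exists u N, ~ n u /\ J (u * h ^+ N)].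
Proof.
move=> J0 JD JM T1 TM TJ.
pose P (A : set S) := (forall a b, (T0 `|` A) a -> (T0 `|` A) b -> (T0 `|` A) (a * b))
  /\ (forall a, (T0 `|` A) a -> ~ J a).
have [|A [[AM AJ] Amax]] := @Zorn_bigcup S P.
  move=> F FP Ftot; split.
    move=> a b.
    have key (B : set S) : F B -> (T0 `|` B) a -> (T0 `|` B) b ->
        (T0 `|` \bigcup_(X in F) X) (a * b).
      move=> FB Ba Bb; have [BM _] := FP _ FB.
      by have [|h] := BM _ _ Ba Bb; [left|right; exists B].
    move=> [Ta|[B FB Ba]] [Tb|[C FC Cb]].
    - by left; exact: TM.
    - by apply: (key C) => //; [left|right].
    - by apply: (key B) => //; [right|left].
    - have [BC|CB] := Ftot _ _ FB FC.
        by apply: (key C) => //; right => //; exact: BC.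
      by apply: (key B) => //; right => //; exact: CB.
  by move=> a [/TJ//|[B FB Ba]]; have [_ h] := FP _ FB; apply: h; right.
pose T := T0 `|` A.
have T1' : T 1 by left.
have sat h : ~ T h -> exists t N, T t /\ J (t * h ^+ N).
  move=> nTh; pose B := [set x | exists t N, T t /\ x = t * h ^+ N].
  have TB : T `<=` B by move=> t Tt; exists t, 0%N; rewrite expr0 mulr1.
  have TBE : T0 `|` B = B.
    by apply/seteqP; split=> x; [case=> // Tx; apply/TB; left|right].
  apply: contrapT => noJ; apply: (Amax B).
    split; last by move=> BA; apply: nTh; right; apply: BA; exists 1, 1%N; rewrite mul1r.
    by move=> a Aa; apply: TB; right.
  split; rewrite TBE; last by move=> _ [t [N [Tt ->]]] Jx; apply: noJ; exists t, N.
  move=> _ _ [t [N [Tt ->]]] [s [M [Ts ->]]]; exists (t * s), (N + M)%N.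
  by split; [exact: AM|rewrite exprD; ring].
exists (~` T); split.
- split.
  + by move=> T0'; exact: (AJ _ T0').
  + move=> a b /sat[t [N [Tt Ja]]] /sat[s [M [Ts Jb]]] Tab.
    have TX k : T ((a + b) ^+ k).
      by elim: k => [|k ih]; rewrite ?expr0 // exprS; apply: AM.
    apply: (AJ (t * s * (a + b) ^+ (N + M))); first exact/AM/TX/AM.
    have E1 (x y z u v : S) : x * y * (z * (u * v)) = x * z * u * (y * v) by ring.
    have E2 (x y z u v : S) : x * y * (u * v * z) = y * u * z * (x * v) by ring.
    rewrite exprDn big_distrr; apply: big_ind => // i _ /=.
    rewrite mulrnAr -mulr_natl; apply: (JM).
    have [Mi|iM] := leqP M i.
      by rewrite -{2}(subnK Mi) exprD E1; exact: JM.
    have -> : (N + M - i)%N = (N + M - i - N + N)%N by lia.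
    by rewrite exprD E2; exact: JM.
  + move=> a b /sat[t [N [Tt Jb]]] Tab.
    have TX k : T ((a * b) ^+ k).
      by elim: k => [|k ih]; rewrite ?expr0 // exprS; apply: AM.
    apply: (AJ (t * (a * b) ^+ N)); first exact/AM/TX.
    by rewrite exprMn mulrCA; exact: JM.
  + exact.
  + move=> a b Tab; apply: contrapT => /not_orP[/contrapT Ta /contrapT Tb].
    by apply: Tab; exact: AM.
- by move=> a Ja Ta; exact: (AJ _ Ta).
- by move=> t Tt; apply; left.
- by move=> h /sat[t [N [Tt Jh]]]; exists t, N; split=> //; apply.
Qed.

End MinimalPrime.

(** * Valuation rings of a field *)

Section Valuation.
Variable L : fieldType.
Implicit Types (O E C : subring L) (y z : L).

Definition valuation_ring O := forall y, y \in O \/ y^-1 \in O.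

(** For a valuation ring O these are the elements of the maximal ideal. *)
Definition nonunit O y := y = 0 \/ y^-1 \notin O.

Section Theory.
Variable O : subring L.
Hypothesis OV : valuation_ring O.

Lemma nonunit_sub y : nonunit O y -> y \in O.
Proof.
by case=> [->|yO]; [exact: rpred0|case: (OV y) => // h; rewrite h in yO].
Qed.

Lemma nonunitM a b : a \in O -> nonunit O b -> nonunit O (a * b).
Proof.
move=> aO [->|bO]; first by left; rewrite mulr0.
have [->|a0] := eqVneq a 0; first by left; rewrite mul0r.
right; apply: contra bO => abO.
have -> : b^-1 = a * (a * b)^-1 by rewrite invfM mulrA divff // mul1r.
exact: rpredM.
Qed.

Lemma nonunitB a b : nonunit O a -> nonunit O b -> nonunit O (a - b).
Proof.
move=> am bm.
have [->|a0] := eqVneq a 0.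
  by rewrite sub0r -mulN1r; apply: nonunitM => //; rewrite rpredN rpred1.
have [->|b0] := eqVneq b 0; first by rewrite subr0.
have [h|h] := OV (a / b).
  have -> : a - b = (a / b - 1) * b by rewrite mulrBl mul1r divfK.
  by apply: nonunitM => //; rewrite rpredB ?rpred1.
have -> : a - b = (1 - b / a) * a by rewrite mulrBl mul1r divfK.
by apply: nonunitM => //; rewrite rpredB ?rpred1 // -invf_div.
Qed.

Lemma nonunitP a b : a \in O -> b \in O -> nonunit O (a * b) ->
  nonunit O a \/ nonunit O b.
Proof.
move=> aO bO [/eqP|abO].
  by rewrite mulf_eq0 => /orP[]/eqP->; [left|right]; left.
have [aV|aV] := boolP (a^-1 \in O); last by left; right.
have [bV|bV] := boolP (b^-1 \in O); last by right; right.
by rewrite invfM rpredM in abO.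
Qed.

Lemma nonunit0 : nonunit O 0. Proof. by left. Qed.

Lemma nonunit1 : ~ nonunit O 1.
Proof. by case=> [/eqP|]; rewrite ?oner_eq0 // invr1 rpred1. Qed.

Lemma nonunitD a b : nonunit O a -> nonunit O b -> nonunit O (a + b).
Proof.
move=> am bm; rewrite -[b]opprK -[- b]sub0r.
by do 2?apply: nonunitB => //; exact: nonunit0.
Qed.

Lemma nonunit_sum (I : Type) (r : seq I) (P : pred I) (F : I -> L) :
  (forall i, P i -> nonunit O (F i)) -> nonunit O (\sum_(i <- r | P i) F i).
Proof. by move=> h; apply: big_ind => //; [exact: nonunit0|exact: nonunitD]. Qed.

Lemma nonunit_polyM (f g : {poly L}) : f \is a polyOver O -> g \is a polyOver O ->
  (forall k, nonunit O (f * g)`_k) ->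
  (forall i, nonunit O f`_i) \/ (forall i, nonunit O g`_i).
Proof.
move=> /polyOverP fO /polyOverP gO.
apply: (@gauss_prime _ (fun y => y \in O)) => //.
- exact: nonunit0.
- exact: nonunitB.
- exact: nonunitM.
- exact: nonunitP.
Qed.

Lemma nonunit_polyX (f : {poly L}) n : f \is a polyOver O ->
  (forall k, nonunit O (f ^+ n)`_k) -> forall i, nonunit O f`_i.
Proof.
move=> fO; elim: n => [/(_ 0%N)|n ih]; first by rewrite coefC => /nonunit1.
by rewrite exprS => /nonunit_polyM[||//|//]; rewrite ?rpredX.
Qed.

(** Divisibility is a total preorder in a valuation ring, so some coefficient
    divides all others. *)
Lemma dominant_coef (f : {poly L}) : f != 0 ->
  exists i, f`_i != 0 /\ forall j, f`_j / f`_i \in O.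
Proof.
move=> f0.
suff h n : (exists2 i, (i < n)%N & f`_i != 0) ->
    exists i, f`_i != 0 /\ forall j, (j < n)%N -> f`_j / f`_i \in O.
  have [|i [fi iP]] := h (size f).
    exists (size f).-1; first by rewrite prednK // size_poly_gt0.
    by rewrite -lead_coefE lead_coef_eq0.
  exists i; split=> // j; have [jf|fj] := ltnP j (size f); first exact: iP.
  by rewrite nth_default // mul0r rpred0.
elim: n => [|n ih] [i] //; rewrite ltnS => ile fi.
case: (pselect (exists2 i, (i < n)%N & f`_i != 0)) => [/ih[k [fk kP]]|no].
  have [h|h] := OV (f`_n / f`_k).
    exists k; split=> // j; rewrite ltnS leq_eqVlt => /predU1P[->//|]; exact: kP.
  have [fn|fn] := eqVneq f`_n 0.
    exists k; split=> // j; rewrite ltnS leq_eqVlt => /predU1P[->|]; last exact: kP.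
    by rewrite fn mul0r rpred0.
  exists n; split=> // j; rewrite ltnS leq_eqVlt => /predU1P[->|jn].
    by rewrite divff // rpred1.
  rewrite invf_div in h.
  have -> : f`_j / f`_n = f`_j / f`_k * (f`_k / f`_n) by rewrite mulrA divfK.
  by rewrite rpredM ?kP.
have {ile}E : i = n.
  apply/eqP; move: ile; rewrite leq_eqVlt => /orP[//|il].
  by case: no; exists i.
exists i; split=> // j; rewrite ltnS leq_eqVlt -E => /predU1P[->|ji].
  by rewrite divff // rpred1.
have [->|fj] := eqVneq f`_j 0; first by rewrite mul0r rpred0.
by case: no; exists j => //; rewrite -E.
Qed.

(** Normalize h and g by dominant coefficients.  If the one of h were not in O, its
    inverse would be in the maximal ideal and so would all coefficients of the
    normalized product, against Gauss's lemma. *)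
Lemma monic_factor_over (h g : {poly L}) : h \is monic -> g \is monic ->
  h * g \is a polyOver O -> h \is a polyOver O.
Proof.
move=> hm gm hgO.
have [i [hi iP]] := dominant_coef (monic_neq0 hm).
have [j [gj jP]] := dominant_coef (monic_neq0 gm).
have hO : (h`_i)^-1 *: h \is a polyOver O.
  by apply/polyOverP => k; rewrite coefZ mulrC.
have gO : (g`_j)^-1 *: g \is a polyOver O.
  by apply/polyOverP => k; rewrite coefZ mulrC.
have giO : (g`_j)^-1 \in O.
  by have := jP (size g).-1; rewrite -lead_coefE (monicP gm) mul1r.
case: (boolP (h`_i \in O)) => hiO.
  by apply/polyOverP => k; rewrite -[h`_k](divfK hi) rpredM.
have him : nonunit O (h`_i)^-1 by right; rewrite invrK.
exfalso; have := nonunit_polyM hO gO; case.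
- move=> k; rewrite -scalerAl -scalerAr !coefZ mulrC; apply: nonunitM => //.
  by rewrite rpredM // (polyOverP hgO).
- by move=> /(_ i); rewrite coefZ mulVf // => /nonunit1.
- by move=> /(_ j); rewrite coefZ mulVf // => /nonunit1.
Qed.

End Theory.
End Valuation.

(** * Domination by valuation rings and integrality *)

Section Domination.
Variable L : fieldType.
Variables (C0 : subring L) (I0 T0 : L -> Prop).

(** Pairs of a subring and an ideal of it, extending C0 and I0, with the ideal
    disjoint from T0.  The set T0 is there to keep the ideal inside a given prime;
    a maximal pair is a valuation ring. *)
Record local_pair := LocalPair {
  lp_ring : subring L;
  lp_ideal : L -> Prop;
  lp_base : {subset C0 <= lp_ring};
  lp_sub : forall a, lp_ideal a -> a \in lp_ring;
  lp_ext : forall a, I0 a -> lp_ideal a;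
  lp_D : forall a b, lp_ideal a -> lp_ideal b -> lp_ideal (a + b);
  lp_M : forall a b, a \in lp_ring -> lp_ideal b -> lp_ideal (a * b);
  lp_T : forall a, T0 a -> ~ lp_ideal a }.

Definition lp_le (X Y : local_pair) : bool :=
  `[< {subset lp_ring X <= lp_ring Y} /\ forall a, lp_ideal X a -> lp_ideal Y a >].

Hypothesis I0C : forall a, I0 a -> a \in C0.
Hypothesis I00 : I0 0.
Hypothesis I0D : forall a b, I0 a -> I0 b -> I0 (a + b).
Hypothesis I0M : forall a b, a \in C0 -> I0 b -> I0 (a * b).
Hypothesis T0C : forall a, T0 a -> a \in C0.
Hypothesis T01 : T0 1.
Hypothesis T0M : forall a b, T0 a -> T0 b -> T0 (a * b).
Hypothesis TI0 : forall a, T0 a -> ~ I0 a.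

Lemma lp_max : exists X, forall Y, lp_le X Y -> lp_le Y X.
Proof.
pose X0 := @LocalPair C0 I0 (fun _ => id) I0C (fun _ => id) I0D I0M TI0.
have [|r s t /asboolP[a b] /asboolP[c d]|A Atot|X Xmax] := @ZL_preorder _ X0 lp_le.
- by move=> t; apply/asboolP; split.
- by apply/asboolP; split=> [x /a/c|x /b/d].
- case: (pselect (exists X, A X)) => [[X1 AX1]|noA]; last first.
    by exists X0 => s As; case: noA; exists s.
  have chain X Y : A X -> A Y -> exists Z, [/\ A Z, lp_le X Z & lp_le Y Z].
    have refl Z : lp_le Z Z by apply/asboolP; split.
    by move=> AX AY; have [h|h] := Atot _ _ AX AY; [exists Y|exists X].
  pose Cp y := `[< exists X, A X /\ y \in lp_ring X >].
  have Cc : subring_closed Cp.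
    split=> [|y z|y z]; first by apply/asboolP; exists X1; rewrite rpred1.
      move=> /asboolP[X [AX yX]] /asboolP[Y [AY zY]]; apply/asboolP.
      have [Z [AZ /asboolP[XZ _] /asboolP[YZ _]]] := chain _ _ AX AY.
      by exists Z; split=> //; apply: rpredB; [exact: XZ|exact: YZ].
    move=> /asboolP[X [AX yX]] /asboolP[Y [AY zY]]; apply/asboolP.
    have [Z [AZ /asboolP[XZ _] /asboolP[YZ _]]] := chain _ _ AX AY.
    by exists Z; split=> //; apply: rpredM; [exact: XZ|exact: YZ].
  pose I y := exists X, A X /\ lp_ideal X y.
  have CP y : reflect (exists X, A X /\ y \in lp_ring X) (y \in Subring Cc).
    exact: asboolP.
  unshelve eexists (@LocalPair (Subring Cc) I _ _ _ _ _ _).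
  + by move=> y yC; apply/CP; exists X1; split=> //; exact: lp_base.
  + by move=> a [X [AX aX]]; apply/CP; exists X; split=> //; exact: lp_sub.
  + by move=> a aI; exists X1; split=> //; exact: lp_ext.
  + move=> a b [X [AX aX]] [Y [AY bY]].
    have [Z [AZ /asboolP[_ XZ] /asboolP[_ YZ]]] := chain _ _ AX AY.
    by exists Z; split=> //; apply: lp_D; [exact: XZ|exact: YZ].
  + move=> a b /CP[X [AX aX]] [Y [AY bY]].
    have [Z [AZ /asboolP[XZ _] /asboolP[_ YZ]]] := chain _ _ AX AY.
    by exists Z; split=> //; apply: lp_M; [exact: XZ|exact: YZ].
  + by move=> a Ta [X [_ /(lp_T Ta)]].
  + move=> s As; apply/asboolP; split=> [y ys|a as']; first by apply/CP; exists s.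
    by exists s.
- by exists X => Y /Xmax.
Qed.

(** A maximal pair (C, I) is a valuation ring: elements of T0 and of 1 + I are
    invertible in C by maximality, and if neither y nor 1/y is in C, then both I C[y]
    and I C[1/y] contain 1, and two such relations reduce each other until their
    degree is zero. *)
Lemma dominating_valuation : exists O : subring L, [/\ valuation_ring O,
  {subset C0 <= O}, forall a, I0 a -> nonunit O a & forall t, T0 t -> t^-1 \in O].
Proof.
have [X Xmax] := lp_max; pose C := lp_ring X; pose I := lp_ideal X.
have IC a : I a -> a \in C by exact: lp_sub.
have ID a b : I a -> I b -> I (a + b) by exact: lp_D.
have IM a b : a \in C -> I b -> I (a * b) by exact: lp_M.
have I0' : I 0 by apply: lp_ext.
have Isum (J : Type) (r : seq J) (P : pred J) (F : J -> L) :
  (forall i, P i -> I (F i)) -> I (\sum_(i <- r | P i) F i).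
  by move=> h; apply: big_ind.
have T0X t k : T0 t -> T0 (t ^+ k).
  by move=> Tt; elim: k => [|k ih]; rewrite ?expr0 // exprS; exact: T0M.
(* by maximality, adjoining y outside C makes the extended ideal meet T0 *)
have ext y : y \notin C -> exists t (p : {poly L}), [/\ T0 t, forall i, I p`_i & p.[y] = t].
  move=> yC; apply: contrapT => no.
  pose J z := exists p : {poly L}, (forall i, I p`_i) /\ z = p.[y].
  have [Y [YC YJ]] : exists Y, lp_ring Y = adjoin C y /\ lp_ideal Y = J.
    unshelve eexists (@LocalPair (adjoin C y) J _ _ _ _ _ _) => //.
    - by move=> z zC; apply/adjoin_base/lp_base.
    - by move=> _ [p [pI ->]]; apply/adjoinP; exists p => //; apply/polyOverP => i; exact: IC.
    - move=> a aI; exists a%:P; rewrite hornerC; split=> // i; rewrite coefC.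
      by case: eqP => _ //; exact: lp_ext.
    - move=> _ _ [p [pI ->]] [r [rI ->]]; exists (p + r); rewrite hornerD; split=> // i.
      by rewrite coefD; exact: ID.
    - move=> _ _ /adjoinP[p /polyOverP pC ->] [r [rI ->]]; exists (p * r).
      rewrite hornerM; split=> // i; rewrite coefM; apply: Isum => j _; exact: IM.
    - by move=> a Ta [p [pI E]]; apply: no; exists a, p.
  have : lp_le X Y.
    apply/asboolP; rewrite YC YJ; split=> [z|a aI]; first exact: adjoin_base.
    by exists a%:P; rewrite hornerC; split=> // i; rewrite coefC; case: eqP.
  move=> /Xmax /asboolP[+ _]; rewrite YC => /(_ y (adjoin_gen _ _)).
  by apply/negP.
have TV t : T0 t -> t^-1 \in C.
  move=> Tt; apply: contrapT => /negP/ext[s [p [Ts pI ps]]].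
  have t0 : t != 0 by apply/eqP => t0; apply: (TI0 Tt); rewrite t0.
  apply: (lp_T (T0M Ts (T0X t (size p) Tt)) (l := X)).
  rewrite -ps horner_coef big_distrl; apply: Isum => i _ /=.
  rewrite -mulrA mulrC; apply: IM => //.
  rewrite exprVn -{2}(subnKC (ltnW (ltn_ord i))) exprD mulKf ?expf_neq0 // rpredX //.
  exact/lp_base/T0C.
have I1 : ~ I 1 by exact: lp_T.
have unit1B c : I c -> (1 - c)^-1 \in C.
  move=> cI; apply: contrapT => /negP/ext[s [p [Ts pI ps]]].
  have c1 : 1 - c != 0.
    by rewrite subr_eq0; apply/eqP => c1; apply: I1; rewrite c1.
  have drop k z : z \in C -> I (z * (1 - c) ^+ k) -> I z.
    elim: k => [|k ih] zC; first by rewrite mulr1.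
    rewrite exprSr mulrA => h; apply: ih => //.
    rewrite -[_ * _](subrK (z * (1 - c) ^+ k * c)).
    have cC := IC _ cI.
    apply: ID; last by apply: IM => //; rewrite rpredM ?rpredX ?rpredB ?rpred1.
    by move: h; rewrite mulrBr mulr1.
  apply: (lp_T Ts (l := X)); apply: (drop (size p)); first exact/lp_base/T0C.
  rewrite -ps horner_coef big_distrl; apply: Isum => i _ /=.
  rewrite -mulrA mulrC; apply: IM => //.
  rewrite exprVn -{2}(subnKC (ltnW (ltn_ord i))) exprD mulKf ?expf_neq0 // rpredX //.
  by rewrite rpredB ?rpred1 ?IC.
have ext1 y : y \notin C -> exists p : {poly L}, (forall i, I p`_i) /\ p.[y] = 1.
  move=> /ext[t [p [Tt pI pt]]]; exists (t^-1 *: p); split=> [i|].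
    by rewrite coefZ; apply: IM => //; exact: TV.
  rewrite hornerZ pt mulVf //; apply/eqP => t0; apply: (TI0 Tt).
  by rewrite t0.
(* if p(y) = 1 and r(1/y) = 1 with coefficients in I and deg r <= deg p, solving
   the second relation for y^m and substituting into the top term of p lowers
   the degree of p *)
have red y (p r : {poly L}) n m : y != 0 -> (forall i, I p`_i) -> (forall i, I r`_i) ->
    (size p <= n.+1)%N -> (size r <= m.+1)%N -> p.[y] = 1 -> r.[y^-1] = 1 ->
    (m <= n)%N -> exists p' : {poly L}, [/\ forall i, I p'`_i, (size p' <= n)%N & p'.[y] = 1].
  move=> y0 pI rI szp szr py ry mn; pose w := (1 - r`_0)^-1.
  have r01 : 1 - r`_0 != 0.
    by rewrite subr_eq0; apply/eqP => c1; apply: I1; rewrite c1.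
  exists (\poly_(i < n) (p`_i + p`_n * w * r`_(n - i))); split=> [i||].
  - rewrite coef_poly; case: ifP => // _; apply: ID => //; apply: IM => //.
    by apply: rpredM; [exact: IC|exact: unit1B].
  - exact: size_poly.
  - rewrite horner_poly -[RHS]py (horner_coef_wide _ szp) big_ord_recr /=.
    under eq_bigr do rewrite mulrDl.
    rewrite big_split /=; congr (_ + _).
    have : y ^+ n * (1 - r`_0) = \sum_(i < n) r`_(n - i) * y ^+ i.
      rewrite -{1}ry (@horner_coef_wide _ n.+1) ?(leq_trans szr) //.
      rewrite big_ord_recl expr0 mulr1 addrC addKr big_distrr /=.
      rewrite (reindex_inj rev_ord_inj); apply: eq_bigr => i _ /=.
      rewrite /bump /= add1n subnSK // exprVn mulrCA; congr (_ * _).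
      have {1}-> : n = (i + (n - i))%N by rewrite subnKC // ltnW.
      by rewrite exprD mulfK // expf_neq0.
    under eq_bigr do rewrite -mulrA.
    rewrite -big_distrr /= => <-.
    by rewrite -mulrA [w * _]mulrC -mulrA mulfV ?mulr1.
have norel k : forall n m y (p r : {poly L}), (n + m <= k)%N -> y != 0 ->
    (forall i, I p`_i) -> (forall i, I r`_i) ->
    (size p <= n)%N -> (size r <= m)%N -> p.[y] = 1 -> r.[y^-1] = 1 -> False.
  have z0 (p : {poly L}) y : (size p <= 0)%N -> p.[y] <> 1.
    rewrite leqn0 size_poly_eq0 => /eqP->; rewrite horner0 => /esym/eqP.
    by rewrite oner_eq0.
  elim: k => [|k ih] [|n] [|m] y p r nm y0 pI rI szp szr py ry;
    try by [exact: (z0 p y) | exact: (z0 r y^-1) | lia].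
  have [mn|/ltnW nm'] := leqP m n.
    have [p' [p'I szp' p'y]] := red y p r n m y0 pI rI szp szr py ry mn.
    by apply: (ih n m.+1 y p' r) => //; lia.
  have := red y^-1 r p m n _ rI pI szr szp ry _ nm'.
  rewrite invr_eq0 invrK => /(_ y0 py)[r' [r'I szr' r'y]].
  by apply: (ih n.+1 m y p r') => //; lia.
exists C; split=> //.
- move=> y; apply: contrapT => /not_orP[/negP/ext1[p [pI py]] yC].
  have [y0|y0] := eqVneq y 0.
    by apply: yC; rewrite y0 invr0 rpred0.
  move: yC => /negP/ext1[r [rI ry]].
  exact: (norel _ (size p) (size r) y p r (leqnn _)).
- exact: lp_base.
- move=> a aI; have [->|a0] := eqVneq a 0; [by left|right].
  apply/negP => aV; apply: I1; rewrite -(mulVf a0); apply: IM => //.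
  exact: lp_ext.
Qed.

End Domination.

Section Integrality.
Variable L : fieldType.
Implicit Types (O E F : subring L) (y z : L).

(** If y is not integral over E, then 1/y is not invertible in E[1/y], and some
    valuation ring has 1/y in its maximal ideal. *)
Lemma integral_valuation E y :
  (forall O, valuation_ring O -> {subset E <= O} -> y \in O) -> integral E y.
Proof.
move=> yO; have [->|y0] := eqVneq y 0; first exact/integral_mem/rpred0.
pose C0 := adjoin E y^-1; pose I0 z := exists2 c, c \in C0 & z = y^-1 * c.
have zC : y^-1 \in C0 by exact: adjoin_gen.
case: (pselect (I0 1)) => [[c /adjoinP[p /polyOverP pE ->] E1]|I1].
  pose N := size p.
  exists ('X^N - \poly_(j < N) p`_(N - j.+1)); split.
  - by rewrite monicE lead_coefDl ?lead_coefXn // size_polyXn size_polyN ltnS size_poly.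
  - by rewrite rpredB ?polyOverXn //; apply: polyOver_poly.
  - apply/eqP; rewrite hornerD hornerN hornerXn horner_poly.
    rewrite -[y ^+ N]mulr1 E1 horner_coef !big_distrr /= -/N.
    rewrite (reindex_inj rev_ord_inj) -sumrB big1 // => i _ /=.
    have Ni : y ^+ N = y ^+ (N - i.+1) * y ^+ i.+1 by rewrite -exprD subnK.
    have -> : y ^+ i = y ^+ N * (y^-1 * y^-1 ^+ (N - i.+1)).
      have yN : y ^+ (N - i.+1) != 0 by rewrite expf_neq0.
      by rewrite Ni exprS exprVn; field; rewrite yN y0.
    by rewrite (mulrCA y^-1) (mulrCA (y ^+ N)) subrr.
have [||||||||O [OV CO OI _]] := @dominating_valuation L C0 I0 (fun z => z = 1).
- by move=> _ [c cC ->]; rewrite rpredM.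
- by exists 0; rewrite ?rpred0 ?mulr0.
- by move=> _ _ [c cC ->] [d dC ->]; exists (c + d); rewrite ?rpredD ?mulrDr.
- by move=> a _ aC [c cC ->]; exists (a * c); rewrite ?rpredM // mulrCA.
- by move=> _ ->; exact: rpred1.
- by [].
- by move=> _ _ -> ->; rewrite mulr1.
- by move=> _ ->.
have : nonunit O y^-1 by apply: OI; exists 1; rewrite ?rpred1 ?mulr1.
case=> [/eqP|]; first by rewrite invr_eq0 (negbTE y0).
by rewrite invrK yO // => z zE; apply/CO/adjoin_base.
Qed.

Definition min_poly_over F y (h : {poly L}) := [/\ h \is monic, h \is a polyOver F,
  h.[y] = 0 & forall g : {poly L}, g != 0 -> g \is a polyOver F -> g.[y] = 0 ->
    (size h <= size g)%N].

Lemma min_poly_over_exists F y : (forall z, z \in F -> z^-1 \in F) ->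
  (exists g : {poly L}, [/\ g != 0, g \is a polyOver F & g.[y] = 0]) ->
  exists h, min_poly_over F y h.
Proof.
move=> FV [g [g0 gF gy]].
pose P n := `[< exists g : {poly L}, [/\ g != 0, g \is a polyOver F, g.[y] = 0 & size g = n] >].
have ex : exists n, P n by exists (size g); apply/asboolP; exists g.
case: (ex_minnP ex) => n /asboolP[h [h0 hF hy hn]] nmin.
exists ((lead_coef h)^-1 *: h); split.
- by rewrite monicE lead_coefZ mulVf // lead_coef_eq0.
- by rewrite polyOverZ // FV // (polyOverP hF).
- by rewrite hornerZ hy mulr0.
- move=> k k0 kF ky; rewrite size_scale ?invr_eq0 ?lead_coef_eq0 // hn.
  by apply: nmin; apply/asboolP; exists k.
Qed.

(** A minimal polynomial divides any monic equation of y over E; by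
    [monic_factor_over] its coefficients lie in every valuation ring containing E. *)
Lemma min_poly_over_integral E F y h : {subset E <= F} -> min_poly_over F y h ->
  integral E y -> forall i, integral E h`_i.
Proof.
move=> EF [hm hF hy hmin] [G [Gm GE Gy]] i.
have GF : G \is a polyOver F by apply/polyOverP => j; exact/EF/(polyOverP GE).
have [q [r [qF rF GqR szr]]] := polyOver_divmod hm hF GF.
have r0 : r = 0.
  apply/eqP; apply/negPn/negP => r0; move: szr; rewrite ltnNge hmin //.
  by have := rootP Gy; rewrite GqR hornerD hornerM hy mulr0 add0r.
rewrite r0 addr0 in GqR.
have qm : q \is monic by move: Gm; rewrite GqR monicMr.
apply: integral_valuation => O OV EO.
suff /polyOverP : h \is a polyOver O by [].
apply: (monic_factor_over OV hm qm); rewrite mulrC -GqR.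
by apply/polyOverP => j; exact/EO/(polyOverP GE).
Qed.

End Integrality.

(** * Integral closedness of polynomial rings *)

Section Frac.
Variable L : fieldType.
Implicit Types (E K O : subring L).

Lemma frac_closed E : subring_closed
  (fun z => `[< exists a b, [/\ a \in E, b \in E, b != 0 & z = a / b] >]).
Proof.
split=> [|y z|y z].
- by apply/asboolP; exists 1, 1; rewrite rpred1 oner_eq0 divr1.
- move=> /asboolP[a [b [aE bE b0 ->]]] /asboolP[c [d [cE dE d0 ->]]]; apply/asboolP.
  exists (a * d - c * b), (b * d); rewrite rpredB ?rpredM // mulf_neq0 //; split=> //.
  by field; rewrite b0 d0.
- move=> /asboolP[a [b [aE bE b0 ->]]] /asboolP[c [d [cE dE d0 ->]]]; apply/asboolP.
  exists (a * c), (b * d); rewrite !rpredM // mulf_neq0 //; split=> //.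
  by field; rewrite b0 d0.
Qed.

Definition frac E := Subring (frac_closed E).

Lemma fracP E z : reflect (exists a b, [/\ a \in E, b \in E, b != 0 & z = a / b])
  (z \in frac E).
Proof. exact: asboolP. Qed.

Lemma frac_base E z : z \in E -> z \in frac E.
Proof. by move=> zE; apply/fracP; exists z, 1; rewrite rpred1 oner_eq0 divr1. Qed.

Lemma fracV E z : z \in frac E -> z^-1 \in frac E.
Proof.
move=> /fracP[a [b [aE bE b0 ->]]]; have [->|a0] := eqVneq a 0.
  by rewrite mul0r invr0 rpred0.
by apply/fracP; exists b, a; rewrite invf_div.
Qed.

Lemma clear_denominators E (p : {poly L}) : p \is a polyOver (frac E) ->
  exists b, [/\ b \in E, b != 0 & b *: p \is a polyOver E].
Proof.
move=> /polyOverP pE.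
have h n : exists b, [/\ b \in E, b != 0 & forall i, (i < n)%N -> b * p`_i \in E].
  elim: n => [|n [b [bE b0 bP]]]; first by exists 1; rewrite rpred1 oner_eq0.
  have /fracP[c [d [cE dE d0 pn]]] := pE n.
  exists (d * b); split; [exact: rpredM|by rewrite mulf_neq0|].
  move=> i; rewrite ltnS leq_eqVlt => /predU1P[->|/bP h].
    by rewrite pn mulrC mulrA divfK // rpredM.
  by rewrite -mulrA rpredM.
have [b [bE b0 bP]] := h (size p); exists b; split=> //.
apply/polyOverP => i; rewrite coefZ; have [/bP//|ip] := ltnP i (size p).
by rewrite nth_default // mulr0 rpred0.
Qed.

Section Transcendental.
Variables (K : subring L) (x : L).
Hypothesis KV : forall z, z \in K -> z^-1 \in K.
Hypothesis xK : forall p : {poly L}, p \is a polyOver K -> p.[x] = 0 -> p = 0.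

Lemma transcendental_inj (p r : {poly L}) : p \is a polyOver K -> r \is a polyOver K ->
  p.[x] = r.[x] -> p = r.
Proof.
move=> pK rK pr; apply/eqP; rewrite -subr_eq0; apply/eqP/xK; first exact: rpredB.
by rewrite hornerD hornerN pr subrr.
Qed.

(** With b a denominator of least degree of c, and c = e/b, the integral equation
    shows that b divides some e^m, and then b divides 1. *)
Lemma adjoin_integrally_closed c : c \in frac (adjoin K x) -> integral (adjoin K x) c ->
  c \in adjoin K x.
Proof.
move=> /fracP[a1 [b2 [/adjoinP[a aK ->] /adjoinP[b' b'K ->] bx cE0]]] [G [Gm GK Gc]].
(* the denominators of c form an ideal of K[x]; b1 has least degree in it *)
pose P n := `[< exists b : {poly L}, [/\ b \is a polyOver K, b != 0,
  b.[x] * c \in adjoin K x & size b = n] >].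
have ex : exists n, P n.
  exists (size b'); apply/asboolP; exists b'; split=> //.
    by apply: contraNneq bx => ->; rewrite horner0.
  by rewrite cE0 mulrC divfK //; apply/adjoinP; exists a.
case: (ex_minnP ex) => n /asboolP[b1 [b1K b10 b1c szb1]] nmin.
have lK : lead_coef b1 \in K by exact: (polyOverP b1K).
have l0 : lead_coef b1 != 0 by rewrite lead_coef_eq0.
pose b := (lead_coef b1)^-1 *: b1.
have bm : b \is monic by rewrite monicE lead_coefZ mulVf.
have bK : b \is a polyOver K by rewrite polyOverZ // KV.
have szb : size b = n by rewrite size_scale // invr_eq0.
have bc : b.[x] * c \in adjoin K x.
  by rewrite hornerZ -mulrA rpredM // adjoin_base // KV.
have bx0 : b.[x] != 0.
  by apply/eqP => b0; move: (monic_neq0 bm); rewrite (xK bK b0) eqxx.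
have den (d : {poly L}) : d \is a polyOver K -> d.[x] * c \in adjoin K x ->
    exists2 k, k \in adjoin K x & d.[x] = k * b.[x].
  move=> dK dc; have [k [r [kK rK dE szr]]] := polyOver_divmod bm bK dK.
  exists k.[x]; first by apply/adjoinP; exists k.
  suff r0 : r = 0 by rewrite dE r0 addr0 hornerM.
  apply/eqP/negPn/negP => r0; move: szr; rewrite szb ltnNge nmin //.
  apply/asboolP; exists r; split=> //.
  have -> : r.[x] * c = d.[x] * c - k.[x] * (b.[x] * c).
    by rewrite dE hornerD hornerM; ring.
  by rewrite rpredB // rpredM //; apply/adjoinP; exists k.
have /adjoinP[e eK eE] := bc.
have cE : c = e.[x] / b.[x] by rewrite -eE mulrAC divff // mul1r.
(* if b divides e^m then e^(m-1) c = e^m / b is a polynomial, so e^(m-1) is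
   again a denominator, that is, a multiple of b *)
have desc m : (exists2 k, k \in adjoin K x & e.[x] ^+ m = k * b.[x]) -> c \in adjoin K x.
  elim: m => [|m ih] [k kE].
    rewrite expr0 => k1; rewrite cE -[_ / _]mulr1 k1 mulrA mulrAC divfK // mulrC.
    by rewrite rpredM //; apply/adjoinP; exists e.
  rewrite exprSr => ke; apply: ih.
  have := @den (e ^+ m); rewrite horner_exp; apply; first exact: rpredX.
  have -> : e.[x] ^+ m * c = k; last by [].
  by rewrite cE mulrA ke mulfK.
pose m := (size G).-1.
have szG : size G = m.+1 by rewrite prednK // size_poly_gt0 monic_neq0.
have Gm1 : G`_m = 1 by exact/eqP/Gm.
apply: (desc m); exists (- \sum_(i < m) G`_i * (e.[x] ^+ i * b.[x] ^+ (m - i.+1))).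
  rewrite rpredN; apply: rpred_sum => i _; rewrite rpredM ?(polyOverP GK) //.
  by rewrite rpredM // rpredX //; apply/adjoinP; [exists e|exists b].
have := rootP Gc; rewrite horner_coef szG big_ord_recr /= Gm1 mul1r.
rewrite cE => /(congr1 (fun z => b.[x] ^+ m * z)); rewrite mulr0 mulrDr.
rewrite -exprMn mulrCA divff // mulr1 => /eqP; rewrite addrC addr_eq0 => /eqP ->.
rewrite mulNr; congr (- _); rewrite big_distrl big_distrr; apply: eq_bigr => i _ /=.
have expB (z : L) k l : (k < l)%N -> z ^+ l = z ^+ (l - k.+1) * z * z ^+ k.
  by move=> kl; rewrite -mulrA -exprS -exprD subnK.
rewrite (expB b.[x] i m) //.
have E (u v w z g : L) : z != 0 -> u * v * z * (g * (w / z)) = g * (w * u) * v.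
  by move=> z0; field.
by rewrite expr_div_n E // expf_neq0.
Qed.

(** By [adjoin_integrally_closed] c is g(x) with g over K.  If g had a coefficient
    outside O, dividing by a dominant one would give a polynomial f with a
    coefficient 1 whose power is zero modulo the maximal ideal. *)
Lemma gauss_integrally_closed O (R : subring L) c : valuation_ring O ->
  (forall z, z \in R <-> z \in O /\ z \in K) ->
  c \in frac (adjoin K x) -> integral (adjoin R x) c -> c \in adjoin R x.
Proof.
move=> OV RE cF ci.
have RO z : z \in R -> z \in O by move=> /RE[].
have RK z : z \in R -> z \in K by move=> /RE[].
have sub : {subset adjoin R x <= adjoin K x}.
  apply: adjoin_min => [z /RK|]; [exact: adjoin_base|exact: adjoin_gen].
have /adjoinP[g gK gE] := adjoin_integrally_closed cF (integral_sub sub ci).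
have [g0|g0] := eqVneq g 0; first by rewrite gE g0 horner0 rpred0.
have [i [gi iP]] := dominant_coef OV g0.
suff giO : g`_i \in O.
  apply/adjoinP; exists g => //; apply/polyOverP => j; apply/RE; split.
    by rewrite -[g`_j](divfK gi) rpredM.
  exact: (polyOverP gK).
apply: contrapT => /negP giO.
have gim : nonunit O (g`_i)^-1 by right; rewrite invrK.
pose f := (g`_i)^-1 *: g.
have fK : f \is a polyOver K by rewrite polyOverZ // KV // (polyOverP gK).
have fO : f \is a polyOver O by apply/polyOverP => j; rewrite coefZ mulrC.
have [G [Gm GR Gc]] := ci.
pose m := (size G).-1.
have szG : size G = m.+1 by rewrite prednK // size_poly_gt0 monic_neq0.
have Gm1 : G`_m = 1 by exact/eqP/Gm.
have /choice[r rP] : forall j, exists r, r \is a polyOver R /\ G`_j = r.[x].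
  by move=> j; have /adjoinP[r] := polyOverP GR j; exists r.
pose s := \sum_(j < m) (g`_i)^-1 ^+ (m - j) *: (r j * f ^+ j).
have rK j : r j \is a polyOver K.
  by have [/polyOverP rR _] := rP j; apply/polyOverP => k; exact/RK.
have rO j : r j \is a polyOver O.
  by have [/polyOverP rR _] := rP j; apply/polyOverP => k; exact/RO.
have fs : f ^+ m = - s.
  apply: transcendental_inj; first exact: rpredX.
    rewrite rpredN; apply: rpred_sum => j _; rewrite polyOverZ ?rpredM ?rpredX //.
    by rewrite KV // (polyOverP gK).
  have fx : f.[x] = (g`_i)^-1 * c by rewrite hornerZ gE.
  rewrite hornerN horner_exp horner_sum fx.
  have := rootP Gc; rewrite horner_coef szG big_ord_recr /= Gm1 mul1r.
  move/(congr1 (fun z => (g`_i)^-1 ^+ m * z)); rewrite mulr0 mulrDr -exprMn.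
  move=> /eqP; rewrite addrC addr_eq0 => /eqP ->; congr (- _).
  rewrite big_distrr; apply: eq_bigr => j _ /=.
  rewrite hornerZ hornerM horner_exp fx exprMn; have [_ ->] := rP j.
  have -> : (g`_i)^-1 ^+ m = (g`_i)^-1 ^+ (m - j) * (g`_i)^-1 ^+ j.
    by rewrite -exprD subnK // ltnW.
  by rewrite -!mulrA; congr (_ * _); rewrite mulrCA.
have : forall k, nonunit O (f ^+ m)`_k.
  move=> k; rewrite fs coefN -mulN1r; apply: nonunitM => //; first by rewrite rpredN rpred1.
  rewrite coef_sum; apply: nonunit_sum => // j _; rewrite coefZ mulrC.
  apply: nonunitM => //; first by apply: (polyOverP _); rewrite rpredM ?rpredX.
  rewrite -[(m - j)%N]prednK ?subn_gt0 // exprSr; apply: nonunitM => //.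
  by rewrite rpredX //; exact: nonunit_sub.
move=> /(nonunit_polyX OV fO)/(_ i); rewrite coefZ mulVf // => /nonunit1; exact.
Qed.

End Transcendental.
End Frac.

(** * A transcendental generator is not residually algebraic *)

Section Image.
Variables (S L : comNzRingType) (th : {rmorphism S -> L}).

Lemma image_closed (D : subring S) :
  subring_closed (fun y => `[< exists2 d, d \in D & y = th d >]).
Proof.
split=> [|y z|y z].
- by apply/asboolP; exists 1; rewrite ?rpred1 ?rmorph1.
- move=> /asboolP[a aD ->] /asboolP[b bD ->]; apply/asboolP.
  by exists (a - b); rewrite ?rpredB ?rmorphB.
- move=> /asboolP[a aD ->] /asboolP[b bD ->]; apply/asboolP.
  by exists (a * b); rewrite ?rpredM ?rmorphM.
Qed.

Definition image_ring D := Subring (image_closed D).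

Lemma image_ringP (D : subring S) y : reflect (exists2 d, d \in D & y = th d) (y \in image_ring D).
Proof. exact: asboolP. Qed.

Lemma image_mem (D : subring S) d : d \in D -> th d \in image_ring D.
Proof. by move=> dD; apply/image_ringP; exists d. Qed.

Lemma integral_image (D : subring S) z : integral D z -> integral (image_ring D) (th z).
Proof.
move=> [p [pm pD /rootP pz]]; exists (map_poly th p); split.
- exact: monic_map.
- by apply/polyOverP => i; rewrite coef_map; apply/image_mem/(polyOverP pD).
- by apply/rootP; rewrite horner_map pz rmorph0.
Qed.

Lemma image_poly_lift (D : subring S) (p : {poly L}) : p \is a polyOver (image_ring D) ->
  exists p0 : {poly S}, p0 \is a polyOver D /\ map_poly th p0 = p.
Proof.
move=> /polyOverP pD.
have /choice[c cP] : forall i, exists c, c \in D /\ p`_i = th c.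
  by move=> i; have /image_ringP[c] := pD i; exists c.
exists (\poly_(i < size p) c i); split.
  by apply: polyOver_poly => i _; have [] := cP i.
apply/polyP => i; rewrite coef_map coef_poly; case: ltnP => ip /=.
  by have [_ ->] := cP i.
by rewrite rmorph0 nth_default.
Qed.

Lemma full_closed : subring_closed (fun _ : S => true).
Proof. by []. Qed.
Definition full_ring := Subring full_closed.

End Image.

Section NotResiduallyAlgebraic.
Variables (S : comNzRingType) (L : fieldType) (th : {rmorphism S -> L}).
Variables (D : subring S) (x : S) (q : S -> Prop).
Hypothesis qP : prime_set q.
Hypothesis thq : forall a, th a = 0 -> q a.
Hypothesis thx : forall h : {poly S}, h \is a polyOver D -> th h.[x] = 0 ->
  forall i, th h`_i = 0.
Hypothesis Sint : forall s, integral (adjoin D x) s.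

Let K := frac (image_ring th D).

Let KV z : z \in K -> z^-1 \in K. Proof. exact: fracV. Qed.

Let xK (p : {poly L}) : p \is a polyOver K -> p.[th x] = 0 -> p = 0.
Proof.
move=> /clear_denominators[b [bD b0 bp]] px.
have [h [hD hE]] := image_poly_lift bp.
apply/polyP => i; rewrite coef0.
have : th h`_i = 0.
  by apply: thx => //; rewrite -horner_map /= hE hornerZ px mulr0.
rewrite -coef_map hE coefZ => /eqP; rewrite mulf_eq0 (negbTE b0) /=.
exact/eqP.
Qed.

(** Suppose t f(x) is in qS, with t outside q and f having a coefficient outside q.
    In a valuation ring O centred at q we have t f(x) = pi s with pi in the maximal
    ideal and s integral over R[x], where R is the trace of O on K.  The minimal
    polynomials of t and s over K(x) have coefficients in R[x] and correspond under
    scaling by f(x)/pi; comparing coefficients puts a power of t in the maximal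
    ideal, while t is a unit of O. *)
Lemma transcendental_not_residually_algebraic : ~ residually_algebraic D q x.
Proof.
move=> [f [t [fD fq tq [n [a [b [aP tf]]]]]]].
have tht u : ~ q u -> th u != 0 by move=> uq; apply/eqP => /thq.
have [||||||||O [OV SO Oq Ot]] := @dominating_valuation L
  (image_ring th (full_ring S)) (fun y => exists2 s, q s & y = th s)
  (fun y => exists2 s, ~ q s & y = th s).
- by move=> _ [s _ ->]; exact: image_mem.
- by exists 0; [exact: (prime_set0 qP)|rewrite rmorph0].
- move=> _ _ [r qr ->] [s qs ->]; exists (r + s); last by rewrite rmorphD.
  exact: (prime_setD qP).
- move=> _ _ /image_ringP[r _ ->] [s qs ->]; exists (r * s); last by rewrite rmorphM.
  exact: (prime_setM qP).
- by move=> _ [s _ ->]; exact: image_mem.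
- by exists 1; [exact: (prime_set1 qP)|rewrite rmorph1].
- move=> _ _ [r qr ->] [s qs ->]; exists (r * s); last by rewrite rmorphM.
  by move=> /(prime_setP qP)[].
- move=> _ [s qs ->] [r qr] /eqP; rewrite -subr_eq0 -rmorphB => /eqP/thq qsr; apply: qs.
  by rewrite -(subrK r s); exact: (prime_setD qP).
have thO s : th s \in O by apply/SO/image_mem.
have qO s : q s -> nonunit O (th s) by move=> qs; apply: Oq; exists s.
have tO s : ~ q s -> (th s)^-1 \in O by move=> qs; apply: Ot; exists s.
have DK d : d \in D -> th d \in K by move=> dD; apply/frac_base/image_mem.
pose Rf y := (y \in O) && (y \in K).
have Rc : subring_closed Rf.
  split=> [|y z|y z]; rewrite /in_mem /= /Rf; first by rewrite !rpred1.
    by move=> /andP[yO yK] /andP[zO zK]; rewrite !rpredB.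
  by move=> /andP[yO yK] /andP[zO zK]; rewrite !rpredM.
pose R := Subring Rc.
have RE z : z \in R <-> z \in O /\ z \in K by split=> /andP.
pose X := th x; pose F := frac (adjoin K X).
have RX_O z : z \in adjoin R X -> z \in O.
  by apply: adjoin_min => [y /RE[]//|]; exact: thO.
have KF z : z \in K -> z \in F by move=> zK; apply/frac_base/adjoin_base.
have XF : X \in F by apply/frac_base/adjoin_gen.
have RF : {subset adjoin R X <= F}.
  by apply: adjoin_min => // z /RE[_ /KF].
have intR s : integral (adjoin R X) (th s).
  apply: (@integral_sub _ (image_ring th (adjoin D x))); last exact: integral_image.
  move=> _ /image_ringP[_ /adjoinP[p /polyOverP pD ->] ->]; rewrite -horner_map /=.
  apply/adjoinP; exists (map_poly th p) => //; apply/polyOverP => i; rewrite coef_map /=.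
  by apply/RE; split=> //; exact: DK.
pose f' := map_poly th f.
have f'K : f' \is a polyOver K.
  by apply/polyOverP => i; rewrite coef_map; apply/DK/(polyOverP fD).
have f'O : f' \is a polyOver O by apply/polyOverP => i; rewrite coef_map; exact: thO.
have f'm : ~ forall i, nonunit O f'`_i.
  have /existsNP[i fi] := fq; move=> /(_ i); rewrite coef_map => -[/thq//|].
  by rewrite tO.
have f'X : f'.[X] != 0.
  apply/eqP => /(xK f'K) f0; apply: f'm => i; rewrite f0 coef0; exact: nonunit0.
(* pi generates over O the ideal of the a_i, whence t f(x) = pi s with s
   integral over R[x] *)
pose A := \poly_(i < n) th (a i).
have tfA : th t * f'.[X] = \sum_(i < n) A`_i * th (b i).
  rewrite horner_map -rmorphM tf rmorph_sum; apply: eq_bigr => i _.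
  by rewrite coef_poly ltn_ord rmorphM.
have A0 : A != 0.
  apply/eqP => A0; move/eqP: tfA; rewrite big1 => [|i _]; last by rewrite A0 coef0 mul0r.
  by rewrite mulf_eq0 (negbTE f'X) orbF (negbTE (tht _ tq)).
have [i0 [pi0 iP]] := dominant_coef OV A0; set pi := A`_i0 in pi0 iP.
have AK i : A`_i \in K.
  by rewrite coef_poly; case: ifP => _; rewrite ?rpred0 // DK //; have [] := aP i.
have pim : nonunit O pi.
  rewrite /pi coef_poly; case: ifP => _; last exact: nonunit0.
  by apply: qO; have [] := aP i0.
pose s := \sum_(i < n) A`_i / pi * th (b i).
have tfs : th t * f'.[X] = pi * s.
  rewrite tfA big_distrr; apply: eq_bigr => i _ /=.
  by rewrite mulrA [pi * _]mulrC divfK.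
have sint : integral (adjoin R X) s.
  apply/integral_closureP; apply: rpred_sum => i _; apply: rpredM.
    apply/integral_closureP/integral_mem/adjoin_base/RE; split=> //.
    by apply: rpredM; [exact: AK|exact/KV/AK].
  exact/integral_closureP.
(* h and g are the minimal polynomials of t and of s = w t over K(x) *)
have FV z : z \in F -> z^-1 \in F by exact: fracV.
have [h hP] : exists h, min_poly_over F (th t) h.
  apply: min_poly_over_exists => //; have [p [pm pR /rootP pt]] := intR t.
  exists p; split=> //; first exact: monic_neq0.
  by apply/polyOverP => i; apply/RF/(polyOverP pR).
have hcoef i : h`_i \in adjoin R X.
  apply: (gauss_integrally_closed KV xK OV RE); last exact: (min_poly_over_integral RF hP).
  by case: hP => _ /polyOverP.
have [hm hF ht hmin] := hP.
pose w := f'.[X] / pi.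
have pw : f'.[X] = pi * w by rewrite /w mulrC divfK.
have w0 : w != 0 by rewrite mulf_neq0 ?invr_eq0.
have wF : w \in F.
  apply: rpredM; first by apply: frac_base; apply/adjoinP; exists f'.
  exact/KF/KV/AK.
have wt : w * th t = s by rewrite /w mulrAC [_ * th t]mulrC tfs mulrAC divff // mul1r.
pose m := (size h).-1.
have szh : size h = m.+1 by rewrite prednK // size_poly_gt0 monic_neq0.
have hm1 : h`_m = 1 by exact/eqP/hm.
pose g := \poly_(i < m.+1) (w ^+ (m - i) * h`_i).
have gi i : (i <= m)%N -> g`_i = w ^+ (m - i) * h`_i by rewrite coef_poly ltnS => ->.
have szg : size g = m.+1.
  by rewrite size_poly_eq // hm1 subnn mulr1 expr0 oner_eq0.
have gP : min_poly_over F s g.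
  split.
  - by rewrite monicE lead_coefE szg /= gi // subnn mul1r hm1.
  - by apply: polyOver_poly => i _; rewrite rpredM ?rpredX // (polyOverP hF).
  - suff -> : g.[s] = w ^+ m * h.[th t] by rewrite ht mulr0.
    rewrite horner_poly -wt horner_coef szh big_distrr; apply: eq_bigr => i _ /=.
    rewrite [(w * _) ^+ i]exprMn -mulrA.
    have -> : w ^+ m = w ^+ (m - i) * w ^+ i by rewrite -exprD subnK // -ltnS.
    by rewrite -!mulrA; congr (_ * _); rewrite mulrCA.
  - move=> k k0 kF ks; rewrite szg -szh.
    pose k' := \poly_(i < size k) (w ^+ i * k`_i).
    have szk : size k' = size k.
      rewrite size_poly_eq // mulf_neq0 ?expf_neq0 //.
      by rewrite -lead_coefE lead_coef_eq0.
    rewrite -szk; apply: hmin.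
    + by rewrite -size_poly_eq0 szk size_poly_eq0.
    + by apply: polyOver_poly => i _; rewrite rpredM ?rpredX // (polyOverP kF).
    + rewrite -ks -wt horner_poly horner_coef; apply: eq_bigr => i _.
      by rewrite [(w * _) ^+ i]exprMn mulrA [k`_i * _]mulrC.
have gcoef i : g`_i \in adjoin R X.
  apply: (gauss_integrally_closed KV xK OV RE); last exact: (min_poly_over_integral RF gP).
  by case: gP => _ /polyOverP.
(* the lower coefficients e of h and d of g satisfy f^(m-i) e = pi^(m-i) d, and
   f has a coefficient that is a unit of O: by Gauss's lemma e vanishes modulo
   the maximal ideal *)
have lowm i : (i < m)%N -> nonunit O h`_i.
  move=> im; have /adjoinP[e eR eE] := hcoef i; have /adjoinP[d dR dE] := gcoef i.
  have overK (p : {poly L}) : p \is a polyOver R -> p \is a polyOver K.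
    by move=> /polyOverP pR; apply/polyOverP => j; have /RE[] := pR j.
  have overO (p : {poly L}) : p \is a polyOver R -> p \is a polyOver O.
    by move=> /polyOverP pR; apply/polyOverP => j; have /RE[] := pR j.
  have fe : f' ^+ (m - i) * e = pi ^+ (m - i) *: d.
    apply: (transcendental_inj xK).
    - by rewrite rpredM ?rpredX // overK.
    - by apply: polyOverZ; [apply: rpredX; exact: AK|exact: overK].
    - rewrite hornerM hornerZ -dE -eE (gi _ (ltnW im)) mulrA; congr (_ * _).
      rewrite horner_exp pw.
      exact: exprMn.
  have := nonunit_polyM OV (rpredX (m - i) f'O) (overO _ eR); rewrite fe => em.
  have {em}[|em|em] := em.
  - move=> k; rewrite coefZ mulrC; apply: nonunitM => //; first exact: (polyOverP (overO _ dR)).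
    rewrite -[(m - i)%N]prednK ?subn_gt0 // exprSr; apply: nonunitM => //.
    by rewrite rpredX //; exact: nonunit_sub.
  - by case: f'm; exact: (nonunit_polyX OV f'O em).
  - rewrite eE horner_coef; apply: nonunit_sum => // k _; rewrite mulrC.
    by apply: nonunitM => //; apply: rpredX; exact: thO.
have tm : nonunit O (th t ^+ m).
  have := ht; rewrite horner_coef szh big_ord_recr /= hm1 mul1r.
  move=> /eqP; rewrite addrC addr_eq0 => /eqP ->; rewrite -mulN1r.
  apply: nonunitM; rewrite ?rpredN ?rpred1 //; apply: nonunit_sum => // i _.
  by rewrite mulrC; apply: nonunitM; rewrite ?rpredX //; exact: lowm.
case: tm => [/eqP|].
  by rewrite expf_eq0 (negbTE (tht _ tq)) andbF.
by rewrite -exprVn rpredX // tO.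
Qed.

End NotResiduallyAlgebraic.

(** * Primes and residue fields *)

Section SpecOf.
Variables (S : comPzRingType) (q : S -> Prop).
Hypothesis qP : prime_set q.

Lemma spec_of_closed : submod_closed (fun a : S^o => `[< q a >]).
Proof.
split=> [|r a b /asboolP qa /asboolP qb]; apply/asboolP.
  exact: (prime_set0 qP).
by apply: (prime_setD qP) => //; exact: (prime_setM qP).
Qed.

Lemma spec_of_proper : (1 : S^o) \notin Submod spec_of_closed.
Proof. by apply/negP => /asboolP; exact: (prime_set1 qP). Qed.

Lemma spec_of_mul (a b : S) : (a * b : S^o) \in Submod spec_of_closed ->
  (a : S^o) \in Submod spec_of_closed \/ (b : S^o) \in Submod spec_of_closed.
Proof.
by move=> /asboolP/(prime_setP qP)[h|h]; [left|right]; apply/asboolP.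
Qed.

Definition spec_of : Spec S := MkSpec spec_of_proper spec_of_mul.

Lemma spec_ofP a : (a : S^o) \in spec_of <-> q a.
Proof. by split=> [/asboolP//|qa]; apply/asboolP. Qed.

End SpecOf.

Section ResidueField.
Variables (A : comPzRingType) (p : Spec A).
Local Notation k := (quotring (max_ideal p)).

Lemma residue_oner_neq0 : (1 : k) != 0.
Proof. exact/eqP/residue_nontrivial. Qed.

HB.instance Definition _ := GRing.PzSemiRing_isNonZero.Build k residue_oner_neq0.

Definition residue_inv (x : k) : k := xget 0 [set y | x != 0 /\ y * x = 1].

Lemma residue_mulVf (x : k) : x != 0 -> residue_inv x * x = 1.
Proof.
move=> x0; rewrite /residue_inv; case: xgetP => [y _ []//|/= h].
have [y yx] := residue_inverse (elimN eqP x0).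
by case: (h y).
Qed.

Lemma residue_invr0 : residue_inv 0 = 0.
Proof. by rewrite /residue_inv; case: xgetP => // y _ []; rewrite eqxx. Qed.

HB.instance Definition _ := GRing.ComNzRing_isField.Build k residue_mulVf residue_invr0.

Lemma to_residue_eq0 (a : A) : to_residue p a = 0 <-> (a : A^o) \in p.
Proof.
rewrite -(rmorph0 (quotring_pi (max_ideal p))).
by split=> [/quotring_eqP|h]; [|apply/quotring_eqP]; rewrite subr0;
  [move=> /max_idealP|apply/max_idealP].
Qed.
End ResidueField.

(** The residue field at n serves as the fraction field of S/n. *)
Lemma prime_set_residue (S : comNzRingType) (n : S -> Prop) : prime_set n ->
  exists (L : fieldType) (th : {rmorphism S -> L}), forall a, th a = 0 <-> n a.
Proof.
move=> nP; pose p := spec_of nP; exists (quotring (max_ideal p)).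
exists (to_residue p) => a; rewrite to_residue_eq0; exact: spec_ofP.
Qed.

(** * Zariski's main theorem *)

Section ZMT.

(** Either some element of the conductor is outside q, or the whole conductor is in
    q; in the second case x is transcendental modulo a prime minimal over the
    conductor, one coefficient at a time by [conductor_lead]. *)
Lemma zmt_integrally_closed (S : comNzRingType) (D : subring S) (q : S -> Prop) x :
    (forall z, integral D z -> z \in D) -> prime_set q ->
    (exists u, forall s, span_over (adjoin D x) u s) -> residually_algebraic D q x ->
  exists g, [/\ ~ q g, g \in D & forall s, exists k, g ^+ k * s \in D].
Proof.
move=> Dic qP Sfg xq.
case: (pselect (exists g, conductor D x g /\ ~ q g)) => [[g [gJ gq]]|Jq].
  exact: (zmt_conductor Dic Sfg qP gJ gq xq).
exfalso.
have [n [nP Jn Tn nJ]] := @prime_set_over S (conductor D x) (fun s => ~ q s)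
  (fun s => eq_ind_r (fun z => z \in adjoin D x) (rpred0 _) (mul0r s))
  (@conductorD _ D x) (fun a b bJ => conductorM a bJ) (prime_set1 qP)
  (fun a b aq bq ab => match prime_setP qP ab with
     or_introl h => aq h | or_intror h => bq h end)
  (fun a aq aJ => Jq (ex_intro _ a (conj aJ aq))).
have nq a : n a -> q a by move=> na; apply: contrapT => /Tn.
have [L [th thE]] := prime_set_residue nP.
suff trans : forall d (h : {poly S}), (size h <= d)%N -> h \is a polyOver D ->
    n h.[x] -> forall i, n h`_i.
  apply: (@transcendental_not_residually_algebraic S L th D x q qP) xq.
  - by move=> a /thE/nq.
  - by move=> h hD /thE hx i; apply/thE/(trans (size h)).
  - exact: adjoin_integral.
elim=> [|d ih] h szh hD hx i.
  by rewrite nth_default ?(leq_trans szh) //; exact: (prime_set0 nP).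
have hd : n h`_d.
  have [u [N [un uJ]]] := nJ _ hx.
  have [M MJ] : exists M, conductor D x ((u * h`_d) ^+ M).
    apply: (@conductor_lead _ _ Dic _ Sfg u d h N.+1 hD szh).
    have -> : (u * h.[x]) ^+ N.+1 = u ^+ N * h.[x] * (u * h.[x] ^+ N).
      by rewrite exprMn exprSr [h.[x] ^+ N.+1]exprS -!mulrA; congr (_ * _); rewrite mulrCA.
    exact: conductorM.
  by have /(prime_setX nP)/(prime_setP nP)[] := Jn _ MJ.
have hD' := polyOverP hD.
pose h' := h - h`_d *: 'X^d.
have h'i j : h`_j = h'`_j + h`_d * (j == d)%:R.
  by rewrite coefB coefZ coefXn subrK.
rewrite h'i; apply: (prime_setD nP); last exact: (prime_setMr nP).
apply: ih.
- apply/leq_sizeP => j; rewrite leq_eqVlt coefB coefZ coefXn => /predU1P[<-|dj].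
    by rewrite eqxx mulr1 subrr.
  by rewrite nth_default ?(leq_trans szh) // gtn_eqF // mulr0 subrr.
- by rewrite rpredB // polyOverZ // polyOverXn.
- rewrite hornerD hornerN hornerZ; apply: (prime_setB nP) => //.
  exact: (prime_setMr nP).
Qed.

Lemma zmt_simple (S : comNzRingType) (D : subring S) (q : S -> Prop) x :
    prime_set q -> (exists u, forall s, span_over (adjoin D x) u s) ->
    residually_algebraic D q x ->
  exists g, [/\ ~ q g, integral D g & forall s, exists k, integral D (g ^+ k * s)].
Proof.
move=> qP [u uP] [f [t [/polyOverP fD fq tq [n [a [b [aP tf]]]]]]].
pose D' := integral_closure D.
have DD : {subset D <= D'} by move=> z zD; apply/integral_closureP/integral_mem.
have [|||g [gq gD gP]] := @zmt_integrally_closed S D' q x _ qP.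
- by move=> z /integral_closedP zD; apply/integral_closureP.
- exists u => s; have [c [cD ->]] := uP s; exists c; split=> // i.
  apply: (adjoin_min (D := D) (x := x)) (cD i) => [z /DD|]; [exact: adjoin_base|exact: adjoin_gen].
- exists f, t; split=> //; first by apply/polyOverP => i; exact: DD.
  by exists n, a, b; split=> // i; have [/DD ? ?] := aP i.
exists g; split=> //; first exact/integral_closureP.
by move=> s; have [k kP] := gP s; exists k; exact/integral_closureP.
Qed.

Section Descent.
Variables (S : comNzRingType) (D : subring S) (ys : seq S) (x g : S) (u : seq S).
Let E := adjoins D ys.
Hypothesis uP : forall s, span_over (adjoin E x) u s.
Hypothesis gE : integral E g.
Hypothesis gS : forall s, exists k, integral E (g ^+ k * s).

(** Only finitely many elements have to be multiplied into the integral closure of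
    E: the generator x and the module generators of S over E[x]. *)
Lemma finite_birational : exists C : subring S, [/\ {subset E <= C}, module_finite E C, g \in C &
  forall s, exists K, forall K', (K <= K')%N -> g ^+ K' * s \in C].
Proof.
have [k kP] : exists k, forall i, (i < size (x :: u))%N -> integral E (g ^+ k * (x :: u)`_i).
  apply: (uniform_bound (P := fun i k => integral E (g ^+ k * (x :: u)`_i))) => i.
  have [k kE] := gS (x :: u)`_i; exists k => k' kk'.
  rewrite -(subnK kk') exprD -mulrA; apply: integralM => //; exact: integralX.
pose ws := g :: [seq g ^+ k * v | v <- x :: u].
pose C := adjoins E ws.
have gC : g \in C by apply: adjoins_gen; rewrite inE eqxx.
have vC v : v \in x :: u -> g ^+ k * v \in C.
  by move=> vu; apply: adjoins_gen; rewrite inE map_f ?orbT.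
have EC z : z \in E -> z \in C by exact: adjoins_base.
exists C; split=> //.
  apply: module_finite_adjoins => w; rewrite inE => /predU1P[->//|/mapP[v vu ->]].
  by have := kP (index v (x :: u)); rewrite index_mem nth_index //; apply.
move=> s; suff [K sK] : exists K, g ^+ K * s \in C.
  by exists K => K' KK'; rewrite -(subnK KK') exprD -mulrA rpredM // rpredX.
have powC i m : (i <= m)%N -> g ^+ (k * m) * x ^+ i \in C.
  move=> im; rewrite -(subnK im) mulnDr exprD -mulrA; apply: rpredM; first exact: rpredX.
  by rewrite exprM -exprMn; apply/rpredX/vC/mem_head.
have adjC c : c \in adjoin E x -> exists K, forall K', (K <= K')%N -> g ^+ K' * c \in C.
  move=> /adjoinP[p /polyOverP pE ->]; exists (k * size p)%N => K' KK'.
  rewrite -(subnK KK') exprD -mulrA; apply: rpredM; first exact: rpredX.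
  rewrite horner_coef big_distrr; apply: rpred_sum => i _ /=; rewrite mulrCA.
  by apply: rpredM; [exact: EC|apply/powC/ltnW].
have [c [cE ->]] := uP s.
have [K KP] := @uniform_bound (fun i K => g ^+ K * c i \in C) (fun i => adjC _ (cE i)) (size u).
exists (K + k)%N; rewrite exprD big_distrr; apply: rpred_sum => i _ /=.
have E2 (v w y z : S) : v * w * (y * z) = v * y * (w * z) by rewrite mulrACA.
by rewrite E2; apply: rpredM; [exact: KP|apply: vC; rewrite inE mem_nth ?orbT].
Qed.

(** Powers of g, invertible at q, bring the elements t and b_i of a relation
    t f(s) = sum a_i b_i into C. *)
Lemma descend_to_subalgebra (C : subring S) (q : S -> Prop) : {subset E <= C} ->
    module_finite E C -> g \in C ->
    (forall s, exists K, forall K', (K <= K')%N -> g ^+ K' * s \in C) ->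
    prime_set q -> ~ q g -> (forall s, residually_algebraic D q s) ->
  exists (D' : subring (subring_sort C)) (ys' : seq (subring_sort C)),
  [/\ size ys' = size ys, forall z, z \in D' -> val z \in D,
    exists v, forall s, span_over (adjoins D' ys') v s &
    forall s, residually_algebraic D' (q \o val) s].
Proof.
move=> EC [v [vC vP]] gC gs qP gq qD.
pose T := subring_sort C.
have lift z : z \in C -> exists z' : T, val z' = z by move=> zC; exists (SubringSort zC).
have Dc : subring_closed (fun z : T => val z \in D).
  split=> [|y z yD zD|y z yD zD].
  - by change (1 \in D); exact: rpred1.
  - by change (val y - val z \in D); exact: rpredB.
  - by change (val y * val z \in D); exact: rpredM.
pose D' := Subring Dc.
have seqlift zs : {subset zs <= C} -> exists zs' : seq T, map val zs' = zs.
  elim: zs => [_|z zs ih zC]; first by exists [::].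
  have [z' <-] := lift z (zC z (mem_head _ _)).
  have [|zs' <-] := ih; first by move=> y yz; apply: zC; rewrite inE yz orbT.
  by exists (z' :: zs').
have [ys' ysE] : exists ys' : seq T, map val ys' = ys.
  by apply: seqlift => y yy; apply/EC/adjoins_gen.
have [v' vE] := seqlift v vC.
have DC d : d \in D -> d \in C by move=> dD; apply/EC/adjoins_base.
have EE : {subset E <= image_ring (val : {rmorphism T -> S}) (adjoins D' ys')}.
  apply: adjoins_min => [d dD|y yy].
    apply/image_ringP; exists (SubringSort (DC _ dD) : T) => //.
    exact: adjoins_base.
  move: yy; rewrite -ysE => /mapP[y' yy' ->]; apply/image_ringP; exists y' => //.
  exact: adjoins_gen.
exists D', ys'; split=> //.
- by rewrite -(size_map val) ysE.
- exists v' => s; have [c [cE sE]] := vP _ (subring_valP s).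
  have /choice[c' cP] : forall i, exists c', c' \in adjoins D' ys' /\ c i = val c'.
    by move=> i; have /EE/image_ringP[c'] := cE i; exists c'.
  exists c'; split=> [i|]; first by have [] := cP i.
  apply: val_inj; rewrite [LHS]sE rmorph_sum -vE size_map; apply: eq_bigr => i _ /=.
  by have [_ ->] := cP i; rewrite (nth_map 0).
- move=> s; have [f [t [fD fq tq [n [a [b [aP tf]]]]]]] := qD (val s).
  have [f' [f'D f'E]] : exists f' : {poly T}, f' \is a polyOver D' /\ map_poly val f' = f.
    have fC : f \is a polyOver C by apply/polyOverP => i; apply/DC/(polyOverP fD).
    have [f' f'E] := polyOver_lift fC; exists f'; split=> //.
    apply/polyOverP => i; rewrite /in_mem /=.
    by have := polyOverP fD i; rewrite -f'E coef_map.
  have [K KP] : exists K, forall i, (i < n.+1)%N -> g ^+ K * (if i is j.+1 then b j else t) \in C.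
    by apply: (uniform_bound (P := fun i K => g ^+ K * (if i is j.+1 then b j else t) \in C)) => i.
  have /choice[b' b'P] : forall i, exists b' : T, (i < n)%N -> val b' = g ^+ K * b i.
    move=> i; case: (ltnP i n) => [ni|_]; last by exists 0.
    by have [b' b'E] := lift _ (KP i.+1 ni); exists b'.
  have /choice[a' a'P] : forall i, exists a' : T, val a' = a i.
    by move=> i; apply/lift/DC; have [] := aP i.
  have [t' t'E] := lift _ (KP 0%N isT).
  exists f', t'; split=> //.
  + by move=> h; apply: fq => i; rewrite -f'E coef_map; exact: h.
  + by rewrite /= t'E => /(prime_setP qP)[/(prime_setX qP)|].
  + exists n, a', b'; split=> [i|].
      by have := aP i; rewrite -a'P.
    apply: val_inj; rewrite rmorphM rmorph_sum -horner_map /= t'E f'E -mulrA tf.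
    rewrite big_distrr; apply: eq_bigr => i _ /=.
    by rewrite a'P b'P // mulrCA.
Qed.

End Descent.

(** Remove one generator x: over E = D[ys] the case of one generator gives g, hence a
    finite E-algebra C that agrees with S up to powers of g; induction applied to C
    gives h, and h^(k+1) g works for S once h^k g is integral over D. *)
Theorem zariski_main n : forall (S : comNzRingType) (D : subring S) (q : S -> Prop)
    (xs : seq S), size xs = n ->
    prime_set q -> (exists u, forall s, span_over (adjoins D xs) u s) ->
    (forall s, residually_algebraic D q s) ->
  exists g, [/\ ~ q g, integral D g & forall s, exists k, integral D (g ^+ k * s)].
Proof.
elim: n => [|n ih] S D q [|x ys] //= szx qP Sfg qD.
  exists 1; split; [exact: (prime_set1 qP)|exact/integral_mem/rpred1|].
  move=> s; exists 0%N; rewrite mul1r; have [u uP] := Sfg.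
  exact: (@integral_span_over _ _ u).
have [u uP] := Sfg; set E := adjoins D ys in uP.
have DE z : z \in D -> z \in E by exact: adjoins_base.
have [|g [gq gE gS]] := @zmt_simple S E q x qP Sfg.
  have [f [t [/polyOverP fD fq tq [m [a [b [aP tf]]]]]]] := qD x.
  exists f, t; split=> //; first by apply/polyOverP => i; exact: DE.
  by exists m, a, b; split=> // i; have [/DE ? ?] := aP i.
have [C [EC ECfg gC gCs]] := finite_birational uP gE gS.
have [D' [ys' [szys D'D Tfg qD']]] :=
  descend_to_subalgebra EC ECfg gC gCs qP gq qD.
have q'P : prime_set (q \o (val : subring_sort C -> S)).
  split=> /=.
  - exact: (prime_set0 qP).
  - by move=> a b; exact: (prime_setD qP).
  - by move=> a b; exact: (prime_setM qP).
  - exact: (prime_set1 qP).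
  - by move=> a b; exact: (prime_setP qP).
have [|h [hq hD hT]] := ih _ D' _ ys' _ q'P Tfg qD'.
  by rewrite szys; case: szx.
have push z : integral D' z -> integral D (val z).
  move=> /(integral_image (val : {rmorphism subring_sort C -> S})).
  by apply: integral_sub => _ /image_ringP[d dD ->]; exact: D'D.
have hDS := push _ hD.
have hC c : c \in C -> exists k, integral D (val h ^+ k * c).
  move=> cC; have [l /push] := hT (SubringSort cC : subring_sort C).
  by rewrite rmorphM rmorphXn /=; exists l.
have {}kP := hC g gC; have {}hq : ~ q (val h) := hq.
move: (val h) hDS hC kP hq => h' hDS hC [k kP] hq.
exists (h' ^+ k.+1 * g); split.
- by move=> /(prime_setP qP)[/(prime_setX qP)|].
- by rewrite exprS -mulrA; exact: integralM.
- move=> s; have [K /(_ K (leqnn K)) sK] := gCs s; have [l lP] := hC _ sK.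
  exists (l + K)%N.
  have -> : (h' ^+ k.+1 * g) ^+ (l + K) * s =
      (h' ^+ k * g) ^+ l * (h' ^+ k.+1) ^+ K * (h' ^+ l * (g ^+ K * s)).
    have e1 : (h' ^+ k.+1 * g) ^+ l = h' ^+ l * (h' ^+ k * g) ^+ l.
      by rewrite exprS -mulrA exprMn.
    have e2 (a b c d e : S) : a * b * (c * d) * e = b * c * (a * (d * e)) by ring.
    by rewrite exprD e1 [(h' ^+ k.+1 * g) ^+ K]exprMn e2.
  by apply: integralM => //; apply: integralM; apply: integralX => //; exact: integralX.
Qed.

End ZMT.

(** * Dimension and linear spans *)

Section VectorSpaces.
Variable k : fieldType.

(** Take K of maximal rank among the matrices whose rows satisfy P. *)
Lemma subspace_mx m (P : 'rV[k]_m -> Prop) : P 0 ->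
    (forall a u v, P u -> P v -> P (a *: u + v)) ->
  exists K : 'M[k]_m, forall v, P v <-> (v <= K)%MS.
Proof.
move=> P0 PL.
pose Q r := `[< exists K : 'M[k]_m, \rank K = r /\ forall v, (v <= K)%MS -> P v >].
have Q0 : Q 0%N.
  apply/asboolP; exists 0; split=> [|v]; first exact: mxrank0.
  by rewrite submx0 => /eqP->.
have Qm r : Q r -> (r <= m)%N by move=> /asboolP[K [<- _]]; exact: rank_leq_row.
case: (ex_maxnP (ex_intro _ 0%N Q0) Qm) => r /asboolP[K [rK KP]] rmax.
exists K => v; split=> [Pv|]; last exact: KP.
have : Q (\rank (K + v)%MS).
  apply/asboolP; exists (K + v)%MS; split=> // w /sub_addsmxP[[a b] ->] /=.
  rewrite addrC [b]mx11_scalar mul_scalar_mx; apply: PL => //.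
  by apply: KP; exact: submxMl.
move=> /rmax; rewrite -rK => le.
have := mxrank_leqif_sup (addsmxSl K v) => -[lr]; rewrite eqn_leq lr le /= => /esym.
exact: submx_trans (addsmxSr _ _).
Qed.

Section Basis.
Variable V : lmodType k.

Lemma basis_coord_matrix n m (e : 'I_n -> V) (f : 'I_m -> V) :
  is_basis e -> is_basis f -> (n <= m)%N.
Proof.
move=> [eS eF] [fS _].
have /choice[c cP] : forall i, exists c : 'I_m -> k, e i = \sum_j c j *: f j by [].
have /choice[d dP] : forall j, exists d : 'I_n -> k, f j = \sum_i d i *: e i by [].
apply: (@mulmx1_min _ _ _ (\matrix_(i, j) c i j) (\matrix_(j, i) d j i)).
apply/matrixP => i l; rewrite !mxE.
under eq_bigr do rewrite !mxE.
apply/eqP; rewrite -subr_eq0; apply/eqP; move: l.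
apply: (eF (fun l => \sum_j c i j * d j l - (i == l)%:R)).
under eq_bigr do rewrite scalerBl.
rewrite sumrB [X in _ - X](bigD1 i) //= eqxx scale1r [X in _ - (_ + X)]big1; last first.
  by move=> j ji; rewrite eq_sym (negbTE ji) scale0r.
rewrite addr0 [X in _ - X]cP; apply/eqP; rewrite subr_eq0; apply/eqP.
under eq_bigr do rewrite scaler_suml.
rewrite exchange_big; apply: eq_bigr => j _ /=.
by rewrite [in RHS]dP scaler_sumr; apply: eq_bigr => l _; rewrite scalerA.
Qed.

Lemma vdim_basis n (e : 'I_n -> V) : is_basis e -> vdim V = (n%:R)%:E.
Proof.
move=> eB; rewrite /vdim; case: xgetP => [x _ [m [f fB] <-]|/(_ (n%:R)%:E) []].
  congr ((_%:R)%:E); apply/eqP; rewrite eqn_leq.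
  by rewrite (basis_coord_matrix eB fB) (basis_coord_matrix fB eB).
by exists n => //; exists e.
Qed.

Lemma vdim_fin : (vdim V < +oo)%E <-> exists n (e : 'I_n -> V), is_basis e.
Proof.
split=> [|[n [e /vdim_basis ->]]]; last exact: ltry.
rewrite /vdim; case: xgetP => [x _ [n [e eB] _] _|_]; first by exists n, e.
by rewrite ltxx.
Qed.

Lemma vdim_ge0 : (0 <= vdim V)%E.
Proof.
rewrite /vdim; case: xgetP => [x _ [n _ <-]|_]; last exact: leey.
by rewrite lee_fin ler0n.
Qed.

(** The image of a basis of a complement of K. *)
Lemma quotient_basis m (f : {linear 'rV[k]_m -> V}) (K : 'M[k]_m) :
    (forall w, exists v, w = f v) -> (forall v, f v = 0 <-> (v <= K)%MS) ->
  exists e : 'I_(m - \rank K) -> V, is_basis e.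
Proof.
move=> fS fK; rewrite -(mxrank_compl K).
pose B := row_base (K^C)%MS.
exists (fun i => f (row i B)).
have fsum (c : 'I_(\rank (K^C)%MS) -> k) :
    \sum_i c i *: f (row i B) = f ((\row_i c i) *m B).
  rewrite mulmx_sum_row linear_sum; apply: eq_bigr => i _.
  by rewrite linearZ !mxE.
split=> [w|c].
  have [v ->] := fS w.
  have : (v <= K + K^C)%MS by rewrite submx_full // addsmx_compl_full.
  move=> /sub_addsmxP[[a b] /= ->]; rewrite linearD.
  have /submxP[d dE] : (b *m K^C <= B)%MS by rewrite eq_row_base submxMl.
  exists (fun i => d 0 i); rewrite fsum.
  rewrite (iffRL (fK _) (submxMl _ _)) add0r dE; congr (f (_ *m _)).
  by apply/rowP => i; rewrite !mxE.
rewrite fsum => /fK cK i.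
have : ((\row_i c i) *m B <= K :&: K^C)%MS.
  by rewrite sub_capmx cK -(eq_row_base (K^C)%MS) submxMl.
rewrite capmx_compl submx0 => /eqP c0.
have : \row_i c i = 0.
  by apply: (row_free_inj (row_base_free (K^C)%MS)); rewrite /= c0 mul0mx.
by move=> /rowP/(_ i); rewrite !mxE.
Qed.

Definition lin_comb (u : seq V) (c : 'rV[k]_(size u)) : V := \sum_i c 0 i *: u`_i.

Lemma lin_comb_linear u : linear (@lin_comb u).
Proof.
move=> a c d; rewrite /lin_comb scaler_sumr -big_split.
by apply: eq_bigr => i _ /=; rewrite !mxE scalerDl scalerA.
Qed.

HB.instance Definition _ u :=
  GRing.isLinear.Build k 'rV[k]_(size u) V *:%R (@lin_comb u) (@lin_comb_linear u).

Definition lin_span (u : seq V) (w : V) :=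
  exists c : 'rV[k]_(size u), w = \sum_i c 0 i *: u`_i.

Lemma lin_span0 u : lin_span u 0.
Proof. by exists 0; rewrite big1 // => i _; rewrite mxE scale0r. Qed.

Lemma lin_spanL u a v w : lin_span u v -> lin_span u w -> lin_span u (a *: v + w).
Proof.
move=> [c ->] [d ->]; exists (a *: c + d); rewrite scaler_sumr -big_split.
by apply: eq_bigr => i _ /=; rewrite !mxE scalerDl scalerA.
Qed.

Lemma lin_spanD u v w : lin_span u v -> lin_span u w -> lin_span u (v + w).
Proof. by rewrite -{2}[v]scale1r; exact: lin_spanL. Qed.

Lemma lin_spanZ u a v : lin_span u v -> lin_span u (a *: v).
Proof. by move=> h; rewrite -[_ *: _]addr0; apply: lin_spanL => //; exact: lin_span0. Qed.

Lemma lin_spanB u v w : lin_span u v -> lin_span u w -> lin_span u (v - w).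
Proof. by move=> hv hw; rewrite -scaleN1r addrC; exact: lin_spanL. Qed.

Lemma lin_span_sum u (I : Type) (r : seq I) (P : pred I) (F : I -> V) :
  (forall i, P i -> lin_span u (F i)) -> lin_span u (\sum_(i <- r | P i) F i).
Proof. by move=> h; apply: big_ind => //; [exact: lin_span0|exact: lin_spanD]. Qed.

Lemma lin_span_mem u v : v \in u -> lin_span u v.
Proof.
move=> vu; have vi : (index v u < size u)%N by rewrite index_mem.
exists (delta_mx 0 (Ordinal vi)); rewrite (bigD1 (Ordinal vi)) //= mxE !eqxx.
rewrite scale1r nth_index // big1 ?addr0 // => i ni.
by rewrite mxE eqxx (negbTE ni) scale0r.
Qed.

Lemma lin_span_linear u v (T : V -> V) : (forall a x y, T (a *: x + y) = a *: T x + T y) ->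
  forall w, (forall z, z \in u -> lin_span v (T z)) -> lin_span u w -> lin_span v (T w).
Proof.
move=> TL w uv [c ->].
have T0 : T 0 = 0.
  by have := TL (-1) 0 0; rewrite scaler0 addr0 scaleN1r addNr.
apply: (big_ind (fun z => lin_span v (T z))) => [|x y hx hy|i _].
- by rewrite T0; exact: lin_span0.
- by rewrite -[x]scale1r TL; exact: lin_spanL.
- by rewrite -[_ *: _]addr0 TL T0 addr0; apply/lin_spanZ/uv/mem_nth.
Qed.

Lemma lin_span_basis u : (forall w, lin_span u w) -> exists n (e : 'I_n -> V), is_basis e.
Proof.
move=> uS.
pose f : {linear 'rV[k]_(size u) -> V} := @lin_comb u.
have [||K KP] := @subspace_mx _ (fun v => f v = 0); first exact: linear0.
  by move=> a v w fv fw; rewrite linearP fv fw scaler0 addr0.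
by eexists; apply: (@quotient_basis _ f K) => [w|v]; [exact: uS|exact: KP].
Qed.

(** In terms of coefficient vectors: if B is the matrix of T and C a cokernel of the
    relations K between the u_i, injectivity says that B C has kernel K, hence the
    same row space as C. *)
Lemma lin_span_inj_surj u (T : V -> V) : (forall a x y, T (a *: x + y) = a *: T x + T y) ->
    (forall v, v \in u -> lin_span u (T v)) -> (forall w, T w = 0 -> w = 0) ->
  forall w, lin_span u w -> exists2 w', lin_span u w' & T w' = w.
Proof.
move=> TL Tu Tinj _ [v ->].
pose f : {linear 'rV[k]_(size u) -> V} := @lin_comb u.
have [||K KP] := @subspace_mx _ (fun v => f v = 0); first exact: linear0.
  by move=> a x w fv fw; rewrite linearP fv fw scaler0 addr0.
have /choice[b bP] : forall i : 'I_(size u), exists b : 'rV[k]_(size u), T u`_i = f b.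
  by move=> i; have [b] := Tu _ (mem_nth 0 (ltn_ord i)); exists b.
pose B := \matrix_i b i.
have T0 : T 0 = 0.
  by have := TL (-1) 0 0; rewrite scaler0 addr0 scaleN1r addNr.
have TZ a x : T (a *: x) = a *: T x by rewrite -[_ *: _]addr0 TL T0 addr0.
have Tf x : T (f x) = f (x *m B).
  rewrite mulmx_sum_row linear_sum /=.
  rewrite (big_morph T (id1 := 0) (op1 := +%R)) //; last first.
    by move=> y z; rewrite -[y]scale1r TL !scale1r.
  by apply: eq_bigr => i _; rewrite TZ bP rowK -linearZ.
pose C := cokermx K.
have KC x : (x <= K)%MS = (x *m C == 0) by rewrite submxE.
have kerBC : (kermx (B *m C) <= K)%MS.
  apply/row_subP => i; apply/KP/Tinj; rewrite Tf; apply/KP; rewrite KC -mulmxA.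
  by apply/eqP/sub_kermxP; exact: row_sub.
have : (C <= B *m C)%MS.
  have [_ <-] := mxrank_leqif_sup (submxMl B C).
  rewrite eqn_leq mxrankM_maxr /= /C mxrank_coker.
  have := mxrankS kerBC; rewrite mxrank_ker leq_subLR => h.
  by rewrite leq_subLR addnC.
move=> CBC; have /submxP[w wE] := submx_trans (submxMl v C) CBC.
exists (f w); first by exists w.
rewrite Tf; apply/eqP; rewrite -subr_eq0 -linearB; apply/eqP/KP.
by rewrite KC mulmxBl -mulmxA -wE subrr.
Qed.
End Basis.
End VectorSpaces.

(** * Commutative rings acting on vector spaces *)

(** The vectors (w i 1, ..., w i r) lie in a space of dimension r n, so r n + 1 of
    them are dependent.  One relation serves all j at once. *)
Lemma linear_dependence (k : fieldType) (V : lmodType k) n (e : 'I_n -> V) r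
    (w : nat -> 'I_r -> V) : is_basis e ->
  exists f : {poly k}, f != 0 /\ forall j, \sum_(i < size f) f`_i *: w i j = 0.
Proof.
move=> [eS _].
have /choice[a aP] : forall i, exists a : 'M[k]_(r, n), forall j,
    w i j = \sum_l a j l *: e l.
  move=> i; have /choice[a aP] : forall j, exists a : 'I_n -> k, w i j = \sum_l a l *: e l by [].
  by exists (\matrix_(j, l) a j l) => j; rewrite aP; apply: eq_bigr => l _; rewrite mxE.
pose d := (r * n).+1; pose X : 'M[k]_(d, r * n) := \matrix_(i < d) mxvec (a i).
have : kermx X != 0.
  by rewrite -mxrank_eq0 mxrank_ker -lt0n subn_gt0 ltnS rank_leq_col.
move=> /rowV0Pn[c /sub_kermxP cX c0].
pose f := \poly_(i < d) c 0 (inord i).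
have fc (i : 'I_d) : f`_i = c 0 i by rewrite coef_poly ltn_ord inord_val.
exists f; split.
  apply: contraNneq c0 => f0; apply/eqP/rowP => i.
  by rewrite -fc f0 coef0 mxE.
move=> j.
have -> : \sum_(i < size f) f`_i *: w i j = \sum_(i < d) f`_i *: w i j.
  rewrite (big_ord_widen d (fun i => f`_i *: w i j)) ?size_poly //.
  rewrite big_mkcond; apply: eq_bigr => i _.
  by case: ltnP => // h; rewrite nth_default // scale0r.
have : \sum_(i < d) c 0 i *: a i = 0.
  apply: (can_inj mxvecK); rewrite linear_sum linear0 -[RHS]cX mulmx_sum_row.
  by apply: eq_bigr => i _; rewrite linearZ /= rowK.
move=> aE; under eq_bigr do rewrite fc aP scaler_sumr.
rewrite exchange_big big1 // => l _ /=.
under eq_bigr do rewrite scalerA.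
rewrite -scaler_suml; have /matrixP/(_ j l) := aE; rewrite summxE [RHS]mxE => h.
rewrite (_ : \sum_i _ = 0) ?scale0r // -[RHS]h.
by apply: eq_bigr => i _; rewrite mxE.
Qed.

Section Action.
Variables (R : comPzRingType) (k : fieldType) (W : lmodType k).
Variable act : R -> W -> W.
Implicit Types (f g : {poly k}) (x y r : R) (u : seq W).

(** A commutative ring acting by linear maps; used for the action of R on both kinds
    of fibres. *)
Record ring_action : Prop := RingAction {
  act_linear : forall r a (x y : W), act r (a *: x + y) = a *: act r x + act r y;
  act_add : forall r s (x : W), act (r + s) x = act r x + act s x;
  act_mul : forall r s (x : W), act (r * s) x = act r (act s x);
  act_one : forall x : W, act 1 x = x }.

Hypothesis actP : ring_action.

Lemma actD r (x y : W) : act r (x + y) = act r x + act r y.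
Proof. by rewrite -[x]scale1r (act_linear actP) !scale1r. Qed.

Lemma actr0 r : act r 0 = 0.
Proof. by apply: (addrI (act r 0)); rewrite -actD !addr0. Qed.

Lemma actZ r a (x : W) : act r (a *: x) = a *: act r x.
Proof. by rewrite -[a *: x]addr0 (act_linear actP) actr0 addr0. Qed.

Lemma act_sum r (I : Type) (s : seq I) (P : pred I) (F : I -> W) :
  act r (\sum_(i <- s | P i) F i) = \sum_(i <- s | P i) act r (F i).
Proof. by apply: big_morph; [exact: actD|exact: actr0]. Qed.

Lemma act0 (x : W) : act 0 x = 0.
Proof. by apply: (addrI (act 0 x)); rewrite -(act_add actP) !addr0. Qed.

Lemma actN r (x : W) : act (- r) x = - act r x.
Proof. by apply: (addrI (act r x)); rewrite -(act_add actP) !subrr act0. Qed.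

Lemma actC r s (x : W) : act r (act s x) = act s (act r x).
Proof. by rewrite -!(act_mul actP) mulrC. Qed.

Definition poly_act (f : {poly k}) (x : R) (w : W) := \sum_(i < size f) f`_i *: act (x ^+ i) w.

Lemma poly_act_wide n f x w : (size f <= n)%N ->
  poly_act f x w = \sum_(i < n) f`_i *: act (x ^+ i) w.
Proof.
move=> fn; rewrite /poly_act (big_ord_widen n (fun i => f`_i *: act (x ^+ i) w)) //.
rewrite big_mkcond; apply: eq_bigr => i _.
by case: ltnP => // h; rewrite nth_default // scale0r.
Qed.

Lemma poly_actD f g x w : poly_act (f + g) x w = poly_act f x w + poly_act g x w.
Proof.
pose n := maxn (size f) (size g).
rewrite (@poly_act_wide n (f + g)) ?size_polyD // (@poly_act_wide n f) ?leq_maxl //.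
rewrite (@poly_act_wide n g) ?leq_maxr //.
by rewrite -big_split; apply: eq_bigr => i _; rewrite coefD scalerDl.
Qed.

Lemma poly_actZ c f x w : poly_act (c%:P * f) x w = c *: poly_act f x w.
Proof.
rewrite !(@poly_act_wide (size f)) //; last first.
  by rewrite mul_polyC (leq_trans (size_scale_leq _ _)).
by rewrite scaler_sumr; apply: eq_bigr => i _; rewrite coefCM scalerA.
Qed.

Lemma poly_actMX f x w : poly_act (f * 'X) x w = poly_act f x (act x w).
Proof.
rewrite (@poly_act_wide (size f).+1); last first.
  by apply: leq_trans (size_polyMleq _ _) _; rewrite size_polyX addn2.
rewrite big_ord_recl coefMX /= scale0r add0r; apply: eq_bigr => i _.
by rewrite coefMX /= /bump /= add1n exprSr (act_mul actP).
Qed.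

Lemma act_poly_act f r x w : act r (poly_act f x w) = poly_act f x (act r w).
Proof. by rewrite act_sum; apply: eq_bigr => i _; rewrite actZ actC. Qed.

Lemma poly_actM f g x w : poly_act (f * g) x w = poly_act f x (poly_act g x w).
Proof.
elim/poly_ind: f w => [|f c ih] w; first by rewrite mul0r /poly_act size_poly0 !big_ord0.
rewrite mulrDl poly_actD -mulrA ['X * g]mulrC mulrA poly_actMX ih poly_actZ.
rewrite [RHS]poly_actD poly_actMX act_poly_act; congr (_ + _).
by rewrite (@poly_act_wide 1 c%:P) ?size_polyC ?leq_b1 // big_ord1 coefC (act_one actP).
Qed.

Lemma poly_act0 f x : poly_act f x 0 = 0.
Proof. by rewrite /poly_act big1 // => i _; rewrite actr0 scaler0. Qed.

Definition algebraic_on (x : R) := exists f, f != 0 /\ forall w, poly_act f x w = 0.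

Lemma algebraic_on_monic x : algebraic_on x -> exists m (c : nat -> k), forall w,
  act (x ^+ m) w = \sum_(j < m) c j *: act (x ^+ j) w.
Proof.
move=> [f [f0 fP]]; pose m := (size f).-1.
have szf : size f = m.+1 by rewrite prednK // size_poly_gt0.
have l0 : f`_m != 0 by rewrite -lead_coefE lead_coef_eq0.
exists m, (fun j => - (f`_m)^-1 * f`_j) => w.
have := fP w; rewrite /poly_act szf big_ord_recr /= => /eqP; rewrite addrC addr_eq0.
move=> /eqP/(congr1 (fun z => (f`_m)^-1 *: z)); rewrite scalerA mulVf // scale1r => ->.
rewrite scalerN -scaleNr scaler_sumr; apply: eq_bigr => j _.
by rewrite scalerA.
Qed.

(** Adjoin one algebraic operator at a time, replacing u by the y^j v with j up to
    the degree of an equation of y. *)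
Lemma finite_stable (ys : seq R) (es : seq W) : (forall y, y \in ys -> algebraic_on y) ->
  exists u, (forall w, w \in es -> lin_span u w) /\
    forall y v, y \in ys -> v \in u -> lin_span u (act y v).
Proof.
elim: ys => [_|y ys ih yP]; first by exists es; split=> // w; exact: lin_span_mem.
have [z zys|u [ue uy]] := ih; first by apply: yP; rewrite inE zys orbT.
have [m [c cP]] := algebraic_on_monic (yP _ (mem_head _ _)).
pose u' := [seq act (y ^+ j) v | v <- u, j <- iota 0 m.+1].
have u'P v j : v \in u -> (j < m.+1)%N -> lin_span u' (act (y ^+ j) v).
  by move=> vu jm; apply/lin_span_mem/allpairs_f; rewrite ?mem_iota.
exists u'; split=> [w /ue we|z _ zy /allpairsP[[v j] [vu jm ->]]].
  have {we} := we; apply: (@lin_span_linear _ _ u u' id) => // v vu.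
  by have := u'P v 0%N vu isT; rewrite expr0 (act_one actP).
move: jm; rewrite mem_iota add0n /= in vu * => jm.
move: zy; rewrite inE => /predU1P[->|zy].
  rewrite -(act_mul actP) -exprS; move: jm; rewrite ltnS leq_eqVlt => /predU1P[->|jm].
    rewrite exprS (act_mul actP) cP act_sum; apply: lin_span_sum => i _.
    rewrite actZ -(act_mul actP) -exprS; apply/lin_spanZ/u'P => //.
    by rewrite ltnS.
  exact: u'P.
rewrite actC; apply: (@lin_span_linear _ _ u u' (act (y ^+ j))); last exact: uy.
  exact: act_linear.
by move=> v' v'u; exact: u'P.
Qed.

Lemma stable_closed u : subring_closed (fun r => `[< forall v, v \in u -> lin_span u (act r v) >]).
Proof.
split=> [|r s /asboolP rP /asboolP sP|r s /asboolP rP /asboolP sP]; apply/asboolP => v vu.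
- by rewrite (act_one actP); exact: lin_span_mem.
- by rewrite (act_add actP) actN; apply: lin_spanB; [exact: rP|exact: sP].
- rewrite (act_mul actP); apply: (@lin_span_linear _ _ u u (act r)) => //; last exact: sP.
  exact: act_linear.
Qed.

End Action.

(** * Ranks of a separated family of commuting matrices *)

Section Decomposition.
Variables (k : fieldType) (d : nat) (I : choiceType) (P : set I).
Variables (s : I -> 'M[k]_d) (u : I -> I -> 'M[k]_d).
Hypothesis us_comm : forall i j l, P i -> P j -> i != j -> u i j *m s l = s l *m u i j.
Hypothesis us_inj : forall i j, P i -> P j -> i != j -> forall v : 'rV_d,
  v *m u i j *m s i = 0 -> v *m s i = 0.
Hypothesis us_kill : forall i j, P i -> P j -> i != j -> s j *m u i j = 0.
Hypothesis s_faithful : forall v : 'rV_d, (forall i, P i -> v *m s i = 0) -> v = 0.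

(** The product of the u i j with j in F. *)
Lemma separating_operator i (F : seq I) : P i -> {in F, forall j, P j} -> i \notin F ->
  exists U : 'M[k]_d, [/\ forall j, j \in F -> s j *m U = 0,
    forall v : 'rV_d, v *m U *m s i = 0 -> v *m s i = 0 &
    forall l, U *m s l = s l *m U].
Proof.
move=> Pi; elim: F => [_ _|j F ih FP].
  by exists 1%:M; split=> // [v|l]; rewrite ?mulmx1 ?mul1mx.
rewrite inE negb_or => /andP[ij iF].
have Pj : P j by apply: FP; rewrite inE eqxx.
have [l lF|//|U [UF Ui Uc]] := ih; first by apply: FP; rewrite inE lF orbT.
exists (U *m u i j); split=> [l|v|l].
- rewrite inE => /predU1P[->|lF]; last by rewrite mulmxA UF // mul0mx.
  by rewrite mulmxA -Uc -mulmxA us_kill // mulmx0.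
- by rewrite mulmxA => /us_inj-/(_ Pi Pj ij)/Ui.
- by rewrite -mulmxA us_comm // !mulmxA Uc.
Qed.

(** The operator U separating i from F kills the images of the s j and is injective
    on the image of s i. *)
Lemma rank_sum_images (F : seq I) : uniq F -> {in F, forall j, P j} ->
  \rank (\sum_(j <- F) s j)%MS = (\sum_(j <- F) \rank (s j))%N.
Proof.
elim: F => [_ _|i F ih /= /andP[iF uF] FP]; first by rewrite !big_nil mxrank0.
have FP' : {in F, forall j, P j} by move=> j jF; apply: FP; rewrite inE jF orbT.
have Pi : P i by apply: FP; rewrite inE eqxx.
rewrite !big_cons -ih // -mxrank_sum_cap.
suff -> : (s i :&: \sum_(j <- F) s j)%MS = 0 by rewrite mxrank0 addn0.
have [U [UF Ui Uc]] := separating_operator Pi FP' iF.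
apply/eqP/rowV0P => v; rewrite sub_capmx => /andP[/submxP[w ->] vF].
have : (\sum_(j <- F) s j <= kermx U)%MS.
  rewrite big_seq; apply: (big_ind (fun X : 'M_d => (X <= kermx U)%MS)).
  - exact: sub0mx.
  - by move=> X Y hX hY; rewrite addsmx_sub hX.
  - by move=> j jF; apply/sub_kermxP/UF.
move=> /(submx_trans vF)/sub_kermxP; rewrite -mulmxA -Uc mulmxA; exact: Ui.
Qed.

Lemma rank_common_kernel (F : seq I) :
  (d <= \sum_(j <- F) \rank (s j) + \rank (\bigcap_(j <- F) kermx (s j))%MS)%N.
Proof.
elim: F => [|i F ih]; first by rewrite !big_nil mxrank1.
rewrite !big_cons; have := mxrank_sum_cap (kermx (s i)) (\bigcap_(j <- F) kermx (s j))%MS.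
have := rank_leq_row (kermx (s i) + \bigcap_(j <- F) kermx (s j))%MS.
have := rank_leq_row (s i); rewrite mxrank_ker.
set a := \rank (s i); set b := \rank (_ + _)%MS; set c := \rank (_ :&: _)%MS.
set e := \rank (\bigcap_(j <- F) _)%MS in ih *; set t := (\sum_(j <- F) _)%N in ih *.
by move=> h1 h2 h3; lia.
Qed.

(** The images of the s i are independent, so only finitely many s i are nonzero, and
    their common kernel is zero; the two rank estimates give equality. *)
Lemma esum_rank : (\esum_(i in P) ((\rank (s i))%:R : Rdefinitions.R)%:E)%E
  = ((d%:R : Rdefinitions.R)%:E)%E.
Proof.
pose Q n := `[< exists F : seq I, [/\ uniq F, {in F, forall j, P j},
  {in F, forall j, s j != 0} & size F = n] >].
have Q0 : Q 0%N by apply/asboolP; exists [::].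
have rk F : uniq F -> {in F, forall j, P j} -> (\sum_(j <- F) \rank (s j) <= d)%N.
  by move=> uF FP; rewrite -rank_sum_images // rank_leq_row.
have Qd n : Q n -> (n <= d)%N.
  move=> /asboolP[F [uF FP Fs <-]]; apply: leq_trans (rk F uF FP).
  rewrite -sum1_size [X in (X <= _)%N]big_seq [X in (_ <= X)%N]big_seq.
  by apply: leq_sum => i /Fs; rewrite lt0n mxrank_eq0.
case: (ex_maxnP (ex_intro _ 0%N Q0) Qd) => n /asboolP[F [uF FP Fs Fn]] Fmax.
have out i : P i -> i \notin F -> s i = 0.
  move=> Pi iF; apply/eqP/negPn/negP => si.
  have /Fmax : Q n.+1.
    apply/asboolP; exists (i :: F); split.
    - by rewrite /= iF.
    - by move=> j; rewrite inE => /predU1P[->|/FP].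
    - by move=> j; rewrite inE => /predU1P[->|/Fs].
    - by rewrite /= Fn.
  by rewrite ltnn.
have dE : (\sum_(j <- F) \rank (s j))%N = d.
  apply/eqP; rewrite eqn_leq rk //=.
  have := rank_common_kernel F.
  suff -> : (\bigcap_(j <- F) kermx (s j))%MS = 0 by rewrite mxrank0 addn0.
  apply/eqP/rowV0P => v vF; apply: s_faithful => i Pi.
  case: (boolP (i \in F)) => [iF|/(out _ Pi) ->]; last exact: mulmx0.
  apply/sub_kermxP; apply: submx_trans vF _.
  by rewrite (big_rem i) //= capmxSl.
rewrite (esumID [set` F]); last by move=> i _; rewrite lee_fin ler0n.
rewrite [X in (_ + X)%E]esum1 ?adde0; last first.
  by move=> i [Pi /negP iF]; rewrite out // mxrank0.
have -> : P `&` [set` F] = [set` F].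
  by apply/seteqP; split=> [i []//|i iF]; split=> //; exact: FP.
rewrite esum_fset ?finite_seq //.
rewrite -fsbig_seq //.
by rewrite sumEFin -natr_sum dE.
Qed.

End Decomposition.

(** * The fibre of M at a prime of R *)

Section ResidueFractions.
Variables (A : comPzRingType) (p : Spec A).

Lemma residue_frac (c : residue p) : exists a s,
  (s : A^o) \notin p /\ to_residue p s * c = to_residue p a.
Proof.
elim/quotring_ind: c; elim/loc_ind => a s; exists a, (sval s); split; first exact: (valP s).
rewrite -[LHS](rmorphM (quotring_pi (max_ideal p)) (loc_inj p (sval s))).
congr quotring_pi; apply: etrans (loc_scaleE _ _ _ _) _.
apply/loc_eqP; exists (den1 p) => /=.
have E (x : A) (y : A^o) : x *: y = x * y :> A by [].
by rewrite !E; ring.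
Qed.

Lemma notin_mul (a b : A) : (a : A^o) \notin p -> (b : A^o) \notin p -> (a * b : A^o) \notin p.
Proof. by move=> ap bp; apply/negP => /prime_mul[]; apply/negP. Qed.

Lemma notin_exp (a : A) n : (a : A^o) \notin p -> (a ^+ n : A^o) \notin p.
Proof.
move=> ap; elim: n => [|n ih]; first exact: prime_proper.
by rewrite exprS; exact: notin_mul.
Qed.

Lemma notin_prod (I : Type) (r : seq I) (P : pred I) (F : I -> A) :
  (forall i, P i -> (F i : A^o) \notin p) -> (\prod_(i <- r | P i) F i : A^o) \notin p.
Proof.
move=> h; apply: (big_ind (fun x : A => (x : A^o) \notin p)) => //.
- exact: prime_proper.
- exact: notin_mul.
Qed.

(** A common denominator for finitely many elements of the residue field. *)
Lemma residue_fracs (c : nat -> residue p) d : exists (a : nat -> A) s,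
  (s : A^o) \notin p /\ forall i, (i < d)%N -> to_residue p s * c i = to_residue p (a i).
Proof.
elim: d => [|d [a [s [sp aP]]]]; first by exists (fun=> 0), 1; split=> //; exact: prime_proper.
have [b [t [tp bP]]] := residue_frac (c d).
exists (fun i => if i == d then s * b else t * a i), (s * t).
split=> [|i]; first exact: notin_mul.
rewrite ltnS leq_eqVlt !rmorphM => /predU1P[->|id].
  by rewrite eqxx -mulrA bP rmorphM.
by rewrite ltn_eqF // mulrAC aP // mulrC rmorphM.
Qed.

End ResidueFractions.

Lemma redmod_eq0 (A : comPzRingType) (J : ideal A) (M : lmodType A) (m : M) :
  redmod_pi J m = 0 <-> m \in ideal_mul M J.
Proof.
have E : redmod_pi J (0 : M) = 0.
  by apply: (addrI (redmod_pi J 0)); rewrite -redmod_piD !addr0.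
by rewrite -E redmod_eqP subr0.
Qed.

Section Fiber.
Variables (A R : comPzRingType) (phi : {rmorphism A -> R}) (M : lmodType R).

Definition in_pM (p : Spec A) (m : M) := exists N (a : nat -> A) (z : nat -> M),
  (forall i, (a i : A^o) \in p) /\ m = \sum_(i < N) phi (a i) *: z i.

Section Fixed.
Variable p : Spec A.

Lemma in_pM0 : in_pM p 0.
Proof.
by exists 0%N, (fun=> 0), (fun=> 0); split=> [i|]; rewrite ?big_ord0 //; exact: (@rpred0 A^o p).
Qed.

Lemma in_pM_gen a m : (a : A^o) \in p -> in_pM p (phi a *: m).
Proof. by move=> ap; exists 1%N, (fun=> a), (fun=> m); rewrite big_ord1. Qed.

Lemma in_pMD m m' : in_pM p m -> in_pM p m' -> in_pM p (m + m').
Proof.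
move=> [N [a [z [ap ->]]]] [N' [a' [z' [ap' ->]]]].
exists (N + N')%N, (fun i => if (i < N)%N then a i else a' (i - N)%N),
  (fun i => if (i < N)%N then z i else z' (i - N)%N); split=> [i|]; first by case: ifP.
rewrite big_split_ord; congr (_ + _); apply: eq_bigr => i _ /=.
  by rewrite ltn_ord.
by rewrite ltnNge leq_addr /= addKn.
Qed.

Lemma in_pMZ r m : in_pM p m -> in_pM p (r *: m).
Proof.
move=> [N [a [z [ap ->]]]]; exists N, a, (fun i => r *: z i); split=> //.
by rewrite scaler_sumr; apply: eq_bigr => i _; rewrite !scalerA mulrC.
Qed.

Lemma in_pM_sum (I : Type) (r : seq I) (P : pred I) (F : I -> M) :
  (forall i, P i -> in_pM p (F i)) -> in_pM p (\sum_(i <- r | P i) F i).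
Proof. by move=> h; apply: big_ind => //; [exact: in_pM0|exact: in_pMD]. Qed.

End Fixed.

Variable n : Spec R.
Local Notation p := (spec_map phi n).
Local Notation W := (redmod (max_ideal p) (restr (loc_map phi n) (locmod n M))).

(** The class of m/s in M_n/pM_n. *)
Definition local_class (m : M) (s : den n) : W := redmod_pi (max_ideal p)
  (loc_frac m s : restr (loc_map phi n) (locmod n M)).

Lemma local_class_ind (P : W -> Prop) : (forall m s, P (local_class m s)) -> forall w, P w.
Proof. by move=> h; elim/redmod_ind; elim/loc_ind. Qed.

(** The fractions m/s with m in pM, which form the submodule (pA_p)M_n. *)
Definition pM_frac (x : restr (loc_map phi n) (locmod n M)) : bool :=
  `[< exists m s, in_pM p m /\ x = loc_frac m s >].

Lemma pM_frac_closed : submod_closed pM_frac.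
Proof.
split=> [|a x y /asboolP[m [s [mp ->]]] /asboolP[m' [s' [mp' ->]]]]; apply/asboolP.
  by exists 0, (den1 n); split=> //; exact: in_pM0.
elim/loc_ind: a => a t.
exists (sval s' *: (phi a *: m) + sval (denM (den_map t) s) *: m'), (denM (denM (den_map t) s) s').
split; first by apply: in_pMD; do ?apply: in_pMZ.
rewrite -loc_fracD; congr (_ + _).
by rewrite -[LHS]/(loc_map phi n (loc_frac _ _) *: (loc_frac m s : locmod n M)) loc_mapE [LHS]loc_scaleE.
Qed.

Lemma local_class_eq0 m s : local_class m s = 0 <-> exists t : R, (t : R^o) \notin n /\ in_pM p (t *: m).
Proof.
have zero m' s' : in_pM p m' -> local_class m' s' = 0.
  move=> [N [a [z [ap ->]]]]; apply/redmod_eq0.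
  have -> : (loc_frac (\sum_(i < N) phi (a i) *: z i) s' : locmod n M) =
      \sum_(i < N) (loc_inj p (a i) *: (loc_frac (z i) s' : restr (loc_map phi n) (locmod n M))).
    elim: N => [|N ih].
      rewrite !big_ord0; apply/loc_eqP; exists (den1 n); rewrite !scaler0 //.
    rewrite !big_ord_recr -ih -loc_frac_same; congr (_ + _).
    rewrite -[RHS]/(loc_map phi n (loc_frac _ _) *: (loc_frac _ _ : locmod n M)).
    rewrite loc_mapE [RHS]loc_scaleE; apply/loc_eqP; exists (den1 n) => /=.
    by rewrite rmorph1 !mul1r.
  apply: rpred_sum => i _; apply: ideal_mulP.
  by apply/max_idealP.
split=> [/redmod_eq0|[t [tn tm]]].
  move=> /asboolP/(_ (Submod pM_frac_closed)) => h.
  have /asboolP[m' [s' [mp /loc_eqP[u]]]] : (loc_frac m s : restr (loc_map phi n) (locmod n M)) \in Submod pM_frac_closed.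
    apply: h => _ [a [x [+ ->]]]; elim/loc_ind: a => a t; move: x; elim/loc_ind=> z r.
    move=> /max_idealP ap; apply/asboolP; exists (phi a *: z), (denM (den_map t) r).
    split; first exact: in_pM_gen.
    by rewrite -[LHS]/(loc_map phi n (loc_frac _ _) *: (loc_frac _ _ : locmod n M)) loc_mapE [LHS]loc_scaleE.
  move=> E; exists (sval u * sval s'); split; last by rewrite E; exact: in_pMZ.
  exact: (valP (denM u s')).
rewrite -(@zero (t *: m) (denM (exist _ t tn : den n) s)) //.
congr redmod_pi; apply/loc_eqP; exists (den1 n) => /=.
by rewrite !scalerA; congr (_ *: _); ring.
Qed.

Definition local_act (r : R) (w : W) : W := redmod_pi (max_ideal p)
  (loc_inj n r *: (redmod_repr w : locmod n M) : restr (loc_map phi n) (locmod n M)).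

Lemma local_act_pi r (x : locmod n M) : local_act r (redmod_pi (max_ideal p) (x : restr (loc_map phi n) _)) =
  redmod_pi (max_ideal p) (loc_inj n r *: x : restr (loc_map phi n) (locmod n M)).
Proof.
apply/redmod_eqP; set y := redmod_repr _.
have : (y : restr (loc_map phi n) (locmod n M)) - x \in ideal_mul (restr (loc_map phi n) (locmod n M)) (max_ideal p).
  by apply/redmod_eqP; rewrite redmod_reprK.
rewrite -[X in X \in _ -> _]/((y : locmod n M) - x) -[X in _ -> X \in _]/(loc_inj n r *: (y : locmod n M) - loc_inj n r *: x).
rewrite -scalerBr; move: (_ - x) => z.
move=> /asboolP zN; apply/asboolP => N NP.
pose Q (z : restr (loc_map phi n) (locmod n M)) : bool :=
  (loc_inj n r *: (z : locmod n M) : restr (loc_map phi n) (locmod n M)) \in N.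
have Qc : submod_closed Q.
  split; rewrite /in_mem /= /Q; first by rewrite scaler0; exact: rpred0.
  move=> a u v; rewrite /in_mem /= /Q => uN vN.
  suff : (loc_inj n r *: (loc_map phi n a *: (u : locmod n M) + v)
    : restr (loc_map phi n) (locmod n M)) \in N by [].
  rewrite scalerDr scalerA mulrC -scalerA.
  by apply: (@rpredD _ N); [apply: (@rpredZ _ _ N a)|].
apply: (zN (Submod Qc)) => _ [a [m [am ->]]]; rewrite /in_mem /= /Q.
suff : (loc_inj n r *: (loc_map phi n a *: (m : locmod n M))
  : restr (loc_map phi n) (locmod n M)) \in N by [].
rewrite scalerA mulrC -scalerA; apply: NP.
by exists a, (loc_inj n r *: (m : locmod n M)).
Qed.

Lemma local_act_class r m s : local_act r (local_class m s) = local_class (r *: m) s.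
Proof.
rewrite local_act_pi; congr redmod_pi; apply: etrans (loc_scaleE _ _ _ _) _.
by apply/loc_eqP; exists (den1 n) => /=; rewrite !mul1r.
Qed.

End Fiber.

(** * Quasi-finiteness as algebraicity *)

Lemma poly_act_lift (A R : comPzRingType) (phi : {rmorphism A -> R}) (k : fieldType)
    (W : lmodType k) (act : R -> W -> W) (kap : {rmorphism A -> k}) d (a : nat -> A) x w :
  ring_action act -> (forall b v, act (phi b) v = kap b *: v) ->
  poly_act act (\poly_(i < d) kap (a i)) x w = act (\sum_(i < d) phi (a i) * x ^+ i) w.
Proof.
move=> actP actphi; rewrite (@poly_act_wide _ _ _ _ d) ?size_poly //.
have actsum (I : Type) (s : seq I) (F : I -> R) : act (\sum_(i <- s) F i) w = \sum_(i <- s) act (F i) w.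
  by apply: (big_morph (fun r => act r w)); [move=> r s'; exact: act_add|exact: act0].
rewrite actsum; apply: eq_bigr => i _.
by rewrite coef_poly ltn_ord (act_mul actP) actphi.
Qed.

Section LocalFiber.
Variables (A R : comPzRingType) (phi : {rmorphism A -> R}) (M : lmodType R) (n : Spec R).
Local Notation p := (spec_map phi n).
Local Notation W := (redmod (max_ideal p) (restr (loc_map phi n) (locmod n M))).
Local Notation local_act := (@local_act A R phi M n).
Local Notation local_class := (@local_class A R phi M n).

Lemma local_classD m m' s : local_class m s + local_class m' s = local_class (m + m') s.
Proof. by rewrite -redmod_piD; congr redmod_pi; exact: loc_frac_same. Qed.

Lemma local_class0 s : local_class 0 s = 0.
Proof. by apply: (addrI (local_class 0 s)); rewrite local_classD !addr0. Qed.

Lemma local_class_sum (I : Type) (r : seq I) (F : I -> M) s :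
  local_class (\sum_(i <- r) F i) s = \sum_(i <- r) local_class (F i) s.
Proof. by apply: (big_morph (local_class^~ s)); [move=> x y; rewrite local_classD|exact: local_class0]. Qed.

Lemma local_act_action : @ring_action R (residue p) W local_act.
Proof.
split.
- move=> r; elim/quotring_ind=> a; elim/redmod_ind=> x; elim/redmod_ind=> y.
  rewrite !local_act_pi -[quotring_pi _ a *: _]/(redmod_scale _ _) redmod_piZ -redmod_piD local_act_pi.
  rewrite -[_ *: redmod_pi _ _]/(redmod_scale _ _) redmod_piZ -redmod_piD; congr redmod_pi.
  suff : loc_inj n r *: (loc_map phi n a *: (x : locmod n M) + y) =
    loc_map phi n a *: (loc_inj n r *: (x : locmod n M)) + loc_inj n r *: (y : locmod n M) by [].
  by rewrite scalerDr !scalerA mulrC.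
- move=> r s; elim/local_class_ind=> m t.
  by rewrite !local_act_class local_classD scalerDl.
- by move=> r s; elim/local_class_ind=> m t; rewrite !local_act_class scalerA.
- by elim/local_class_ind=> m t; rewrite local_act_class scale1r.
Qed.

Lemma local_act_phi a w : local_act (phi a) w = to_residue p a *: w.
Proof.
elim/redmod_ind: w => x; rewrite local_act_pi.
rewrite -[RHS]/(redmod_scale (quotring_pi _ (loc_inj p a)) _) redmod_piZ; congr redmod_pi.
suff -> : loc_inj n (phi a) = loc_map phi n (loc_inj p a) by [].
rewrite [loc_inj p a]/loc_inj loc_mapE; apply/loc_eqP; exists (den1 n) => /=.
by rewrite rmorph1.
Qed.

(** An element outside n acts invertibly on M_n/pM_n. *)
Lemma local_act_inj s w : (s : R^o) \notin n -> local_act s w = 0 -> w = 0.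
Proof.
move=> sn; elim/local_class_ind: w => m t; rewrite local_act_class => /local_class_eq0[u [un um]].
apply/local_class_eq0; exists (u * s); rewrite -scalerA; split=> //.
exact: notin_mul.
Qed.

Lemma local_act_den m s : local_act (sval s) (local_class m s) = local_class m (den1 n).
Proof.
rewrite local_act_class; congr redmod_pi; apply/loc_eqP; exists (den1 n) => /=.
by rewrite scalerA !mul1r.
Qed.

(** The exponent e is there because the determinant trick raises a relation to a
    power; it spares multiplying out polynomials over A. *)
Definition algebraic_at (x : R) := exists d (a : nat -> A) (e : nat) (t : R),
  [/\ exists2 i, (i < d)%N & (a i : A^o) \notin p, (t : R^o) \notin n &
      forall m : M, in_pM phi p ((t * (\sum_(i < d) phi (a i) * x ^+ i) ^+ e) *: m)].

Lemma poly_lift_neq0 d (a : nat -> A) : (exists2 i, (i < d)%N & (a i : A^o) \notin p) ->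
  \poly_(i < d) to_residue p (a i) != 0.
Proof.
move=> [i id ap]; apply/eqP => /polyP/(_ i); rewrite coef_poly id coef0.
by move=> /to_residue_eq0; exact/negP.
Qed.

Lemma algebraic_at_algebraic_on x : algebraic_at x -> algebraic_on local_act x.
Proof.
move=> [d [a [e [t [ap tn tP]]]]].
exists ((\poly_(i < d) to_residue p (a i)) ^+ e); split.
  by rewrite expf_neq0 // poly_lift_neq0.
have actP := local_act_action.
move=> w; apply: (local_act_inj tn).
have -> : poly_act local_act ((\poly_(i < d) to_residue p (a i)) ^+ e) x w =
    local_act ((\sum_(i < d) phi (a i) * x ^+ i) ^+ e) w.
  elim: e w {tP} => [|e ih] w.
    by rewrite !expr0 (@poly_act_wide _ _ _ _ 1) ?size_poly1 // big_ord1 coef1 scale1r.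
  rewrite !exprS (poly_actM actP) ih (act_mul actP).
  by apply: poly_act_lift => //; exact: local_act_phi.
rewrite -(act_mul actP); elim/local_class_ind: w => m s; rewrite local_act_class.
by apply/local_class_eq0; exists 1; rewrite scale1r; split=> //; exact: prime_proper.
Qed.

Section Generators.
Variables (r : nat) (e : 'I_r -> M).
Hypothesis eS : forall m, exists c : 'rV[R]_r, m = \sum_i c 0 i *: e i.

(** Linear dependence of the x^i e_j, with denominators cleared; the t_j obtained for
    the generators e_j are multiplied together. *)
Lemma quasi_finite_algebraic_at x : quasi_finite_at phi M n -> algebraic_at x.
Proof.
move=> /vdim_fin[N [b bP]].
have [f [f0 fP]] := @linear_dependence (residue p) W N b r
  (fun i j => local_class (x ^+ i *: e j) (den1 n)) bP.
have [a [s [sp aP]]] := residue_fracs (fun i => f`_i) (size f).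
pose F := \sum_(i < size f) phi (a i) * x ^+ i.
have Fe j : exists t : R, (t : R^o) \notin n /\ in_pM phi p (t *: (F *: e j)).
  apply/(local_class_eq0 phi _ (den1 n)); rewrite scaler_suml local_class_sum.
  have := congr1 ( *:%R (to_residue p s)) (fP j); rewrite scaler0 scaler_sumr => E0; apply: (etrans _ E0).
  apply: eq_bigr => i _; rewrite scalerA aP // -local_act_phi local_act_class scalerA.
  by [].
have /choice[t tP] := Fe.
exists (size f), a, 1%N, (\prod_j t j); split.
- exists (size f).-1; first by rewrite prednK // size_poly_gt0.
  apply/negP => ap; have f1 : ((size f).-1 < size f)%N by rewrite prednK // size_poly_gt0.
  have := aP _ f1; rewrite (iffRL (to_residue_eq0 _ _) ap) => /eqP.
  rewrite mulf_eq0 -lead_coefE lead_coef_eq0 (negbTE f0) orbF => /eqP/to_residue_eq0.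
  exact/negP.
- by apply: notin_prod => j _; have [] := tP j.
- move=> m; have [c ->] := eS m; rewrite scaler_sumr; apply: in_pM_sum => j _.
  rewrite scalerA mulrC -scalerA; apply: in_pMZ; rewrite expr1 (bigD1 j) //=.
  rewrite [t j * _]mulrC -mulrA -scalerA; apply: in_pMZ.
  by rewrite -scalerA; have [] := tP j.
Qed.

(** The finite dimensional span u of the monomials in ys applied to the generators is
    stable under every x: if g and g x act on it and g is outside n, then g is
    injective, hence onto, and v = g v' gives x v = (g x) v'.  The same argument
    inverts the denominators. *)
Lemma algebraic_at_quasi_finite (ys : seq R) : (forall y, y \in ys -> algebraic_at y) ->
    (forall T : R -> bool, subring_closed T -> (forall a, T (phi a)) ->
      (forall y, y \in ys -> T y) ->
      forall x, exists g : R, [/\ (g : R^o) \notin n, T g & T (g * x)]) ->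
  quasi_finite_at phi M n.
Proof.
move=> ysA ysgen; have actP := local_act_action.
have [u [ue uy]] := @finite_stable _ _ _ _ actP ys [seq local_class (e j) (den1 n) | j <- enum 'I_r]
  (fun y yys => algebraic_at_algebraic_on (ysA y yys)).
have actL := act_linear actP.
have inv s w : (s : R^o) \notin n -> (forall v, v \in u -> lin_span u (local_act s v)) ->
    lin_span u w -> exists2 w', lin_span u w' & local_act s w' = w.
  by move=> sn su; apply: lin_span_inj_surj => // v; exact: local_act_inj.
have stab x v : v \in u -> lin_span u (local_act x v).
  move=> vu.
  have [|y yys|g [gn /asboolP gT /asboolP gxT]] := ysgen _ (stable_closed actP u) _ _ x.
  - by move=> a; apply/asboolP => w wu; rewrite local_act_phi; exact/lin_spanZ/lin_span_mem.
  - by apply/asboolP => w wu; exact: uy.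
  have [v' v'u <-] := inv g v gn gT (lin_span_mem vu).
  rewrite -(act_mul actP) mulrC; exact: (lin_span_linear (actL _)) v'u.
apply/vdim_fin; apply: (@lin_span_basis _ _ u); elim/local_class_ind=> m s.
have [|w' w'u ww'] := @inv (sval s) (local_act (sval s) (local_class m s)) (valP s) (stab _).
  rewrite local_act_den; have [c ->] := eS m; rewrite local_class_sum; apply: lin_span_sum => j _.
  rewrite -local_act_class; apply: (lin_span_linear (actL _)) (stab _) _.
  by apply: ue; apply: map_f; rewrite mem_enum.
suff <- : w' = local_class m s by [].
apply/eqP; rewrite -subr_eq0; apply/eqP; apply: (local_act_inj (valP s)).
by rewrite (actD actP) (_ : - _ = -1 *: local_class m s) ?scaleN1r // -scaleN1r (actZ actP) ww' scaleN1r subrr.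
Qed.

End Generators.
End LocalFiber.

(** * The fibre of M over a prime of A *)

Lemma scale_cross (k : comPzRingType) (V : lmodType k) (c1 c2 c3 : k) (x y v w : V) :
  c2 *: x = c3 *: v -> c1 *: y = w -> (c1 * c2) *: (x + y) = (c1 * c3) *: v + c2 *: w.
Proof. by move=> h1 <-; rewrite scalerDr -!scalerA h1 !scalerA [c2 * c1]mulrC. Qed.

Section GlobalFiber.
Variables (A R : comPzRingType) (phi : {rmorphism A -> R}) (M : lmodType R) (p : Spec A).
Local Notation k := (residue p).
Local Notation kap := (to_residue p).
Local Notation V := (tensor (to_residue p) (restr phi M)).
Local Notation tens_pi := (@tens_pi A (residue p) (to_residue p) (restr phi M)).
Local Notation tens_eq := (@tens_eq A (residue p) (to_residue p) (restr phi M)).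

Lemma tens_piD s t : tens_pi s + tens_pi t = tens_pi (s ++ t).
Proof. exact: tens_addE. Qed.

Lemma tens_piZ c s : c *: tens_pi s = tens_pi (tens_map_mul c s).
Proof. exact: tens_scaleE. Qed.

Lemma tens_pi_cons x s : tens_pi (x :: s) = tens_pi [:: x] + tens_pi s.
Proof. by rewrite tens_piD. Qed.

Lemma tens_pi_nil : tens_pi [::] = 0. Proof. by []. Qed.

Definition tens_map_act (r : R) (s : seq (restr phi M * k)) : seq (restr phi M * k) :=
  [seq (r *: (x.1 : M), x.2) | x <- s].

Lemma tens_map_act_eq r s t : tens_eq s t -> tens_eq (tens_map_act r s) (tens_map_act r t).
Proof.
elim=> {s t} /=.
- by move=> s; exact: tens_refl.
- by move=> s t _; exact: tens_sym.
- by move=> s t u _ h _; exact: tens_trans h.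
- by move=> s s' t t' _ h _ h'; rewrite /tens_map_act !map_cat; exact: tens_cat.
- by move=> s t; rewrite /tens_map_act !map_cat; exact: tens_catC.
- by move=> b; rewrite scaler0; exact: tens_0l.
- by move=> m m' b; rewrite scalerDr; exact: tens_Dl.
- by move=> m b b'; exact: tens_Dr.
- move=> a m b.
  suff -> : r *: (a *: m : M) = (a *: (r *: (m : M) : restr phi M) : restr phi M).
    exact: tens_Zl.
  suff : r *: (phi a *: (m : M)) = phi a *: (r *: (m : M)) by [].
  by rewrite !scalerA mulrC.
Qed.

Definition fiber_act (r : R) (v : V) : V := tens_pi (tens_map_act r (tens_repr v)).

Lemma fiber_actE r s : fiber_act r (tens_pi s) = tens_pi (tens_map_act r s).
Proof. by apply/tens_eqP/tens_map_act_eq/tens_reprP. Qed.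

Lemma fiber_act_action : @ring_action R k V fiber_act.
Proof.
split.
- move=> r c; elim/tens_ind=> s; elim/tens_ind=> t.
  rewrite tens_piZ tens_piD !fiber_actE tens_piZ tens_piD; congr tens_pi.
  by rewrite /tens_map_act /tens_map_mul map_cat -!map_comp.
- move=> r s; elim/tens_ind=> t; rewrite !fiber_actE.
  elim: t => [|[m b] t ih] /=; first by rewrite tens_pi_nil addr0.
  rewrite tens_pi_cons ih [X in _ = X + _]tens_pi_cons [X in _ = _ + X]tens_pi_cons.
  rewrite [RHS]addrACA; congr (_ + _); rewrite tens_piD scalerDl.
  by apply/tens_eqP; exact: tens_Dl.
- move=> r s; elim/tens_ind=> t; rewrite (fiber_actE s) !fiber_actE; congr tens_pi.
  by elim: t => //= x t ->; rewrite scalerA.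
- elim/tens_ind=> t; rewrite fiber_actE; congr tens_pi.
  by elim: t => //= -[m b] t -> /=; rewrite scale1r.
Qed.

Lemma fiber_act_phi a v : fiber_act (phi a) v = kap a *: v.
Proof.
elim/tens_ind: v => s; rewrite fiber_actE tens_piZ; elim: s => [//|[m b] s ih] /=.
rewrite tens_pi_cons ih [RHS]tens_pi_cons; congr (_ + _).
apply/tens_eqP; exact: tens_Zl.
Qed.

Definition tpure (m : M) : V := tens_pi [:: (m : restr phi M, 1)].

Lemma tpureD m m' : tpure (m + m') = tpure m + tpure m'.
Proof. by rewrite /tpure tens_piD; apply/tens_eqP; exact: tens_Dl. Qed.

Lemma tpure0 : tpure 0 = 0.
Proof. by apply: (addrI (tpure 0)); rewrite -tpureD !addr0. Qed.

Lemma tpure_sum (I : Type) (r : seq I) (F : I -> M) :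
  tpure (\sum_(i <- r) F i) = \sum_(i <- r) tpure (F i).
Proof. by apply: big_morph; [exact: tpureD|exact: tpure0]. Qed.

Lemma fiber_act_pure r m : fiber_act r (tpure m) = tpure (r *: m).
Proof. by rewrite /tpure fiber_actE. Qed.

Lemma tpure_pM m : in_pM phi p m -> tpure m = 0.
Proof.
move=> [N [a [z [ap ->]]]]; rewrite tpure_sum big1 // => i _.
by rewrite -fiber_act_pure fiber_act_phi (iffRL (to_residue_eq0 _ _) (ap i)) scale0r.
Qed.

(** Every element of M (x) k(p) is a scalar multiple of a pure tensor m (x) 1, since
    the elements of k(p) are fractions with a common denominator. *)
Lemma tens_frac v : exists (m : M) (s : A), (s : A^o) \notin p /\ kap s *: v = tpure m.
Proof.
elim/tens_ind: v; elim=> [|[m b] t [m' [s [sp ih]]]].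
  exists 0, 1; rewrite tpure0 tens_pi_nil scaler0; split=> //; exact: prime_proper.
have [a [s' [s'p bE]]] := residue_frac b.
exists (phi (s * a) *: m + phi s' *: m'), (s * s'); split; first exact: notin_mul.
have xE : kap s' *: tens_pi [:: (m, b)] = kap a *: tpure m.
  by rewrite /tpure !tens_piZ /tens_map_mul /= mulr1; congr (Defs.tens_pi _ [:: (_, _)]).
rewrite tens_pi_cons tpureD -!fiber_act_pure !fiber_act_phi !rmorphM.
exact: scale_cross xE ih.
Qed.

Lemma scale_frac_inj (s : A) (v : V) : (s : A^o) \notin p -> kap s *: v = 0 -> v = 0.
Proof.
move=> sp /(congr1 (fun w => (kap s)^-1 *: w)); rewrite scalerA scaler0 mulVf ?scale1r //.
by apply: contra sp => /eqP/to_residue_eq0.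
Qed.

End GlobalFiber.

Section Comparison.
Variables (A R : comPzRingType) (phi : {rmorphism A -> R}) (M : lmodType R) (n : Spec R).
Local Notation p := (spec_map phi n).
Local Notation V := (tensor (to_residue p) (restr phi M)).
Local Notation W := (redmod (max_ideal p) (restr (loc_map phi n) (locmod n M))).
Local Notation local_act := (@local_act A R phi M n).
Local Notation fiber_act := (@fiber_act A R phi M p).
Local Notation wcl m := (@local_class A R phi M n m (den1 n)).

(** The map M (x) k(p) -> M_n/pM_n on representing sequences. *)
Definition localize_seq (s : seq (restr phi M * residue p)) : W :=
  \sum_(x <- s) x.2 *: wcl x.1.

Lemma localize_seq_eq s t : @tens_eq _ _ (to_residue p) _ s t -> localize_seq s = localize_seq t.
Proof.
elim=> {s t} /=.
- by [].
- by move=> s t _ ->.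
- by move=> s t u _ -> _ ->.
- by move=> s s' t t' _ h _ h'; rewrite /localize_seq !big_cat /=; congr (_ + _).
- by move=> s t; rewrite /localize_seq !big_cat /= addrC.
- by move=> b; rewrite /localize_seq big_seq1 big_nil local_class0 scaler0.
- move=> m m' b; rewrite /localize_seq !big_cons !big_nil !addr0 /= -scalerDr.
  by rewrite local_classD.
- by move=> m b b'; rewrite /localize_seq !big_cons !big_nil !addr0 /= scalerDl.
- move=> a m b; rewrite /localize_seq !big_seq1 /= mulrC -scalerA; congr (_ *: _).
  by rewrite -local_act_phi local_act_class.
Qed.

Definition localize (v : V) : W := localize_seq (tens_repr v).

Lemma localizeE s : localize (tens_pi _ s) = localize_seq s.
Proof. exact/localize_seq_eq/tens_reprP. Qed.

Lemma localize_linear : linear (localize : V -> W).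
Proof.
move=> c; elim/tens_ind=> s; elim/tens_ind=> t.
rewrite tens_piZ tens_piD !localizeE /localize_seq big_cat big_map /=.
by rewrite scaler_sumr; congr (_ + _); apply: eq_bigr => x _; rewrite scalerA.
Qed.

HB.instance Definition _ := GRing.isLinear.Build (residue p) V W *:%R localize localize_linear.

Lemma localize_act r v : localize (fiber_act r v) = local_act r (localize v).
Proof.
elim/tens_ind: v => s; rewrite fiber_actE !localizeE /localize_seq big_map.
rewrite (act_sum (local_act_action _ _ _)); apply: eq_bigr => x _ /=.
by rewrite (actZ (local_act_action _ _ _)) local_act_class.
Qed.

Lemma localize_pure m : localize (tpure phi p m) = wcl m.
Proof. by rewrite localizeE /localize_seq big_seq1 scale1r. Qed.

Lemma localize_eq0 v : localize v = 0 <-> exists t : R, (t : R^o) \notin n /\ fiber_act t v = 0.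
Proof.
split=> [v0|[t [tn tv]]]; last first.
  by apply: (local_act_inj tn); rewrite -localize_act tv linear0.
have [m [s [sp sv]]] := tens_frac v.
have := congr1 localize sv; rewrite linearZ /= v0 scaler0 localize_pure => /esym.
move=> /local_class_eq0[t [tn tm]]; exists t; split=> //.
apply: (scale_frac_inj sp); rewrite -(actZ (fiber_act_action _ _ _)) sv fiber_act_pure.
exact: tpure_pM.
Qed.

(** The image is finite dimensional and stable under each s outside n, so s is onto
    on it, and it contains all m/s. *)
Lemma localize_surj d (e : 'I_d -> V) : is_basis e -> forall w, exists v, w = localize v.
Proof.
move=> [eS _].
pose u := [seq localize (e i) | i <- enum 'I_d].
have uP v : lin_span u (localize v).
  have [c ->] := eS v; rewrite linear_sum; apply: lin_span_sum => i _.
  by rewrite linearZ; apply/lin_spanZ/lin_span_mem/map_f; rewrite mem_enum.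
have uI w : lin_span u w -> exists v, w = localize v.
  move=> [c ->].
  have [v vP] : exists v : nat -> V, forall i, (i < size u)%N -> u`_i = localize (v i).
    have /choice[v vP] : forall i, exists v, (i < size u)%N -> u`_i = localize v.
      move=> i; case: (ltnP i (size u)) => [iu|_]; last by exists 0.
      by have /mapP[j _ ->] := mem_nth 0 iu; exists (e j).
    by exists v.
  exists (\sum_i c 0 i *: v i); rewrite linear_sum; apply: eq_bigr => i _.
  by rewrite vP // linearZ.
have actP := local_act_action phi M n.
elim/local_class_ind=> m s; apply: uI.
have [|v||w' w'u E] := @lin_span_inj_surj _ _ u (local_act (sval s)) (act_linear actP _) _ _ (wcl m).
- by move=> v /mapP[i _ ->]; rewrite -localize_act.
- exact: (local_act_inj (valP s)).
- by rewrite -localize_pure.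
- suff <- : w' = local_class phi m s by [].
  apply/eqP; rewrite -subr_eq0; apply/eqP; apply: (local_act_inj (valP s)).
  by rewrite (actD actP) -scaleN1r (actZ actP) E local_act_den scaleN1r subrr.
Qed.

(** When s outside n kills everything that some element outside n kills, the kernel
    of the localization map is the kernel of s. *)
Lemma local_fiber_dim_rank d (e : 'I_d -> V) (s : R) (S : 'M[residue p]_d) :
    is_basis e -> (s : R^o) \notin n ->
    (forall t v, (t : R^o) \notin n -> fiber_act t v = 0 -> fiber_act s v = 0) ->
    (forall v : 'rV_d, fiber_act s (\sum_i v 0 i *: e i) = \sum_i (v *m S) 0 i *: e i) ->
  local_fiber_dim phi M n = ((\rank S)%:R)%:E.
Proof.
move=> eB sn smax sS; have [eS eF] := eB.
pose f (v : 'rV[residue p]_d) : V := \sum_i v 0 i *: e i.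
have fL : linear f.
  move=> a v w; rewrite scaler_sumr -big_split.
  by apply: eq_bigr => i _ /=; rewrite !mxE scalerDl scalerA.
have f0 v : f v = 0 -> v = 0 by move=> /eF h; apply/rowP => i; rewrite h mxE.
have fS v : exists c, v = f c.
  by have [c ->] := eS v; exists (\row_i c i); apply: eq_bigr => i _; rewrite mxE.
have gL : linear (localize \o f) by move=> a v w /=; rewrite fL linearP.
pose g : {linear 'rV[residue p]_d -> W} :=
  HB.pack (localize \o f) (GRing.isLinear.Build _ _ _ _ _ gL).
have [b bP] : exists b : 'I_(d - \rank (kermx S)) -> W, is_basis b.
  apply: (@quotient_basis _ _ _ g (kermx S)) => [w|v].
    by have [v ->] := localize_surj eB w; have [c ->] := fS v; exists c.
  split=> [/localize_eq0[t [tn tv]]|/sub_kermxP vS].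
    apply/sub_kermxP/f0; rewrite -[f _]sS; exact: smax tv.
  apply/localize_eq0; exists s; split=> //; rewrite sS vS big1 // => i _.
  by rewrite mxE scale0r.
have := vdim_basis bP; rewrite /local_fiber_dim => ->.
by rewrite mxrank_ker subKn // rank_leq_row.
Qed.

End Comparison.

(** * Decomposition of a finite fibre *)

Lemma spec_ext (A : comPzRingType) (p q : Spec A) :
  (forall a : A, (a : A^o) \in p <-> (a : A^o) \in q) -> p = q.
Proof.
move: p q => [[f fc] f1 fm] [[g gc] g1 gm] h.
have E : f = g by apply/funext => a; apply/idP/idP => /h.
move: E gc g1 gm {h} => <- gc g1 gm; have E : fc = gc by exact: Prop_irrelevance.
by move: E g1 gm => <- g1 gm; congr MkSpec; exact: Prop_irrelevance.
Qed.

Section SupportDecomposition.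
Variables (R : comPzRingType) (k : fieldType) (V : lmodType k) (act : R -> V -> V).
Hypothesis actP : ring_action act.
Variables (d : nat) (b : 'I_d -> V).
Hypothesis bB : is_basis b.
Variable P : set (Spec R).
Hypothesis act_separation : forall n n', P n -> P n' -> n != n' ->
  exists u s : R, [/\ (u : R^o) \notin n, (s : R^o) \notin n' & forall v, act s (act u v) = 0].
Hypothesis act_support : forall v,
  (forall n, P n -> exists s : R, (s : R^o) \notin n /\ act s v = 0) -> v = 0.

(** For each n choose s outside n with kernel of maximal dimension: then every
    element outside n kills no more than s does. *)
Lemma support_decomposition : exists (s : Spec R -> R) (S : Spec R -> 'M[k]_d),
  [/\ forall n, (s n : R^o) \notin n,
    forall (n : Spec R) (t : R) v, (t : R^o) \notin n -> act t v = 0 -> act (s n) v = 0,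
    forall n (v : 'rV_d), act (s n) (\sum_i v 0 i *: b i) = \sum_i (v *m S n) 0 i *: b i &
    (\esum_(n in P) ((\rank (S n))%:R : Rdefinitions.R)%:E = (d%:R)%:E)%E].
Proof.
have [bS bF] := bB.
have [f fE] : exists f : 'rV[k]_d -> V, forall v, f v = \sum_i v 0 i *: b i.
  by exists (fun v => \sum_i v 0 i *: b i).
have f0 v : f v = 0 -> v = 0 by rewrite fE => /bF h; apply/rowP => i; rewrite h mxE.
have fB v w : f (v - w) = f v - f w.
  by rewrite !fE -sumrB; apply: eq_bigr => i _; rewrite !mxE scalerBl.
have finj v w : f v = f w -> v = w.
  by move=> E; apply/eqP; rewrite -subr_eq0; apply/eqP/f0; rewrite fB E subrr.
have fS v : exists w, v = f w.
  have [c ->] := bS v; exists (\row_i c i); rewrite fE.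
  by apply: eq_bigr => i _; rewrite mxE.
have [rho rhoP] : exists rho : R -> 'M[k]_d, forall t v, act t (f v) = f (v *m rho t).
  have /choice[rho rhoP] : forall t, exists S : 'M[k]_d, forall v, act t (f v) = f (v *m S).
    move=> t; have /choice[c cP] : forall i, exists c, act t (b i) = f c by move=> i; exact: fS.
    exists (\matrix_i c i) => v; rewrite !fE (act_sum actP).
    under eq_bigr do rewrite (actZ actP) cP fE scaler_sumr.
    rewrite exchange_big; apply: eq_bigr => j _ /=; rewrite mxE scaler_suml.
    by apply: eq_bigr => i _; rewrite scalerA mxE.
  by exists rho.
have rho_mul t t' : rho (t * t') = rho t *m rho t'.
  apply/row_matrixP => i; rewrite !rowE; apply: finj.
  by rewrite mulmxA -!rhoP mulrC (act_mul actP).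
have rho_comm t t' : rho t *m rho t' = rho t' *m rho t.
  by rewrite -!rho_mul mulrC.
have rho0 t : (forall v, act t v = 0) -> rho t = 0.
  by move=> t0; apply/row_matrixP => i; rewrite rowE row0; apply: f0; rewrite -rhoP.
have /choice[s sP] : forall n : Spec R, exists s : R, (s : R^o) \notin n /\
    forall (t : R) v, (t : R^o) \notin n -> act t v = 0 -> act s v = 0.
  move=> n.
  pose Q j := `[< exists s : R, (s : R^o) \notin n /\ \rank (kermx (rho s)) = j >].
  have ex : exists j, Q j.
    by exists (\rank (kermx (rho 1))); apply/asboolP; exists 1; split=> //; exact: prime_proper.
  have Qd j : Q j -> (j <= d)%N by move=> /asboolP[s [_ <-]]; exact: rank_leq_row.
  case: (ex_maxnP ex Qd) => j /asboolP[s [sn rs]] jmax; exists s; split=> // t v tn.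
  have [w ->] := fS v; rewrite !rhoP => wt.
  have sub : (kermx (rho s) <= kermx (rho (t * s)%R))%MS.
    by apply/sub_kermxP; rewrite rho_mul rho_comm mulmxA mulmx_ker mul0mx.
  have [le] := mxrank_leqif_sup sub; rewrite eqn_leq le /= rs jmax; last first.
    by apply/asboolP; exists (t * s); split=> //; exact: notin_mul.
  move=> /esym sub'.
  have : (w <= kermx (rho (t * s)%R))%MS.
    by apply/sub_kermxP; rewrite rho_mul mulmxA (f0 _ wt) mul0mx.
  move=> /submx_trans/(_ sub')/sub_kermxP ->.
  by rewrite fE big1 // => i _; rewrite mxE scale0r.
have /choice[u uP] : forall nn : Spec R * Spec R, exists u : R, P nn.1 -> P nn.2 -> nn.1 != nn.2 ->
    (u : R^o) \notin nn.1 /\ forall v, act (s nn.2) (act u v) = 0.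
  move=> [n n']; case: (pselect (P n /\ P n' /\ n != n')) => [[np [n'p nn]]|no]; last first.
    by exists 0 => np n'p nn; case: no.
  have [u [t [un tn utP]]] := act_separation np n'p nn; exists u => _ _ _; split=> // v.
  by have [_ h] := sP n'; exact: h tn (utP v).
exists s, (rho \o s); split.
- by move=> n; have [] := sP n.
- by move=> n t v; have [_ h] := sP n; exact: h.
- by move=> n v; rewrite -!fE rhoP.
apply: (@esum_rank k d (Spec R) P (rho \o s) (fun n n' => rho (u (n, n')))).
- by move=> i j l _ _ _ /=; exact: rho_comm.
- move=> i j ip jp ij v vu; have [ui _] := uP (i, j) ip jp ij.
  have [si smax] := sP i; apply: f0; rewrite -rhoP.
  apply: (smax (s i * u (i, j))); first exact: notin_mul.
  by rewrite (act_mul actP) !rhoP vu fE big1 // => l _; rewrite mxE scale0r.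
- move=> i j ip jp ij; have [_ kill] := uP (i, j) ip jp ij.
  by rewrite /= -rho_mul; apply: rho0 => v; rewrite (act_mul actP) kill.
- move=> v vP; apply/f0/act_support => n np; exists (s n); have [sn _] := sP n.
  by split=> //; rewrite rhoP [_ *m _]vP // fE big1 // => i _; rewrite mxE scale0r.
Qed.

End SupportDecomposition.

Section GlobalToLocal.
Variables (A R : comPzRingType) (phi : {rmorphism A -> R}) (M : lmodType R) (p : Spec A).
Local Notation k := (residue p).
Local Notation kap := (to_residue p).
Local Notation V := (tensor (to_residue p) (restr phi M)).
Local Notation fiber_act := (@fiber_act A R phi M p).
Let actP : @ring_action R k V fiber_act := fiber_act_action phi M p.

(** Otherwise some prime contains the ideal and avoids the images of all elements
    outside p; by the fourth hypothesis it lies over p. *)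
Lemma ideal_meets_complement (I : R -> Prop) : I 0 ->
    (forall r s, I r -> I s -> I (r + s)) -> (forall r s, I s -> I (r * s)) ->
    (forall a, (a : A^o) \in p -> I (phi a)) ->
    (forall n : Spec R, spec_map phi n = p -> exists r : R, (r : R^o) \notin n /\ I r) ->
  exists a : A, (a : A^o) \notin p /\ I (phi a).
Proof.
move=> I0 ID IM Ip In; apply: contrapT => no.
have [|||q [qP Iq Tq _]] := @prime_set_over R I
  (fun r => exists2 a : A, (a : A^o) \notin p & r = phi a) I0 ID IM.
- by exists 1; [exact: prime_proper|rewrite rmorph1].
- by move=> _ _ [a ap ->] [b bp ->]; exists (a * b); rewrite ?rmorphM //; exact: notin_mul.
- by move=> _ [a ap ->] Ia; apply: no; exists a.
have nE : spec_map phi (spec_of qP) = p.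
  apply: spec_ext => a.
  have -> : (a : A^o) \in spec_map phi (spec_of qP) = ((phi a : R^o) \in spec_of qP) by [].
  rewrite spec_ofP; split=> [qa|/Ip/Iq//].
  by apply: contrapT => /negP ap; apply: (Tq (phi a)) => //; exists a.
have [r [rn Ir]] := In _ nE.
by move/negP: rn; apply; apply/spec_ofP; exact: Iq.
Qed.

Lemma fiber_act_in_pM z (v : V) : (forall m : M, in_pM phi p (z *: m)) -> fiber_act z v = 0.
Proof.
move=> zM; have [m [s [sp sv]]] := tens_frac v.
apply: (scale_frac_inj sp); rewrite -(actZ actP) sv fiber_act_pure.
exact: tpure_pM.
Qed.

Section Quasifinite.
Variables (r : nat) (e : 'I_r -> M).
Hypothesis eS : forall m, exists c : 'rV[R]_r, m = \sum_i c 0 i *: e i.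
Hypothesis qf : forall n, spec_map phi n = p -> quasi_finite_at phi M n.

(** Apply [ideal_meets_complement] to the ideal of all t for which x satisfies a
    nontrivial equation on t V. *)
Lemma fiber_algebraic x : algebraic_on fiber_act x.
Proof.
pose I t := exists f : {poly k}, f != 0 /\ forall v, poly_act fiber_act f x (fiber_act t v) = 0.
have [|||||a [ap [f [f0 fP]]]] := @ideal_meets_complement I.
- exists 1; rewrite oner_eq0; split=> // v.
  by rewrite (act0 actP) (poly_act0 actP).
- move=> t t' [f [f0 fP]] [f' [f'0 f'P]]; exists (f * f'); rewrite mulf_neq0 //.
  split=> // v; rewrite (act_add actP) (_ : poly_act _ _ _ _ = poly_act fiber_act (f * f') x (fiber_act t v) + poly_act fiber_act (f * f') x (fiber_act t' v)); last first.
    rewrite /poly_act -big_split; apply: eq_bigr => i _ /=.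
    by rewrite (actD actP) scalerDr.
  by rewrite [in X in X + _]mulrC !(poly_actM actP) fP f'P !(poly_act0 actP) addr0.
- move=> t t' [f [f0 fP]]; exists f; split=> // v.
  by rewrite (act_mul actP) -(act_poly_act actP) fP (actr0 actP).
- move=> a ap; exists 1; rewrite oner_eq0; split=> // v.
  by rewrite fiber_act_phi (iffRL (to_residue_eq0 _ _) ap) scale0r (poly_act0 actP).
- move=> n np; have := quasi_finite_algebraic_at eS x (qf np).
  rewrite /algebraic_at np => -[d [a [j [t [[i id ap] tn tP]]]]]; exists t; split=> //.
  pose F := \poly_(i < d) kap (a i).
  have F0 : F != 0.
    apply/eqP => /polyP/(_ i); rewrite coef_poly id coef0.
    by move=> /to_residue_eq0; exact/negP.
  exists (F ^+ j); rewrite expf_neq0 //; split=> // v.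
  have FP w : poly_act fiber_act (F ^+ j) x w = fiber_act ((\sum_(i < d) phi (a i) * x ^+ i) ^+ j) w.
    elim: j w {tP} => [|j ih] w.
      by rewrite !expr0 (@poly_act_wide _ _ _ _ 1) ?size_poly1 // big_ord1 coef1 scale1r.
    rewrite !exprS (poly_actM actP) ih (act_mul actP).
    by apply: poly_act_lift => // b w'; exact: fiber_act_phi.
  rewrite FP -(act_mul actP) mulrC; exact: fiber_act_in_pM.
exists f; split=> // v; have := fP ((kap a)^-1 *: v).
rewrite fiber_act_phi scalerA divff ?scale1r //.
by apply: contra ap => /eqP/to_residue_eq0.
Qed.

Lemma fiber_basis : finite_type phi -> exists d (b : 'I_d -> V), is_basis b.
Proof.
move=> [ys ysgen].
have [u [ue uy]] := @finite_stable _ _ _ _ actP ys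
  [seq tpure phi p (e j) | j <- enum 'I_r] (fun y _ => fiber_algebraic y).
have stab x v : v \in u -> lin_span u (fiber_act x v).
  have := ysgen _ (stable_closed actP u); move=> h; move: v; apply/asboolP; apply: h.
    by move=> a; apply/asboolP => w wu; rewrite fiber_act_phi; exact/lin_spanZ/lin_span_mem.
  by move=> y yys; apply/asboolP => w wu; exact: uy.
apply: (@lin_span_basis _ _ u) => v; have [m [s [sp sv]]] := tens_frac v.
have s0 : kap s != 0 by apply: contra sp => /eqP/to_residue_eq0.
have -> : v = (kap s)^-1 *: tpure phi p m by rewrite -sv scalerA mulVf // scale1r.
apply: lin_spanZ; have [c ->] := eS m; rewrite tpure_sum; apply: lin_span_sum => j _.
rewrite -fiber_act_pure; apply: (lin_span_linear (act_linear actP _)) (stab _) _.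
by apply: ue; apply: map_f; rewrite mem_enum.
Qed.

(** Write an equation of x on V as x^i u with u of nonzero constant term: u then lies
    outside every prime over p that contains x. *)
Lemma fitting x : exists i (u : R), (forall v, fiber_act (x ^+ i * u) v = 0) /\
  forall n, spec_map phi n = p -> (x : R^o) \in n -> (u : R^o) \notin n.
Proof.
have [f [f0 fP]] := fiber_algebraic x.
have ex : exists i, f`_i != 0 by exists (size f).-1; rewrite -lead_coefE lead_coef_eq0.
case: (ex_minnP ex) => i fi imin.
have [a [s [sp aP]]] := residue_fracs (fun j => f`_j) (size f).
have id : (i < size f)%N.
  by rewrite ltnNge; apply: contra fi => h; rewrite nth_default.
have s0 : kap s != 0 by apply: contra sp => /eqP/to_residue_eq0.
exists i, (\sum_(j < size f - i) phi (a (i + j)%N) * x ^+ j); split.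
  move=> v; have := congr1 ( *:%R (kap s)) (fP v); rewrite scaler0 => E0.
  apply: etrans E0; rewrite big_distrr /= /poly_act scaler_sumr.
  have -> : fiber_act (\sum_(j < size f - i) x ^+ i * (phi (a (i + j)%N) * x ^+ j)) v
      = \sum_(j < size f - i) kap s *: (f`_(i + j) *: fiber_act (x ^+ (i + j)) v).
    rewrite (big_morph (fun t => fiber_act t v) (id1 := 0) (op1 := +%R)).
    - apply: eq_bigr => j _; rewrite mulrCA -exprD (act_mul actP) fiber_act_phi scalerA aP //.
      by have := ltn_ord j; lia.
    - by move=> t t'; exact: act_add.
    - exact: act0.
  pose G j := kap s *: (f`_j *: fiber_act (x ^+ j) v).
  rewrite -(big_mkord xpredT (fun j => G (i + j)%N)) -(big_mkord xpredT G).
  rewrite (@big_cat_nat _ _ _ i 0 (size f)) //=; last exact: ltnW.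
  rewrite [X in _ = X + _]big_nat [X in _ = X + _]big1 ?add0r.
    by have := big_addn 0 (size f) i xpredT G; rewrite add0n => ->; apply: eq_bigr => j _; rewrite addnC.
  move=> j /andP[_ ji]; rewrite /G (_ : f`_j = 0) ?scale0r ?scaler0 //.
  by apply/eqP/negPn/negP => /imin; rewrite leqNgt ji.
move=> n np xn; apply/negP => un.
have /negP : (a i : A^o) \notin p.
  apply/negP => /to_residue_eq0; rewrite -aP // => /eqP.
  by rewrite mulf_eq0 (negbTE s0) (negbTE fi).
apply; rewrite -np; suff : (phi (a i) : R^o) \in n by [].
have sf : (0 < size f - i)%N by rewrite subn_gt0.
move: un; rewrite -(prednK sf) big_ord_recl expr0 mulr1 addn0.
set y := \sum_(_ < _) _ => un.
have -> : (phi (a i) : R^o) = (phi (a i) + y : R^o) - (y : R^o) by rewrite addrK.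
apply: (@rpredB R^o n) => //; rewrite /y; apply: (@rpred_sum R^o n) => j _.
rewrite exprS mulrCA mulrC; exact: (@rpredZ R R^o n _ x).
Qed.

(** Some x belongs to exactly one of the two primes; [fitting] gives the two
    operators, in one order or the other. *)
Lemma separation n n' : spec_map phi n = p -> spec_map phi n' = p -> n != n' ->
  exists u s : R, [/\ (u : R^o) \notin n, (s : R^o) \notin n' & forall v, fiber_act s (fiber_act u v) = 0].
Proof.
move=> np n'p /eqP nn'.
have [x] : exists x : R, ((x : R^o) \in n) != ((x : R^o) \in n').
  apply: contrapT => h; apply: nn'; apply: spec_ext => x.
  by apply: contrapT => xE; apply: h; exists x; apply/eqP => E; apply: xE; rewrite E.
have [i [u [uP un]]] := fitting x.
case: (boolP ((x : R^o) \in n)) => xn; case: (boolP ((x : R^o) \in n')) => xn' // _.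
  exists u, (x ^+ i); split; [exact: un|exact: notin_exp|].
  by move=> v; rewrite -(act_mul actP).
exists (x ^+ i), u; split; [exact: notin_exp|exact: un|].
by move=> v; rewrite -(act_mul actP) mulrC.
Qed.

Lemma fiber_dim_esum : finite_type phi ->
  fiber_dim phi M p = (\esum_(n in spec_map phi @^-1` [set p]) local_fiber_dim phi M n)%E
  /\ (fiber_dim phi M p < +oo)%E.
Proof.
move=> ft; have [d [b bB]] := fiber_basis ft.
rewrite /fiber_dim (vdim_basis bB); split; last exact: ltry.
have [|v vP|s [S [sP smax sS <-]]] := support_decomposition actP bB
  (P := [set n | spec_map phi n = p]).
- exact: separation.
- apply: contrapT => v0.
  have [|||a ap|n np|a [ap av]] := @ideal_meets_complement (fun t => fiber_act t v = 0).
  + exact: act0.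
  + by move=> t t' h h'; rewrite (act_add actP) h h' addr0.
  + by move=> t t' h; rewrite (act_mul actP) h (actr0 actP).
  + by rewrite fiber_act_phi (iffRL (to_residue_eq0 _ _) ap) scale0r.
  + exact: vP.
  + by apply: v0; apply: (scale_frac_inj ap); rewrite -fiber_act_phi.
apply: eq_esum => n np; symmetry.
move: b bB S sS (sP n) (smax n); rewrite -np => b bB S sS sn smaxn.
exact: (local_fiber_dim_rank bB sn smaxn (sS n)).
Qed.

End Quasifinite.
End GlobalToLocal.

(** * Passage to R modulo the annihilator of M *)

(** R / Ann M is nonzero only when M is; this alias carries a proof of it, as
    polynomials require nonzero rings. *)
Definition nonzero_ring (S : comPzRingType) (S0 : (1 : S) != 0) : Type := S.
HB.instance Definition _ (S : comPzRingType) (S0 : (1 : S) != 0) :=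
  GRing.ComPzRing.on (nonzero_ring S0).
HB.instance Definition _ (S : comPzRingType) (S0 : (1 : S) != 0) :=
  GRing.PzSemiRing_isNonZero.Build (nonzero_ring S0) S0.

Section DeterminantTrick.
Variables (A R : comPzRingType) (phi : {rmorphism A -> R}) (M : lmodType R) (p : Spec A).
Variables (r : nat) (e : 'I_r -> M).
Hypothesis eS : forall m, exists c : 'rV[R]_r, m = \sum_i c 0 i *: e i.

Let pR (y : R) := in_pM phi p (M := R^o) y.

Lemma in_pM_coord m : in_pM phi p m ->
  exists c : 'I_r -> R, (forall j, pR (c j)) /\ m = \sum_j c j *: e j.
Proof.
move=> [N [a [z [ap ->]]]]; have /choice[c cP] := fun i => eS (z i).
exists (fun j => \sum_(i < N) phi (a i) * c i 0 j); split=> [j|].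
  by apply: (in_pM_sum (M := R^o)) => i _; exact: (in_pM_gen phi (M := R^o)).
under [RHS]eq_bigr do rewrite scaler_suml.
rewrite exchange_big; apply: eq_bigr => i _ /=.
by rewrite cP scaler_sumr; apply: eq_bigr => j _; rewrite scalerA.
Qed.

(** The matrix B = z - (c i j) kills the generators, so det B kills M, and det B is
    congruent to z^r modulo pR. *)
Lemma determinant_trick z : (forall m : M, in_pM phi p (z *: m)) ->
  exists y, pR y /\ z ^+ r - y \in ann M.
Proof.
move=> zM.
have /choice[c cP] : forall i, exists c : 'I_r -> R,
    (forall j, pR (c j)) /\ z *: e i = \sum_j c j *: e j.
  by move=> i; exact/in_pM_coord/zM.
pose B : 'M[R]_r := z%:M - \matrix_(i, j) c i j.
have Be i : \sum_j B i j *: e j = 0.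
  under eq_bigr do rewrite !mxE scalerBl.
  rewrite sumrB (bigD1 i) //= eqxx mulr1n big1 ?addr0 => [|j ji].
    by have [_ ->] := cP i; rewrite subrr.
  by rewrite eq_sym (negbTE ji) mulr0n scale0r.
have detB (m : M) : \det B *: m = 0.
  have [b ->] := eS m; rewrite scaler_sumr big1 // => l _.
  rewrite scalerA mulrC -scalerA; suff -> : \det B *: e l = 0 by rewrite scaler0.
  have : \sum_i \adj B l i *: (\sum_j B i j *: e j) = 0.
    by rewrite big1 // => i _; rewrite Be scaler0.
  under eq_bigr do rewrite scaler_sumr.
  rewrite exchange_big (bigD1 l) //= [X in _ + X]big1 => [|j jl].
    under eq_bigr do rewrite scalerA.
    rewrite -scaler_suml addr0; have /matrixP/(_ l l) := mul_adj_mx B.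
    by rewrite !mxE eqxx mulr1n => ->.
  under eq_bigr do rewrite scalerA.
  rewrite -scaler_suml; have /matrixP/(_ l j) := mul_adj_mx B.
  by rewrite !mxE eq_sym (negbTE jl) mulr0n => ->; rewrite scale0r.
have pRc : submod_closed (fun y : R^o => `[< pR y >]).
  split=> [|a x y /asboolP xp /asboolP yp]; apply/asboolP; first exact: in_pM0.
  by apply: (in_pMD (M := R^o)) => //; exact: (in_pMZ (M := R^o)).
pose I : ideal R := Submod pRc.
have : quotring_pi I (z ^+ r) = quotring_pi I (\det B).
  rewrite -det_map_mx rmorphXn -det_scalar; congr (\det _).
  apply/matrixP => i j; rewrite !mxE raddfB /= raddfMn /=.
  suff -> : quotring_pi I (c i j) = 0 by rewrite subr0.
  rewrite -(rmorph0 (quotring_pi I)); apply/quotring_eqP; rewrite subr0.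
  by apply/asboolP; have [] := cP i.
move=> /quotring_eqP/asboolP h; exists (z ^+ r - \det B); split=> //.
by rewrite subKr; apply/asboolP.
Qed.

End DeterminantTrick.

Section Annihilator.
Variables (A R : comPzRingType) (phi : {rmorphism A -> R}) (M : lmodType R).
Variables (r : nat) (e : 'I_r -> M).
Hypothesis eS : forall m, exists c : 'rV[R]_r, m = \sum_i c 0 i *: e i.
Local Notation S := (quotring (ann M)).
Local Notation pi := (quotring_pi (ann M)).
Local Notation psi := (quotring_pi (ann M) \o phi).

Let oneS (m : S^o) : exists c : 'rV[S]_1, m = \sum_i c 0 i *: (fun=> 1 : S^o) i.
Proof. by exists (const_mx m); rewrite big_ord1 mxE; symmetry; exact: mulr1. Qed.

Lemma annP (a : R) : (a : R^o) \in ann M -> forall m : M, a *: m = 0.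
Proof. by move/asboolP. Qed.

Lemma pi_eq0 (a : R) : pi a = 0 <-> (a : R^o) \in ann M.
Proof. by rewrite -(rmorph0 pi) quotring_eqP subr0. Qed.

Lemma finite_type_generators : finite_type phi -> exists ys : seq R,
  forall (n : Spec R) (T : R -> bool), subring_closed T -> (forall a, T (phi a)) ->
    (forall y, y \in ys -> T y) ->
    forall x, exists g : R, [/\ (g : R^o) \notin n, T g & T (g * x)].
Proof.
move=> [ys ysgen]; exists ys => n T Tc Tphi Ty x; exists 1.
have T1 : T 1 by case: Tc.
by rewrite mul1r; split=> //; [exact: prime_proper|exact: ysgen].
Qed.

(** The module M_n is zero there. *)
Lemma quasi_finite_off_support (n : Spec R) (g : R) : finite_type phi ->
  (g : R^o) \notin n -> (g : R^o) \in ann M -> quasi_finite_at phi M n.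
Proof.
move=> /finite_type_generators[ys ysgen] gn gM.
apply: (algebraic_at_quasi_finite eS (ys := ys)); last exact: ysgen.
move=> y _; exists 1%N, (fun=> 1), 0%N, g; split=> //.
  by exists 0%N => //; exact: prime_proper.
by move=> m; rewrite mulr1 annP //; exact: in_pM0.
Qed.

Section Prime.
Variable n : Spec R.
Hypothesis nM : forall g : R, (g : R^o) \in ann M -> (g : R^o) \in n.

Definition quotient_prime_set (x : S) := exists2 a : R, x = pi a & (a : R^o) \in n.

Lemma quotient_prime_setP a : quotient_prime_set (pi a) <-> (a : R^o) \in n.
Proof.
split=> [[b /quotring_eqP ab bn]|an]; last by exists a.
by rewrite -[a](subrK b); apply: (@rpredD R^o n) => //; exact: nM.
Qed.

Lemma quotient_prime_set_prime : prime_set quotient_prime_set.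
Proof.
split.
- by exists 0; [rewrite rmorph0|exact: (@rpred0 R^o n)].
- move=> _ _ [a -> an] [b -> bn]; exists (a + b); first by rewrite rmorphD.
  exact: (@rpredD R^o n).
- elim/quotring_ind=> a _ [b -> bn]; exists (a * b); first by rewrite rmorphM.
  exact: (@rpredZ R R^o n a b).
- by rewrite -(rmorph1 pi) quotient_prime_setP; exact/negP/prime_proper.
- elim/quotring_ind=> a; elim/quotring_ind=> b; rewrite -rmorphM !quotient_prime_setP.
  exact: prime_mul.
Qed.

Definition quotient_prime : Spec S := spec_of quotient_prime_set_prime.

Lemma quotient_primeP (a : R) : (pi a : S^o) \in quotient_prime <-> (a : R^o) \in n.
Proof. by rewrite spec_ofP quotient_prime_setP. Qed.

Lemma quotient_prime_notin (a : R) : (pi a : S^o) \notin quotient_prime <-> (a : R^o) \notin n.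
Proof. by split; apply: contra => /quotient_primeP. Qed.

Lemma quotient_prime_contr (a : A) : (a : A^o) \in spec_map psi quotient_prime <->
  (a : A^o) \in spec_map phi n.
Proof. exact: (quotient_primeP (phi a)). Qed.

Lemma algebraic_at_of_quotient x : algebraic_at psi S^o quotient_prime (pi x) -> algebraic_at phi M n x.
Proof.
move=> [d [a [j [t [[i id ap] + tP]]]]]; move: t tP; elim/quotring_ind=> t tP.
move=> /quotient_prime_notin tn; exists d, a, j, t; split=> //.
  by exists i => //; apply: contra ap => /quotient_prime_contr.
move=> m; have [N [b [z [bp zE]]]] := tP 1.
have /choice[c cP] : forall i, exists c, z i = pi c.
  by move=> l; move: (z l); elim/quotring_ind=> c; exists c.
have : pi (t * (\sum_(l < d) phi (a l) * x ^+ l) ^+ j - \sum_(l < N) phi (b l) * c l) = 0.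
  rewrite rmorphB rmorphM rmorphXn !rmorph_sum; apply/eqP; rewrite subr_eq0; apply/eqP.
  apply: etrans (_ : _ = \sum_(l < N) psi (b l) *: z l) _; last first.
    by apply: eq_bigr => l _; rewrite cP rmorphM.
  have -> : \sum_(l < d) pi (phi (a l) * x ^+ l) = \sum_(l < d) psi (a l) * pi x ^+ l.
    by apply: eq_bigr => l _; rewrite rmorphM rmorphXn.
  by rewrite -zE; exact: esym (mulr1 _).
move=> /pi_eq0/annP/(_ m); rewrite scalerBl => /eqP; rewrite subr_eq0 => /eqP ->.
rewrite scaler_suml; apply: in_pM_sum => l _; rewrite -scalerA; apply: in_pM_gen.
exact/quotient_prime_contr.
Qed.

End Prime.

Lemma algebraic_at_quotient (nb : Spec S) x :
  algebraic_at phi M (spec_map pi nb) x -> algebraic_at psi S^o nb (pi x).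
Proof.
move=> [d [a [j [t [[i id ap] tn tP]]]]].
have [y [[N [b [z [bp yE]]]] zy]] := determinant_trick eS tP.
exists d, a, (j * r)%N, (pi t ^+ r); split.
- by exists i.
- by apply: notin_exp; exact: tn.
move=> m; have -> : pi t ^+ r * (\sum_(l < d) psi (a l) * pi x ^+ l) ^+ (j * r) = pi y.
  have -> : \sum_(l < d) psi (a l) * pi x ^+ l = pi (\sum_(l < d) phi (a l) * x ^+ l).
    by rewrite rmorph_sum; apply: eq_bigr => l _; rewrite rmorphM rmorphXn.
  transitivity (pi ((t * (\sum_(l < d) phi (a l) * x ^+ l) ^+ j) ^+ r)).
    by rewrite rmorphXn rmorphM rmorphXn exprMn exprM.
  by apply/eqP; rewrite -subr_eq0 -rmorphB; apply/eqP/pi_eq0.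
rewrite yE rmorph_sum scaler_suml; apply: in_pM_sum => l _.
rewrite rmorphM -scalerA; apply: (in_pM_gen psi (M := S^o)).
exact: bp.
Qed.

Lemma finite_type_quotient : finite_type phi -> finite_type psi.
Proof.
move=> [ys ysgen]; exists (map pi ys) => T Tc Tpsi Ty; elim/quotring_ind=> x.
have [T1 TB TM] := Tc.
apply: (ysgen (fun x => T (pi x))) => //.
  split=> [|a b|a b]; rewrite /in_mem /= ?rmorph1 ?rmorphB ?rmorphM //.
    exact: TB.
  exact: TM.
by move=> y yys; apply: Ty; exact: map_f.
Qed.

Lemma quasi_finite_quotient : finite_type phi -> quasi_finite phi M -> quasi_finite psi S^o.
Proof.
move=> ft qf nb; have [ys ysgen] := finite_type_quotient ft.
apply: (@algebraic_at_quasi_finite _ _ psi S^o nb 1 _ oneS ys).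
  move=> y _; move: y; elim/quotring_ind=> x; apply: algebraic_at_quotient.
  exact: quasi_finite_algebraic_at eS _ (qf _).
move=> T Tc Tphi Ty x; exists 1; have T1 : T 1 by case: Tc.
by rewrite mul1r; split=> //; [exact: prime_proper|exact: ysgen].
Qed.

Lemma quasi_finite_of_quotient : finite_type phi -> quasi_finite psi S^o -> quasi_finite phi M.
Proof.
move=> ft qf n.
case: (pselect (forall g : R, (g : R^o) \in ann M -> (g : R^o) \in n)) => nM; last first.
  have /existsNP[g /not_implyP[gM /negP gn]] := nM.
  exact: quasi_finite_off_support gn gM.
have [ys ysgen] := finite_type_generators ft.
apply: (algebraic_at_quasi_finite eS (ys := ys)); last exact: ysgen.
move=> y _; apply: (@algebraic_at_of_quotient n nM).
exact: quasi_finite_algebraic_at oneS _ (qf _).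
Qed.

End Annihilator.

(** * Openness and the theorem *)

Section Openness.
Variables (A R : comPzRingType) (phi : {rmorphism A -> R}) (M : lmodType R).
Variables (r : nat) (e : 'I_r -> M).
Hypothesis eS : forall m, exists c : 'rV[R]_r, m = \sum_i c 0 i *: e i.
Hypothesis ft : finite_type phi.
Local Notation pi := (quotring_pi (ann M)).
Local Notation psi := (quotring_pi (ann M) \o phi).

Section Nonzero.
Hypothesis S0 : (1 : quotring (ann M)) != 0.
Local Notation S := (nonzero_ring S0).

Lemma scalars_closed : subring_closed (fun y : S => `[< exists a, y = psi a >]).
Proof.
split=> [|y z /asboolP[a ->] /asboolP[b ->]|y z /asboolP[a ->] /asboolP[b ->]]; apply/asboolP.
- by exists 1; rewrite rmorph1.
- by exists (a - b); rewrite rmorphB.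
- by exists (a * b); rewrite rmorphM.
Qed.

Definition scalars : subring S := Subring scalars_closed.

Lemma scalars_mem a : (psi a : S) \in scalars.
Proof. by apply/asboolP; exists a. Qed.

Lemma residually_algebraic_of_algebraic_at (nb : Spec (quotring (ann M))) (x : quotring (ann M)) :
  prime_set (fun y : S => (y : (quotring (ann M))^o) \in nb) ->
  algebraic_at psi (quotring (ann M))^o nb x ->
  residually_algebraic scalars (fun y : S => (y : (quotring (ann M))^o) \in nb) x.
Proof.
move=> qP [d [a [j [t [[i id ap] tn tP]]]]].
pose F : {poly S} := \poly_(l < d) (psi (a l) : S).
exists (F ^+ j), t; split.
- by apply/rpredX/polyOver_poly => l _; exact: scalars_mem.
- have Fq : ~ (forall l, (F`_l : (quotring (ann M))^o) \in nb).
    by move=> /(_ i); rewrite coef_poly id; exact/negP.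
  elim: j {tP} => [/(_ 0%N)|j ih]; first by rewrite coef1; exact: (prime_set1 qP).
  by rewrite exprS => /(prime_set_polyM qP)[].
- exact/negP.
- have [N [b [z [bp zE]]]] := tP 1.
  exists N, (fun l => psi (b l) : S), (fun l => z l : S); split=> [l|].
    by split; [exact: scalars_mem|exact: bp].
  apply: etrans zE; rewrite horner_exp horner_poly.
  exact: esym (mulr1 _).
Qed.

(** Zariski's main theorem for R / Ann M at a prime where M is quasi-finite. *)
Lemma birational_integral (nb : Spec (quotring (ann M))) :
    quasi_finite_at phi M (spec_map pi nb) ->
  exists g : R, (g : R^o) \notin spec_map pi nb /\
    forall x, exists k, integral scalars (pi (g ^+ k * x) : S) /\ integral scalars (pi g : S).
Proof.
move=> qf; have qP : prime_set (fun y : S => (y : (quotring (ann M))^o) \in nb).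
  split.
  - exact: (@rpred0 (quotring (ann M))^o nb).
  - by move=> a b; exact: (@rpredD (quotring (ann M))^o nb).
  - by move=> a b; exact: (@rpredZ (quotring (ann M)) (quotring (ann M))^o nb a b).
  - exact/negP/prime_proper.
  - exact: prime_mul.
have [ys ysgen] := finite_type_quotient M ft.
have [||g [gq gD gP]] := @zariski_main _ S scalars _ ys erefl qP.
- exists [:: 1] => s.
  have sD : s \in adjoins scalars ys.
    apply: (ysgen (fun s => (s : S) \in adjoins scalars ys)) => [|a|y].
    + split; [exact: (@rpred1 S (adjoins scalars ys))|move=> y z yD zD|move=> y z yD zD].
        exact: (@rpredB S (adjoins scalars ys)).
      exact: (@rpredM S (adjoins scalars ys)).
    + exact/adjoins_base/scalars_mem.
    + by move=> yys; exact: (@adjoins_gen S scalars ys y yys).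
  by exists (fun=> s); rewrite big_ord1 mulr1.
- move=> s; apply: residually_algebraic_of_algebraic_at => //.
  move: s; elim/quotring_ind=> x; apply: (algebraic_at_quotient eS).
  exact: quasi_finite_algebraic_at eS _ qf.
move: g gq gD gP; elim/quotring_ind=> g gq gD gP; exists g; split; first exact/negP.
by move=> x; have [k kP] := gP (pi x); exists k; split; [rewrite rmorphM rmorphXn; exact: kP|exact: gD].
Qed.

(** The leading coefficient 1 of an integral equation is outside every prime. *)
Lemma algebraic_at_of_integral (n : Spec R) (x : R) :
    (forall g : R, (g : R^o) \in ann M -> (g : R^o) \in n) ->
  integral scalars (pi x : S) -> algebraic_at phi M n x.
Proof.
move=> nM [p [pm /polyOverP pD /rootP px]].
have /choice[a aP] : forall i, exists a, p`_i = psi a by move=> i; have /asboolP := pD i.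
exists (size p), a, 1%N, 1; split.
- have sp : (0 < size p)%N by rewrite size_poly_gt0 monic_neq0.
  exists (size p).-1; first by rewrite prednK.
  apply/negP => an; have /negP := prime_proper n; apply.
  have an' : (phi (a (size p).-1) : R^o) \in n := an.
  rewrite (_ : (1 : R^o) = (1 - phi (a (size p).-1) : R^o) + (phi (a (size p).-1) : R^o)); last by rewrite subrK.
  apply: (@rpredD R^o n) => //; apply: nM; apply/pi_eq0.
  have pa : pi (phi (a (size p).-1)) = 1.
    by apply: etrans (esym (aP _)) _; exact: (monicP pm).
  by rewrite rmorphB rmorph1; apply/eqP; rewrite subr_eq0; apply/eqP; exact: esym pa.
- exact: prime_proper.
- move=> m; rewrite mul1r expr1 annP; first exact: in_pM0.
  apply/pi_eq0; rewrite rmorph_sum; apply: etrans px; rewrite horner_coef.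
  by apply: eq_bigr => i _; rewrite aP rmorphM rmorphXn.
Qed.

End Nonzero.

(** Either some element of Ann M is outside n, or Zariski's main theorem applies to
    R / Ann M; where g is nonzero, g and the elements g^k y generate R up to powers
    of g. *)
Lemma quasi_finite_open_nbhs (n : Spec R) : quasi_finite_at phi M n ->
  exists g : R, (g : R^o) \notin n /\
    forall n' : Spec R, (g : R^o) \notin n' -> quasi_finite_at phi M n'.
Proof.
move=> qf.
case: (pselect (forall g : R, (g : R^o) \in ann M -> (g : R^o) \in n)) => nM; last first.
  have /existsNP[g /not_implyP[gM /negP gn]] := nM.
  by exists g; split=> // n' gn'; exact: quasi_finite_off_support gn' gM.
have S0 : (1 : quotring (ann M)) != 0.
  apply/eqP => /(pi_eq0 M 1)/nM; exact/negP/prime_proper.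
pose nb := quotient_prime nM.
have nbE : spec_map pi nb = n.
  by apply: spec_ext => a; exact: (quotient_primeP nM a).
have [|g [gn gP]] := @birational_integral S0 nb; first by rewrite nbE.
rewrite nbE in gn; exists g; split=> // n' gn'.
case: (pselect (forall g : R, (g : R^o) \in ann M -> (g : R^o) \in n')) => n'M; last first.
  have /existsNP[h /not_implyP[hM /negP hn]] := n'M.
  exact: quasi_finite_off_support hn hM.
have [k kP] := choice gP; have [ys ysgen] := ft.
apply: (algebraic_at_quasi_finite eS (ys := g :: [seq g ^+ k y * y | y <- ys])).
  move=> y; rewrite inE => /predU1P[->|/mapP[x _ ->]]; apply: (@algebraic_at_of_integral S0) => //.
    by have [] := kP 1.
  by have [] := kP x.
move=> T Tc Tphi Ty x; have [T1 TB TM] := Tc.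
have Tg : T g by apply: Ty; rewrite inE eqxx.
have TX y i : T y -> T (y ^+ i).
  by move=> h; elim: i => [|i ih]; rewrite ?expr0 // exprS; exact: TM.
have /asboolP[i ix] : `[< exists i, T (g ^+ i * x) >].
  apply: (ysgen (fun x => `[< exists i, T (g ^+ i * x) >])).
  - split=> [|y z /asboolP[i iy] /asboolP[j jz]|y z /asboolP[i iy] /asboolP[j jz]]; apply/asboolP.
    + by exists 0%N; rewrite mulr1.
    + exists (i + j)%N; rewrite mulrBr [in X in X - _]addnC !exprD -!mulrA.
      by apply: TB; apply: TM => //; exact: TX.
    + by exists (i + j)%N; rewrite exprD mulrACA; exact: TM.
  - by move=> a; apply/asboolP; exists 0%N; rewrite mul1r.
  - move=> y yys; apply/asboolP; exists (k y); apply: Ty.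
    by rewrite inE; apply/orP; right; exact: (map_f (fun y => g ^+ k y * y)).
by exists (g ^+ i); split=> //; [exact: notin_exp|exact: TX].
Qed.

End Openness.

Lemma local_fiber_dim_le_esum (A R : comPzRingType) (phi : {rmorphism A -> R}) (M : lmodType R)
    (P : set (Spec R)) n : P n ->
  (local_fiber_dim phi M n <= \esum_(n in P) local_fiber_dim phi M n)%E.
Proof.
move=> Pn; rewrite -(@esum_set1 _ _ n (local_fiber_dim phi M)); last exact: vdim_ge0.
rewrite [leRHS](esumID [set n]) => [|i _]; last exact: vdim_ge0.
have -> : P `&` [set n] = [set n] by apply/seteqP; split=> [x []|x ->].
by rewrite leeDl // esum_ge0 // => i _; exact: vdim_ge0.
Qed.

Theorem proposition47 (A R : comPzRingType) (phi : {rmorphism A -> R})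
    (M : lmodType R) (hR : finite_type phi) (hM : finitely_presented M) :
  [<-> quasi_finite phi M;
       forall p : Spec A,
         fiber_dim phi M p =
           (\esum_(n in spec_map phi @^-1` [set p]) local_fiber_dim phi M n)%E /\
         (\esum_(n in spec_map phi @^-1` [set p]) local_fiber_dim phi M n < +oo)%E;
       quasi_finite_map (quotring_pi (ann M) \o phi)] /\
  open [set n : Spec R | quasi_finite_at phi M n].
Proof.
have [_ [r [e [_ [eS _]]]]] := hM; split; first split.
- move=> qf p; have [E fin] := fiber_dim_esum eS (fun n (_ : spec_map phi n = p) => qf n) hR.
  by rewrite -E.
- split=> [fin|[_ qf]].
    split; first exact: finite_type_quotient.
    apply: (quasi_finite_quotient eS hR) => n; have [_ lt] := fin (spec_map phi n).
    by apply: le_lt_trans lt; exact: local_fiber_dim_le_esum.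
  exact: (quasi_finite_of_quotient eS hR).
suff : zariski_open [set n : Spec R | quasi_finite_at phi M n] by [].
exists [set g : R | forall n : Spec R, (g : R^o) \notin n -> quasi_finite_at phi M n].
apply/seteqP; split=> n /=.
  move=> /(quasi_finite_open_nbhs eS hR)[g [gn gP]] h.
  by move/negP: gn; apply; exact: h.
by move=> /existsNP[g /not_implyP[gP /negP gn]]; exact: gP.
Qed.
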